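(* Fix a root system $\Phi$ of finite or affine type and a Coxeter element $c$. The assignment $(\alpha,\beta)\mapsto(\alpha\|\beta)_c$ on $\Phi_c\times\Phi_c$ is the unique function satisfying: (i) $(-\alpha_i\|\beta)_c=[\beta:\alpha_i]$ for every simple root $\alpha_i$ and $\beta\in\Phi_c$; (ii) $(\beta\|-\alpha_i)_c=[\beta^\vee:\alpha_i^\vee]$ for every simple root $\alpha_i$ and $\beta\in\Phi_c$; (iii) $(\alpha\|\beta)_c=(\alpha\|\beta)^\circ_c$ for $\alpha,\beta\in\Upsilon^{\mathrm{re}}_c$; (iv) $(\delta\|\alpha)_c=(\alpha\|\delta)_c=0$ for $\alpha\in\Upsilon^{\mathrm{re}}_c\cup\{\delta\}$; (vi) $(\alpha\|\beta)_c=(\tau_c\alpha\|\tau_c\beta)_c$ for $\alpha,\beta\in\Phi_c$. (In finite type, (iii) and (iv) are vacuous.)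
   Context: $A=[a_{ij}]$ is an $n\times n$ symmetrizable Cartan matrix (finite or affine type) with symmetrizing constants $d_i$; $V$ has basis of simple roots $\Pi=\{\alpha_1,\dots,\alpha_n\}$, co-roots $\alpha_i^\vee=d_i^{-1}\alpha_i$, symmetric form $K(\alpha_i^\vee,\alpha_j)=a_{ij}$, reflections $s_i(v)=v-K(\alpha_i^\vee,v)\alpha_i$. $\Phi$ is the root system, $\Phi^+$ the positive roots, $[v:\alpha_i]$, $[v:\alpha_i^\vee]$ coordinates in the root and co-root bases, $[x]_+=\max(x,0)$, $\beta^\vee=\frac2{K(\beta,\beta)}\beta$ for real roots, $(-\alpha_i)^\vee=-\alpha_i^\vee$. The Coxeter element is indexed $c=s_1\cdots s_n$. $\sigma_i$ on $-\Pi\cup\Phi^+$ is $\sigma_i(\alpha)=\alpha$ for $\alpha\in-\Pi\setminus\{-\alpha_i\}$ and $s_i\alpha$ otherwise; $\tau_c=\sigma_1\sigma_2\cdots\sigma_n$ (a permutation of $\Phi_c$). Finite type: $\Phi_c=\Phi^+\cup-\Pi$, $\Upsilon^{\mathrm{re}}_c=\emptyset$, $(\alpha\|\beta)_c=\max[(\alpha\|\beta)^{\to}_c,(\alpha\|\beta)^{\leftarrow}_c]$ with $(\alpha\|\beta)_c^{\to}=-\sum_{i}[\alpha^\vee:\alpha_i^\vee][\beta:\alpha_i]-\sum_{j<i}a_{ij}[\alpha^\vee:\alpha_i^\vee]_+[\beta:\alpha_j]_+$ and $(\alpha\|\beta)_c^{\leftarrow}=-\sum_{i}[\alpha^\vee:\alpha_i^\vee][\beta:\alpha_i]-\sum_{i<j}a_{ij}[\alpha^\vee:\alpha_i^\vee]_+[\beta:\alpha_j]_+$.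 Affine type: $\delta$ is the positive imaginary root closest to $0$, $\delta^\vee$ the positive imaginary root closest to $0$ of the dual root system (Cartan matrix $A^T$). With $\alpha_{\mathrm{aff}}$ the affine simple root, $V_{\mathrm{fin}}$ the span of the others, $\Phi_{\mathrm{fin}}=\Phi\cap V_{\mathrm{fin}}$: $\gamma_c\in V_{\mathrm{fin}}$ is unique with $c\gamma_c=\gamma_c+\delta$, $U_c=\{v:K(\gamma_c,v)=0\}$, $\Upsilon_c=\Phi\cap U_c$, $\Upsilon^{\mathrm{re}}_c$ the positive real roots of $U_c$ whose $c$-orbit contains a root of $\Phi_{\mathrm{fin}}$, $\Phi_c=-\Pi\cup(\Phi^+\setminus U_c)\cup\Upsilon^{\mathrm{re}}_c\cup\{\delta\}$. The real roots of $\Upsilon_c$ form a root system with irreducible components of affine type A; $\Pi_c$ is the unique minimal subset of $\Upsilon_c\cap\Phi^+$ whose nonnegative span contains $\Upsilon_c\cap\Phi^+$. Tube support $\mathrm{Supp}_{\Pi_c}(\beta)$ of a real root of $\Upsilon_c$: elements of $\Pi_c$ with nonzero coefficient in its unique expansion in simple roots of its component; unions for sets; component-full means containing all simple roots of some component. $\beta_j\in\Pi_c$ is adjacent to $\alpha$ if $\beta_j\in\mathrm{Supp}_{\Pi_c}(c\alpha)\cup\mathrm{Supp}_{\Pi_c}(c^{-1}\alpha)$ and $\beta_j\notin\mathrm{Supp}_{\Pi_c}(\alpha)$; $\mathrm{adj}(\alpha,\beta)$ counts elements of $\mathrm{Supp}_{\Pi_c}(\beta)$ adjacent to $\alpha$.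 $(\alpha\|\beta)^\circ_c$ is $-1$ if $\alpha=\beta$, $0$ if one tube support is properly contained in the other, $\mathrm{adj}(\alpha,\beta)$ otherwise. $(\alpha\|\beta)_c=\mathrm{adj}(\alpha,\beta)$ if $\alpha,\beta\in\Upsilon^{\mathrm{re}}_c$ and $\{\alpha,\beta\}$ is component-full, else $\max[(\alpha\|\beta)^{\to}_c,(\alpha\|\beta)^{\leftarrow}_c]$. *)

(* Defs.v *)
(* Root systems of finite / affine type given by a
   symmetrizable Cartan matrix, Coxeter element c = s_1 ... s_n, the set
   Phi_c, the map tau_c and the compatibility degree (alpha || beta)_c.
   Vectors of V are row vectors 'rV[rat]_n of coordinates in the basis of
   simple roots: v 0 i = [v : alpha_i].  Indices are 0-based, so the
   paper's s_1 ... s_n is s_0 ... s_(n-1) here (same order). *)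
From HB Require Import structures.
From mathcomp Require Import all_boot all_order all_algebra.
From mathcomp Require Import boolp.
From Stdlib Require Import Relations.Relation_Operators.

Set Implicit Arguments.
Unset Strict Implicit.
Unset Printing Implicit Defensive.

Import Order.TTheory GRing.Theory Num.Theory.
Local Open Scope ring_scope.

Definition sroot (n : nat) (i : 'I_n) : 'rV[rat]_n := delta_mx 0 i.

Definition Kf n (A : 'M[int]_n) (d : 'I_n -> rat) (u v : 'rV[rat]_n) : rat :=
  \sum_(i < n) \sum_(j < n) u 0 i * v 0 j * d i * (A i j)%:~R.

(* K(alpha_i^vee, v) = sum_j a_ij [v : alpha_j] *)
Definition pairc n (A : 'M[int]_n) (i : 'I_n) (v : 'rV[rat]_n) : rat :=
  \sum_(j < n) (A i j)%:~R * v 0 j.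

Definition refl n (A : 'M[int]_n) (i : 'I_n) (v : 'rV[rat]_n) : 'rV[rat]_n :=
  v - pairc A i v *: sroot i.

Definition sym_cartan n (A : 'M[int]_n) (d : 'I_n -> rat) : Prop :=
  [/\ forall i, A i i = 2,
      forall i j, i != j -> A i j <= 0,
      forall i j, A i j = 0 -> A j i = 0,
      forall i, 0 < d i
    & forall i j, d i * (A i j)%:~R = d j * (A j i)%:~R].

Definition indecomposable n (A : 'M[int]_n) : Prop :=
  forall S : {set 'I_n}, S != set0 -> S != setT ->
    exists i j, [/\ i \in S, j \notin S & A i j != 0].

Definition finite_type n (A : 'M[int]_n) (d : 'I_n -> rat) : Prop :=
  forall v : 'rV[rat]_n, v != 0 -> 0 < Kf A d v v.

Definition affine_type n (A : 'M[int]_n) (d : 'I_n -> rat) : Prop :=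
  [/\ indecomposable A,
      forall v : 'rV[rat]_n, 0 <= Kf A d v v
    & \rank (map_mx (fun x : int => x%:~R : rat) A) = n.-1].

Inductive real_root n (A : 'M[int]_n) : 'rV[rat]_n -> Prop :=
  | RR_simple (i : 'I_n) : real_root A (sroot i)
  | RR_refl (i : 'I_n) (v : 'rV[rat]_n) : real_root A v -> real_root A (refl A i v).

Definition intvec n (v : 'rV[rat]_n) : Prop :=
  exists z : 'rV[int]_n, v = map_mx (fun x : int => x%:~R : rat) z.

(* imaginary roots (affine type): nonzero integer vectors in the radical
   of K, i.e. the nonzero integer multiples of delta; none in finite type *)
Definition imag_root n (M : 'M[int]_n) (v : 'rV[rat]_n) : Prop :=
  [/\ v != 0, intvec v & forall i, \sum_(j < n) (M i j)%:~R * v 0 j = 0].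

Definition root n (A : 'M[int]_n) (v : 'rV[rat]_n) : Prop :=
  real_root A v \/ imag_root A v.

Definition pos n (v : 'rV[rat]_n) : Prop := forall i, 0 <= v 0 i.

(* delta = the positive imaginary root closest to 0 (for M = A);
   for M = A^T this gives delta^vee in co-root coordinates *)
Definition is_delta n (M : 'M[int]_n) (v : 'rV[rat]_n) : Prop :=
  [/\ imag_root M v, pos v &
      forall w, imag_root M w -> pos w -> forall i, v 0 i <= w 0 i].

Definition is_negsimple n (v : 'rV[rat]_n) : Prop := exists i, v = - sroot i.

Definition cox n (A : 'M[int]_n) (v : 'rV[rat]_n) : 'rV[rat]_n :=
  foldr (fun i w => refl A i w) v (enum 'I_n).
Definition coxinv n (A : 'M[int]_n) (v : 'rV[rat]_n) : 'rV[rat]_n :=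
  foldl (fun w i => refl A i w) v (enum 'I_n).

Definition sigma n (A : 'M[int]_n) (i : 'I_n) (v : 'rV[rat]_n) : 'rV[rat]_n :=
  if [exists j, (j != i) && (v == - sroot j)] then v else refl A i v.
Definition tau n (A : 'M[int]_n) (v : 'rV[rat]_n) : 'rV[rat]_n :=
  foldr (fun i w => sigma A i w) v (enum 'I_n).

Definition pospart (x : rat) : rat := Num.max x 0.

(* ca i = [alpha^vee : alpha_i^vee] *)
Definition compat_right n (A : 'M[int]_n) (ca : 'I_n -> rat) (b : 'rV[rat]_n) : rat :=
  - (\sum_(i < n) ca i * b 0 i)
  - \sum_(i < n) \sum_(j < n | (j < i)%N)
        (A i j)%:~R * pospart (ca i) * pospart (b 0 j).
Definition compat_left n (A : 'M[int]_n) (ca : 'I_n -> rat) (b : 'rV[rat]_n) : rat :=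
  - (\sum_(i < n) ca i * b 0 i)
  - \sum_(i < n) \sum_(j < n | (i < j)%N)
        (A i j)%:~R * pospart (ca i) * pospart (b 0 j).

(* co-root coordinates of a real root: beta^vee = 2 beta / K(beta,beta),
   [v : alpha_i^vee] = d_i [v : alpha_i] *)
Definition corc n (A : 'M[int]_n) (d : 'I_n -> rat) (v : 'rV[rat]_n) (i : 'I_n) : rat :=
  d i * (2 / Kf A d v v) * v 0 i.

Definition PhiC_fin n (A : 'M[int]_n) (v : 'rV[rat]_n) : Prop :=
  (root A v /\ pos v) \/ is_negsimple v.

Definition compat_fin n (A : 'M[int]_n) (d : 'I_n -> rat) (a b : 'rV[rat]_n) : rat :=
  Num.max (compat_right A (corc A d a) b) (compat_left A (corc A d a) b).

Definition axioms_fin n (A : 'M[int]_n) (d : 'I_n -> rat)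
    (f : 'rV[rat]_n -> 'rV[rat]_n -> rat) : Prop :=
  [/\ (* (i) *) forall i b, PhiC_fin A b -> f (- sroot i) b = b 0 i,
      (* (ii) *) forall i b, PhiC_fin A b -> f b (- sroot i) = corc A d b i
    & (* (vi) *) forall a b, PhiC_fin A a -> PhiC_fin A b -> f a b = f (tau A a) (tau A b)].

(* Data: delta, dv = coordinates of delta^vee in the co-root basis,
   aff = index of the affine simple root, g = gamma_c, P = Pi_c. *)

Definition corc_aff n (A : 'M[int]_n) (d : 'I_n -> rat) (delta dv : 'rV[rat]_n)
    (v : 'rV[rat]_n) (i : 'I_n) : rat :=
  if v == delta then dv 0 i else corc A d v i.

Definition Phi_fin n (A : 'M[int]_n) (aff : 'I_n) (v : 'rV[rat]_n) : Prop :=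
  root A v /\ v 0 aff = 0.

Definition Uc n (A : 'M[int]_n) (d : 'I_n -> rat) (g v : 'rV[rat]_n) : Prop :=
  Kf A d g v = 0.

Definition Ups_re n (A : 'M[int]_n) (d : 'I_n -> rat) (aff : 'I_n) (g v : 'rV[rat]_n)
    : Prop :=
  [/\ real_root A v, pos v, Uc A d g v &
      exists m : nat, Phi_fin A aff (iter m (cox A) v) \/
                      Phi_fin A aff (iter m (coxinv A) v)].

Definition PhiC_aff n (A : 'M[int]_n) (d : 'I_n -> rat) (aff : 'I_n)
    (delta g v : 'rV[rat]_n) : Prop :=
  [\/ is_negsimple v, [/\ root A v, pos v & ~ Uc A d g v],
      Ups_re A d aff g v | v = delta].

Definition Ups_pos n (A : 'M[int]_n) (d : 'I_n -> rat) (g v : 'rV[rat]_n) : Prop :=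
  [/\ root A v, pos v & Uc A d g v].

Definition nonneg_span n (S : 'rV[rat]_n -> Prop) (v : 'rV[rat]_n) : Prop :=
  exists s : seq ('rV[rat]_n * rat),
    (forall x, x \in s -> S x.1 /\ 0 <= x.2) /\ v = \sum_(x <- s) x.2 *: x.1.

Definition spans_Ups n (A : 'M[int]_n) (d : 'I_n -> rat) (g : 'rV[rat]_n)
    (S : 'rV[rat]_n -> Prop) : Prop :=
  forall v, Ups_pos A d g v -> nonneg_span S v.

Definition is_Pic n (A : 'M[int]_n) (d : 'I_n -> rat) (g : 'rV[rat]_n)
    (P : seq 'rV[rat]_n) : Prop :=
  [/\ uniq P, forall x, x \in P -> Ups_pos A d g x,
      spans_Ups A d g (fun x => x \in P) &
      forall S : 'rV[rat]_n -> Prop, (forall x, S x -> x \in P) ->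
        spans_Ups A d g S -> forall x, x \in P -> S x].

(* the simple roots (in Pi_c) of an irreducible component of the root
   system formed by the real roots of Upsilon_c: a maximal connected
   (for non-orthogonality) set of real elements of Pi_c *)
Definition is_component n (A : 'M[int]_n) (d : 'I_n -> rat) (P C : seq 'rV[rat]_n)
    : Prop :=
  [/\ uniq C, C != [::],
      forall x, x \in C -> x \in P /\ real_root A x,
      forall x y, x \in C -> y \in C ->
        clos_refl_trans _ (fun a b => [/\ a \in C, b \in C & Kf A d a b != 0]) x y &
      forall x y, x \in C -> y \in P -> real_root A y -> Kf A d x y != 0 -> y \in C].

Definition in_supp n (A : 'M[int]_n) (d : 'I_n -> rat) (P : seq 'rV[rat]_n)
    (b g' : 'rV[rat]_n) : Prop :=
  exists C, is_component A d P C /\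
    exists ks : seq rat, [/\ size ks = size C,
      b = \sum_(k < size C) ks`_k *: C`_k &
      exists k, (k < size C)%N /\ C`_k = g' /\ ks`_k != 0].

Definition supp n (A : 'M[int]_n) (d : 'I_n -> rat) (P : seq 'rV[rat]_n)
    (b : 'rV[rat]_n) : seq 'rV[rat]_n :=
  [seq x <- P | `[< in_supp A d P b x >]].

Definition adjacent n (A : 'M[int]_n) (d : 'I_n -> rat) (P : seq 'rV[rat]_n)
    (a x : 'rV[rat]_n) : bool :=
  (x \in supp A d P (cox A a) ++ supp A d P (coxinv A a)) && (x \notin supp A d P a).

Definition adj n (A : 'M[int]_n) (d : 'I_n -> rat) (P : seq 'rV[rat]_n)
    (a b : 'rV[rat]_n) : nat :=
  count (adjacent A d P a) (supp A d P b).

Definition proper_sub n (s t : seq 'rV[rat]_n) : bool :=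
  all (fun x => x \in t) s && ~~ all (fun x => x \in s) t.

Definition compat_circ n (A : 'M[int]_n) (d : 'I_n -> rat) (P : seq 'rV[rat]_n)
    (a b : 'rV[rat]_n) : rat :=
  if a == b then -1
  else if proper_sub (supp A d P a) (supp A d P b)
          || proper_sub (supp A d P b) (supp A d P a) then 0
  else (adj A d P a b)%:R.

Definition component_full n (A : 'M[int]_n) (d : 'I_n -> rat) (P : seq 'rV[rat]_n)
    (a b : 'rV[rat]_n) : Prop :=
  exists C, is_component A d P C /\
    forall x, x \in C -> x \in supp A d P a ++ supp A d P b.

Definition compat_aff n (A : 'M[int]_n) (d : 'I_n -> rat) (aff : 'I_n)
    (delta dv g : 'rV[rat]_n) (P : seq 'rV[rat]_n) (a b : 'rV[rat]_n) : rat :=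
  if `[< [/\ Ups_re A d aff g a, Ups_re A d aff g b & component_full A d P a b] >]
  then (adj A d P a b)%:R
  else Num.max (compat_right A (corc_aff A d delta dv a) b)
               (compat_left A (corc_aff A d delta dv a) b).

Definition axioms_aff n (A : 'M[int]_n) (d : 'I_n -> rat) (aff : 'I_n)
    (delta dv g : 'rV[rat]_n) (P : seq 'rV[rat]_n)
    (f : 'rV[rat]_n -> 'rV[rat]_n -> rat) : Prop :=
  let PhiC := PhiC_aff A d aff delta g in
  [/\ (* (i) *) forall i b, PhiC b -> f (- sroot i) b = b 0 i,
      (* (ii) *) forall i b, PhiC b -> f b (- sroot i) = corc_aff A d delta dv b i,
      (* (iii) *) forall a b, Ups_re A d aff g a -> Ups_re A d aff g b ->
                    f a b = compat_circ A d P a b,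
      (* (iv) *) forall a, Ups_re A d aff g a \/ a = delta ->
                    f delta a = 0 /\ f a delta = 0
    & (* (vi) *) forall a b, PhiC a -> PhiC b -> f a b = f (tau A a) (tau A b)].

(* alpha_aff is the affine node (Kac's alpha_0): [delta^vee : alpha_aff^vee] = 1
   and theta = delta - [delta : alpha_aff] alpha_aff is a root *)
Definition affine_node n (A : 'M[int]_n) (delta dv : 'rV[rat]_n) (aff : 'I_n) : Prop :=
  dv 0 aff = 1 /\ root A (delta - delta 0 aff *: sroot aff).

(* Main.v *)
(** Split the symmetrized Cartan matrix as [K = ef + ef^T], where [ef] is lower
    triangular with diagonal [d] (the Euler form of the Coxeter element).  Then
    [ef (c x) y = - ef y x], so [c] is an isometry of [ef].  On positive vectors
    the two candidate values of the compatibility degree are [- ef] of the pair in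
    the two orders, divided by the half norm; and [tau_c] is [c], except that it
    sends [- alpha_i] to the root representing the [i]-th coordinate by [ef] on the
    left, and sends the root representing it on the right to [- alpha_i].
    Hence the degree is [tau_c]-invariant.

    A root whose [c]-orbit leaves the positive cone has a [tau_c]-orbit through
    [- Pi], and there the axioms determine the degree.  Orbits of real roots are
    finite modulo the radical, which gives this for every root of finite type, and
    in affine type for every root with [ef delta v != 0]; the remaining roots are
    those of [U_c].

    In affine type [c] permutes the real elements of [Pi_c].  If [x] is one of them
    in the finite root system, then [K (x, c x) != 0]: otherwise, comparing
    [delta]-translates with their expansions in [Pi_c], one finds [z] and [c z] in
    distinct components of [Pi_c] and both in the finite root system, where a descent
    yields a real root of [U_c] orthogonal to neither component; there is none.
    So [ef] on that orbit is the one of a cyclic quiver, the roots of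
    [Upsilon_c^re] are the sums [x + c x + ... + c^(l-1) x] over proper arcs of such
    cycles, and the degree of two arcs is read off from their end points. *)

(* Roots enter through the lattice condition [rootlike] instead of through reduced words: it is
   stable under all reflections, yields sign coherence from integrality and semidefiniteness alone,
   and passes to the subsystem without the affine node, where a real root of [A] is not visibly
   generated by the remaining reflections. On U_c uniqueness is immediate, because (iii) and (iv)
   prescribe the values; the cost lies in proving (iii), which needs the structure of the tubes. It
   is derived here and not taken from a classification. The tool is the defect [ef delta v], which
   is constant on c-orbits: roots of negative defect pair nonnegatively with roots whose whole orbit
   is positive. Both sign estimates against an orbit with K (x, c x) = 0 ([bad_aff_le] and
   [link_pair]) come from this. Expansions in Pi_c are not unique, since the sums over two orbits
   are proportional. The condition that the orbit of a root of Upsilon_c^re meets Phi_fin repairs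
   this: inside Phi_fin the form is definite and some element of each orbit of Pi_c has coefficient
   0, so that a root is confined to one orbit and has a start there. *)
Require Import Defs.
From HB Require Import structures.
From mathcomp Require Import all_boot all_order all_algebra.
From mathcomp Require Import boolp.
From mathcomp Require Import ring lra zify.
From Stdlib Require Import Relations.Relation_Operators.
Import Order.TTheory GRing.Theory Num.Theory.
Local Open Scope ring_scope.
Set Implicit Arguments.
Unset Strict Implicit.
Unset Printing Implicit Defensive.

(* [lra] chokes on equations between vectors, in hypotheses or in the goal. *)
Ltac row_lra :=
  intros;
  repeat match goal with H : @eq ?T _ _ |- _ =>
    assert_fails (unify T rat); clear H end;
  repeat match goal with H : _ -> _ |- _ => clear H end;
  try match goal with |- @eq ?T _ _ => assert_fails (unify T rat); exfalso end;
  lra.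

(** * The Euler form of the Coxeter element *)

Section EulerForm.
Variables (n : nat) (A : 'M[int]_n) (d : 'I_n -> rat).
Implicit Types (u v w : 'rV[rat]_n) (i j : 'I_n) (l : seq 'I_n).

Definition lowc i j : rat := if (j < i)%N then (A i j)%:~R else (i == j)%:R.
Definition uppc i j : rat := if (i < j)%N then (A i j)%:~R else (i == j)%:R.

Definition efmx : 'M[rat]_n := \matrix_(i, j) (d i * lowc i j).
Definition ef v w : rat := (v *m efmx *m w^T) 0 0.

Lemma efDl u v w : ef (u + v) w = ef u w + ef v w.
Proof. by rewrite /ef !mulmxDl mxE. Qed.
Lemma efDr u v w : ef u (v + w) = ef u v + ef u w.
Proof. by rewrite /ef linearD mulmxDr mxE. Qed.
Lemma efZl a v w : ef (a *: v) w = a * ef v w.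
Proof. by rewrite /ef -!scalemxAl mxE. Qed.
Lemma efZr a v w : ef v (a *: w) = a * ef v w.
Proof. by rewrite /ef linearZ -scalemxAr mxE. Qed.
Lemma efNl v w : ef (- v) w = - ef v w.
Proof. by rewrite -scaleN1r efZl mulN1r. Qed.
Lemma efNr v w : ef v (- w) = - ef v w.
Proof. by rewrite -scaleN1r efZr mulN1r. Qed.
Lemma efBl u v w : ef (u - v) w = ef u w - ef v w.
Proof. by rewrite efDl efNl. Qed.
Lemma efBr u v w : ef u (v - w) = ef u v - ef u w.
Proof. by rewrite efDr efNr. Qed.
Lemma ef0l v : ef 0 v = 0.
Proof. by rewrite -(scale0r (0 : 'rV_n)) efZl mul0r. Qed.
Lemma ef0r v : ef v 0 = 0.
Proof. by rewrite -(scale0r (0 : 'rV_n)) efZr mul0r. Qed.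
Lemma ef_suml (I : Type) (r : seq I) (Q : pred I) (F : I -> 'rV_n) w :
  ef (\sum_(i <- r | Q i) F i) w = \sum_(i <- r | Q i) ef (F i) w.
Proof. exact: (big_morph (fun v => ef v w) (fun u v => efDl u v w) (ef0l w)). Qed.
Lemma ef_sumr (I : Type) (r : seq I) (Q : pred I) (F : I -> 'rV_n) v :
  ef v (\sum_(i <- r | Q i) F i) = \sum_(i <- r | Q i) ef v (F i).
Proof. exact: (big_morph (ef v) (efDr v) (ef0r v)). Qed.

Lemma efE v w : ef v w = \sum_i \sum_j v 0 i * d i * lowc i j * w 0 j.
Proof.
rewrite /ef mxE exchange_big /=; apply: eq_bigr => j _.
rewrite !mxE mulr_suml; apply: eq_bigr => i _; rewrite !mxE; ring.
Qed.

Lemma srootE i j : sroot i 0 j = (j == i)%:R.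
Proof. by rewrite /sroot mxE eqxx. Qed.

Lemma srootii i : sroot i 0 i = 1 :> rat.
Proof. by rewrite srootE eqxx. Qed.
Lemma oppE v i : (- v) 0 i = - v 0 i.
Proof. by rewrite mxE. Qed.

Lemma row_sum_sroot v : v = \sum_i v 0 i *: sroot i.
Proof. exact: row_sum_delta. Qed.

Lemma reflE i v j : refl A i v 0 j = v 0 j - pairc A i v * (j == i)%:R.
Proof. by rewrite -srootE /refl; move: (sroot i) => s; rewrite !mxE. Qed.

Lemma paircD i u v : pairc A i (u + v) = pairc A i u + pairc A i v.
Proof. by rewrite /pairc -big_split; apply: eq_bigr => j _ /=; rewrite mxE mulrDr. Qed.
Lemma paircZ i a v : pairc A i (a *: v) = a * pairc A i v.
Proof. by rewrite /pairc mulr_sumr; apply: eq_bigr => j _ /=; rewrite mxE; ring. Qed.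
Lemma pairc_sroot i j : pairc A i (sroot j) = (A i j)%:~R.
Proof.
rewrite /pairc (bigD1 j) //= srootE eqxx mulr1 big1 ?addr0 // => k /negPf nkj.
by rewrite srootE nkj mulr0.
Qed.

Lemma reflD i u v : refl A i (u + v) = refl A i u + refl A i v.
Proof. by rewrite /refl paircD scalerDl opprD addrACA. Qed.
Lemma reflZ i a v : refl A i (a *: v) = a *: refl A i v.
Proof. by rewrite /refl paircZ scalerBr scalerA. Qed.
Lemma reflN i v : refl A i (- v) = - refl A i v.
Proof. by rewrite -scaleN1r reflZ scaleN1r. Qed.

Definition reflw l v := foldr (refl A) v l.

Lemma coxE v : cox A v = reflw (enum 'I_n) v.
Proof. by []. Qed.
Lemma reflw_cat l1 l2 v : reflw (l1 ++ l2) v = reflw l1 (reflw l2 v).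
Proof. exact: foldr_cat. Qed.
Lemma reflwD l u v : reflw l (u + v) = reflw l u + reflw l v.
Proof. by elim: l => //= i l ->; rewrite reflD. Qed.
Lemma reflwZ l a v : reflw l (a *: v) = a *: reflw l v.
Proof. by elim: l => //= i l ->; rewrite reflZ. Qed.
Lemma reflwN l v : reflw l (- v) = - reflw l v.
Proof. by rewrite -scaleN1r reflwZ scaleN1r. Qed.
Lemma reflw_notin l v j : j \notin l -> reflw l v 0 j = v 0 j.
Proof.
elim: l => //= i l IH; rewrite inE negb_or => /andP[/negPf nij /IH {}IH].
by rewrite reflE IH nij mulr0 subr0.
Qed.
Lemma real_root_reflw l v : real_root A v -> real_root A (reflw l v).
Proof. by move=> rv; elim: l => //= i l; apply: RR_refl. Qed.

Lemma coxD u v : cox A (u + v) = cox A u + cox A v. Proof. exact: reflwD. Qed.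
Lemma coxZ a v : cox A (a *: v) = a *: cox A v. Proof. exact: reflwZ. Qed.
Lemma coxN v : cox A (- v) = - cox A v. Proof. exact: reflwN. Qed.
Lemma cox0 : cox A 0 = 0. Proof. by rewrite -(scale0r (0 : 'rV_n)) coxZ !scale0r. Qed.
Lemma cox_sum (I : Type) (r : seq I) (Q : pred I) (F : I -> 'rV_n) :
  cox A (\sum_(i <- r | Q i) F i) = \sum_(i <- r | Q i) cox A (F i).
Proof. exact: (big_morph (cox A) coxD cox0). Qed.

Lemma coxinvE v : coxinv A v = reflw (rev (enum 'I_n)) v.
Proof. by rewrite /reflw -foldl_rev revK. Qed.
Lemma coxinvD u v : coxinv A (u + v) = coxinv A u + coxinv A v.
Proof. by rewrite !coxinvE reflwD. Qed.
Lemma coxinvZ a v : coxinv A (a *: v) = a *: coxinv A v.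
Proof. by rewrite !coxinvE reflwZ. Qed.
Lemma coxinv0 : coxinv A 0 = 0.
Proof. by rewrite -(scale0r (0 : 'rV_n)) coxinvZ !scale0r. Qed.
Lemma coxinv_sum (I : Type) (r : seq I) (Q : pred I) (F : I -> 'rV_n) :
  coxinv A (\sum_(i <- r | Q i) F i) = \sum_(i <- r | Q i) coxinv A (F i).
Proof. exact: (big_morph (coxinv A) coxinvD coxinv0). Qed.

Hypothesis cartan : sym_cartan A d.

Let Aii i : A i i = 2. Proof. by case: cartan. Qed.
Let dgt0 i : 0 < d i. Proof. by case: cartan. Qed.
Let symA i j : d i * (A i j)%:~R = d j * (A j i)%:~R. Proof. by case: cartan. Qed.

Lemma lowcii i : lowc i i = 1.
Proof. by rewrite /lowc ltnn eqxx. Qed.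

Lemma lowc_upp i j : d j * lowc j i = d i * uppc i j.
Proof.
rewrite /lowc /uppc; case: ifP => _; first exact: symA.
by have [->//|nij] := eqVneq i j; rewrite !mulr0.
Qed.

Lemma low_upp i j : lowc i j + uppc i j = (A i j)%:~R.
Proof.
rewrite /lowc /uppc; case: ltngtP => [lij|lij|/val_inj ->].
- have /negPf -> : i != j by rewrite -val_eqE neq_ltn lij ?orbT.
  by rewrite ?add0r ?addr0.
- have /negPf -> : i != j by rewrite -val_eqE neq_ltn lij ?orbT.
  by rewrite ?add0r ?addr0.
- by rewrite eqxx Aii.
Qed.

Lemma KfE u v : Kf A d u v = ef u v + ef v u.
Proof.
rewrite efE [ef v u]efE [X in _ + X]exchange_big -big_split.
apply: eq_bigr => i _; rewrite -big_split; apply: eq_bigr => j _ /=.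
rewrite -low_upp -(mulrA (v 0 j)) lowc_upp; ring.
Qed.

Lemma KfC u v : Kf A d u v = Kf A d v u.
Proof. by rewrite !KfE addrC. Qed.
Lemma KfDl u v w : Kf A d (u + v) w = Kf A d u w + Kf A d v w.
Proof. by rewrite !KfE efDl efDr; ring. Qed.
Lemma KfDr u v w : Kf A d u (v + w) = Kf A d u v + Kf A d u w.
Proof. by rewrite !KfE efDl efDr; ring. Qed.
Lemma KfZl a v w : Kf A d (a *: v) w = a * Kf A d v w.
Proof. by rewrite !KfE efZl efZr; ring. Qed.
Lemma KfZr a v w : Kf A d v (a *: w) = a * Kf A d v w.
Proof. by rewrite !KfE efZl efZr; ring. Qed.
Lemma KfNl v w : Kf A d (- v) w = - Kf A d v w.
Proof. by rewrite -scaleN1r KfZl mulN1r. Qed.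
Lemma KfNr v w : Kf A d v (- w) = - Kf A d v w.
Proof. by rewrite -scaleN1r KfZr mulN1r. Qed.
Lemma KfBl u v w : Kf A d (u - v) w = Kf A d u w - Kf A d v w.
Proof. by rewrite KfDl KfNl. Qed.
Lemma KfBr u v w : Kf A d u (v - w) = Kf A d u v - Kf A d u w.
Proof. by rewrite KfDr KfNr. Qed.
Lemma Kf0l v : Kf A d 0 v = 0.
Proof. by rewrite KfE ef0l ef0r addr0. Qed.
Lemma Kf0r v : Kf A d v 0 = 0.
Proof. by rewrite KfC Kf0l. Qed.
Lemma Kf_suml (I : Type) (r : seq I) (Q : pred I) (F : I -> 'rV_n) w :
  Kf A d (\sum_(i <- r | Q i) F i) w = \sum_(i <- r | Q i) Kf A d (F i) w.
Proof.
exact: (big_morph (fun v => Kf A d v w) (fun u v => KfDl u v w) (Kf0l w)).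
Qed.
Lemma Kf_sumr (I : Type) (r : seq I) (Q : pred I) (F : I -> 'rV_n) v :
  Kf A d v (\sum_(i <- r | Q i) F i) = \sum_(i <- r | Q i) Kf A d v (F i).
Proof. exact: (big_morph (Kf A d v) (KfDr v) (Kf0r v)). Qed.

Lemma Kf_diag v : Kf A d v v = 2 * ef v v.
Proof. by rewrite KfE; ring. Qed.

Lemma Kf_sroot i v : Kf A d (sroot i) v = d i * pairc A i v.
Proof.
rewrite /Kf (bigD1 i) //= [X in _ + X]big1 => [|k /negPf nki].
  rewrite addr0 /pairc mulr_sumr; apply: eq_bigr => j _.
  by rewrite srootE eqxx mulr1n; ring.
by apply: big1 => j _; rewrite srootE nki !mul0r.
Qed.

Lemma Kf_srootE v w : Kf A d v w = \sum_i v 0 i * (d i * pairc A i w).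
Proof.
rewrite {1}(row_sum_sroot v) Kf_suml; apply: eq_bigr => i _.
by rewrite KfZl Kf_sroot.
Qed.

Lemma pairc_refl i v : pairc A i (refl A i v) = - pairc A i v.
Proof.
by rewrite /refl -scaleNr paircD paircZ pairc_sroot Aii -[(2 : int)%:~R]/(2 : rat); ring.
Qed.

Lemma reflK i : involutive (refl A i).
Proof.
by move=> v; rewrite {1}/refl pairc_refl {1}/refl scaleNr opprK subrK.
Qed.

Lemma Kf_refl i u v : Kf A d (refl A i u) (refl A i v) = Kf A d u v.
Proof.
rewrite /refl KfBl !KfBr !KfZl !KfZr [Kf A d u (sroot i)]KfC !Kf_sroot.
rewrite pairc_sroot Aii -[(2 : int)%:~R]/(2 : rat); ring.
Qed.

Lemma reflw_revK l : cancel (reflw l) (reflw (rev l)).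
Proof.
elim: l => // i l IH v; rewrite rev_cons -cats1 reflw_cat /= reflK; exact: IH.
Qed.
Lemma reflwK_rev l : cancel (reflw (rev l)) (reflw l).
Proof. by move=> v; rewrite -{1}(revK l) reflw_revK. Qed.
Lemma Kf_reflw l u v : Kf A d (reflw l u) (reflw l v) = Kf A d u v.
Proof. by elim: l => //= i l IH; rewrite Kf_refl. Qed.

Lemma coxK : cancel (cox A) (coxinv A).
Proof. by move=> v; rewrite coxinvE coxE reflw_revK. Qed.
Lemma coxinvK : cancel (coxinv A) (cox A).
Proof. by move=> v; rewrite coxinvE coxE reflwK_rev. Qed.
Lemma Kf_cox u v : Kf A d (cox A u) (cox A v) = Kf A d u v.
Proof. exact: Kf_reflw. Qed.
Lemma Kf_coxinv u v : Kf A d (coxinv A u) (coxinv A v) = Kf A d u v.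
Proof. by rewrite -Kf_cox !coxinvK. Qed.
Lemma iter_coxK m : cancel (iter m (cox A)) (iter m (coxinv A)).
Proof. by elim: m => // m IH v; rewrite iterSr iterS coxK IH. Qed.
Lemma iter_coxinvK m : cancel (iter m (coxinv A)) (iter m (cox A)).
Proof. by elim: m => // m IH v; rewrite iterSr iterS coxinvK IH. Qed.

Lemma enum_ord_split i :
  enum 'I_n = take i (enum 'I_n) ++ i :: drop i.+1 (enum 'I_n).
Proof.
rewrite -{1}(cat_take_drop i (enum 'I_n)); congr (_ ++ _).
by rewrite (drop_nth i) ?size_enum_ord // nth_ord_enum.
Qed.

Lemma mem_take_ord (k : nat) j : (j \in take k (enum 'I_n)) = (j < k)%N.
Proof. 
rewrite -(mem_map val_inj) map_take val_enum_ord take_iota mem_iota /= add0n.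
by rewrite ltn_min ltn_ord andbT.
Qed.
Lemma mem_drop_ord (k : nat) j : (j \in drop k (enum 'I_n)) = (k <= j)%N.
Proof.
rewrite -(mem_map val_inj) map_drop val_enum_ord drop_iota mem_iota add0n /=.
have := ltn_ord j; lia.
Qed.

Lemma cox_split (k : nat) v :
  cox A v = reflw (take k (enum 'I_n)) (reflw (drop k (enum 'I_n)) v).
Proof. by rewrite -reflw_cat cat_take_drop. Qed.

(* Coordinate [j] is touched exactly once by the word of the Coxeter element. *)
Lemma reflw_dropE (k : nat) v j :
  reflw (drop k (enum 'I_n)) v 0 j = if (j < k)%N then v 0 j else cox A v 0 j.
Proof.
case: ltnP => kj; first by rewrite reflw_notin // mem_drop_ord -ltnNge.
by rewrite (cox_split k) [RHS]reflw_notin // mem_take_ord -leqNgt.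
Qed.

(** When s_i acts, the coordinates above i already have their final value and the others still have
    their initial one. In matrix form this is the factorization c = - U^-1 L, with A = L + U. *)
Lemma cox_row i v :
  \sum_j uppc i j * cox A v 0 j = - \sum_j lowc i j * v 0 j.
Proof.
have Ei : cox A v 0 i = v 0 i - pairc A i (reflw (drop i.+1 (enum 'I_n)) v).
  have -> : cox A v 0 i = reflw (drop i (enum 'I_n)) v 0 i.
    by rewrite reflw_dropE ltnn.
  rewrite (drop_nth i) ?size_enum_ord // nth_ord_enum /= reflE eqxx mulr1.
  by rewrite reflw_dropE ltnS leqnn.
have : pairc A i (reflw (drop i.+1 (enum 'I_n)) v) =
   \sum_j lowc i j * v 0 j + \sum_j uppc i j * cox A v 0 j + (v 0 i - cox A v 0 i).
  have -> : v 0 i - cox A v 0 i = \sum_j (j == i)%:R * (v 0 j - cox A v 0 j).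
    rewrite (bigD1 i) //= eqxx mul1r big1 ?addr0 // => j /negPf ->.
    by rewrite mul0r.
  rewrite -!big_split; apply: eq_bigr => j _ /=.
  rewrite reflw_dropE -low_upp /lowc /uppc ltnS [j == i]eq_sym.
  case: (ltngtP j i) => [lij|lij|/val_inj ->].
  - have /negPf -> : i != j by rewrite -val_eqE neq_ltn lij ?orbT.
    by rewrite mulr0n; ring.
  - have /negPf -> : i != j by rewrite -val_eqE neq_ltn lij ?orbT.
    by rewrite mulr0n; ring.
  - by rewrite eqxx mulr1n; ring.
move: Ei; lra.
Qed.

Lemma ef_cox v w : ef (cox A w) v = - ef v w.
Proof.
rewrite (efE v) efE exchange_big -sumrN; apply: eq_bigr => i _ /=.
transitivity (v 0 i * d i * \sum_j uppc i j * cox A w 0 j).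
  rewrite mulr_sumr; apply: eq_bigr => j _; rewrite -(mulrA (cox A w 0 j)) lowc_upp; ring.
rewrite cox_row mulrN mulr_sumr; congr (- _).
by apply: eq_bigr => j _; ring.
Qed.

Lemma ef_cox2 v w : ef (cox A v) (cox A w) = ef v w.
Proof. by rewrite !ef_cox opprK. Qed.
Lemma ef_coxinv v w : ef v w = - ef w (coxinv A v).
Proof. by rewrite -{1}(coxinvK v) ef_cox. Qed.
Lemma ef_coxl v w : ef (cox A v) w = ef v (coxinv A w).
Proof. by rewrite -{1}(coxinvK w) ef_cox2. Qed.
Lemma ef_coxinvl v w : ef (coxinv A v) w = ef v (cox A w).
Proof. by rewrite -ef_cox2 coxinvK. Qed.
Lemma ef_itercoxl m v w : ef (iter m (cox A) v) w = ef v (iter m (coxinv A) w).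
Proof. by elim: m w => // m IH w; rewrite iterS ef_coxl IH iterSr. Qed.
Lemma ef_itercoxinvl m v w : ef (iter m (coxinv A) v) w = ef v (iter m (cox A) w).
Proof. by elim: m w => // m IH w; rewrite iterS ef_coxinvl IH iterSr. Qed.
Lemma Kf_itercox m u v : Kf A d (iter m (cox A) u) (iter m (cox A) v) = Kf A d u v.
Proof. by elim: m => // m IH; rewrite !iterS Kf_cox. Qed.

(** It applies to sums over c-orbits, which therefore vanish in finite type and are multiples of
    delta in affine type. *)
Lemma cox_fix_rad v : cox A v = v -> forall w, Kf A d v w = 0.
Proof. by move=> cv w; rewrite KfE -{1}cv ef_cox addNr. Qed.

Lemma rad_pairc v : (forall w, Kf A d v w = 0) -> forall i, pairc A i v = 0.
Proof.
move=> h i; apply/eqP; have /eqP := h (sroot i); rewrite KfC Kf_sroot mulf_eq0.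
by rewrite gt_eqF.
Qed.
Lemma pairc_rad v : (forall i, pairc A i v = 0) -> forall w, Kf A d v w = 0.
Proof.
by move=> h w; rewrite KfC Kf_srootE big1 // => i _; rewrite h !mulr0.
Qed.
Lemma reflw_rad l v : (forall i, pairc A i v = 0) -> reflw l v = v.
Proof. by move=> h; elim: l => //= i l ->; rewrite /refl h scale0r subr0. Qed.
Lemma cox_rad v : (forall i, pairc A i v = 0) -> cox A v = v.
Proof. exact: reflw_rad. Qed.
Lemma coxinv_rad v : (forall i, pairc A i v = 0) -> coxinv A v = v.
Proof. by rewrite coxinvE; apply: reflw_rad. Qed.

End EulerForm.

(** * Sign coherence of roots *)

Section RootLike.
Variables (n : nat) (A : 'M[int]_n) (d : 'I_n -> rat).
Hypothesis cartan : sym_cartan A d.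
Implicit Types (u v w x y : 'rV[rat]_n) (i j : 'I_n) (l : seq 'I_n).

Let Aii i : A i i = 2. Proof. by case: cartan. Qed.
Let Ale i j : i != j -> A i j <= 0. Proof. by case: cartan => _ h _ _ _; apply: h. Qed.
Let dgt0 i : 0 < d i. Proof. by case: cartan. Qed.

(* The lattice-theoretic shadow of a real root: [ef v v] is half the squared
   length, so the last clause says that the co-root is integral. *)
Definition rootlike v :=
  [/\ 0 < ef A d v v, forall i, v 0 i \is a Num.int
    & forall i, d i * v 0 i / ef A d v v \is a Num.int].

Definition trefl x v := v - (Kf A d x v / ef A d x x) *: x.

Lemma int_ge1 (a : rat) : a \is a Num.int -> 0 < a -> 1 <= a.
Proof. by move=> ai a0; rewrite -(gtr0_norm a0) norm_intr_ge1 ?gt_eqF. Qed.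

Lemma ef_Kf v : ef A d v v = Kf A d v v / 2.
Proof. by rewrite (Kf_diag cartan) mulrC mulKf. Qed.

Lemma ef_sroot i : ef A d (sroot i) (sroot i) = d i.
Proof.
by rewrite ef_Kf Kf_sroot pairc_sroot Aii -[(2 : int)%:~R]/(2 : rat) mulfK.
Qed.

Lemma lowc_int i j : lowc A i j \is a Num.int.
Proof. by rewrite /lowc; case: ifP => _; rewrite ?intr_int ?rpred_nat. Qed.
Lemma uppc_int i j : uppc A i j \is a Num.int.
Proof. by rewrite /uppc; case: ifP => _; rewrite ?intr_int ?rpred_nat. Qed.

Lemma efEupp v w : ef A d v w = \sum_i \sum_j w 0 i * d i * uppc A i j * v 0 j.
Proof.
rewrite efE exchange_big; apply: eq_bigr => i _; apply: eq_bigr => j _ /=.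
rewrite -(mulrA (v 0 j)) (lowc_upp cartan); ring.
Qed.

(** [efE] attaches d_i to the left argument and [efEupp] attaches it to the right one, so the
    integrality of d_i v_i / k clears the denominator in either order. *)
Lemma ef_div_int (k : rat) v w :
    (forall i, d i * v 0 i / k \is a Num.int) -> (forall i, w 0 i \is a Num.int) ->
  (ef A d v w / k \is a Num.int) && (ef A d w v / k \is a Num.int).
Proof.
move=> vi wi; rewrite efE efEupp !mulr_suml; apply/andP; split.
  apply: rpred_sum => i _; rewrite mulr_suml; apply: rpred_sum => j _.
  have -> : v 0 i * d i * lowc A i j * w 0 j / k =
            (d i * v 0 i / k) * lowc A i j * w 0 j by ring.
  by rewrite rpredM // rpredM // lowc_int.
apply: rpred_sum => i _; rewrite mulr_suml; apply: rpred_sum => j _.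
have -> : v 0 i * d i * uppc A i j * w 0 j / k =
          (d i * v 0 i / k) * uppc A i j * w 0 j by ring.
by rewrite rpredM // rpredM // uppc_int.
Qed.

Lemma rootlike_efl v w : rootlike v -> (forall i, w 0 i \is a Num.int) ->
  ef A d v w / ef A d v v \is a Num.int.
Proof. by case=> _ _ vi /(ef_div_int vi)/andP[]. Qed.
Lemma rootlike_efr v w : rootlike v -> (forall i, w 0 i \is a Num.int) ->
  ef A d w v / ef A d v v \is a Num.int.
Proof. by case=> _ _ vi /(ef_div_int vi)/andP[]. Qed.
Lemma rootlike_Kf v w : rootlike v -> (forall i, w 0 i \is a Num.int) ->
  Kf A d v w / ef A d v v \is a Num.int.
Proof.
by move=> rv wi; rewrite (KfE cartan) mulrDl rpredD ?rootlike_efl ?rootlike_efr.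
Qed.

Lemma rootlike_sroot i : rootlike (sroot i).
Proof.
split=> [|j|j]; rewrite ?ef_sroot // srootE ?rpred_nat //.
have [->|_] := eqVneq j i; last by rewrite mulr0 mul0r.
by rewrite mulr1 divff ?gt_eqF.
Qed.

Lemma rootlikeN v : rootlike v -> rootlike (- v).
Proof.
case=> v0 vi vci; split=> [|i|i]; rewrite ?efNl ?efNr ?opprK // mxE ?rpredN //.
by rewrite mulrN mulNr rpredN.
Qed.

Lemma rootlike_neq0 v : rootlike v -> v != 0.
Proof. by case=> v0 _ _; apply: contraTneq v0 => ->; rewrite ef0l ltxx. Qed.

Lemma Kf_trefl x u v : 0 < ef A d x x ->
  Kf A d (trefl x u) (trefl x v) = Kf A d u v.
Proof.
move=> x0; rewrite /trefl !(KfBl cartan) !(KfBr cartan) !(KfZl cartan) !(KfZr cartan).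
rewrite (KfC cartan u x) (Kf_diag cartan x).
by move: (ef A d x x) x0 => e e0; field; rewrite gt_eqF.
Qed.

Lemma rootlike_trefl x v : rootlike x -> rootlike v -> rootlike (trefl x v).
Proof.
move=> rx rv; have [x0 xi xci] := rx; have [v0 vi vci] := rv.
have E : ef A d (trefl x v) (trefl x v) = ef A d v v.
  by rewrite ef_Kf Kf_trefl // -ef_Kf.
split=> [|i|i]; rewrite ?E // /trefl !mxE.
  by rewrite rpredB // rpredM // rootlike_Kf.
rewrite mulrBr mulrBl rpredB //.
(* Exchanging the two denominators makes both factors integers: a co-root coordinate of x and the
   pairing of x with the co-root of v. *)
have -> : d i * (Kf A d x v / ef A d x x * x 0 i) / ef A d v v =
          (d i * x 0 i / ef A d x x) * (Kf A d v x / ef A d v v).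
  by rewrite (KfC cartan v); ring.
by rewrite rpredM // rootlike_Kf.
Qed.

Lemma trefl_sroot i v : trefl (sroot i) v = refl A i v.
Proof. by rewrite /trefl ef_sroot Kf_sroot mulrC mulKf // gt_eqF. Qed.

Lemma rootlike_refl i v : rootlike v -> rootlike (refl A i v).
Proof. by rewrite -trefl_sroot; apply/rootlike_trefl/rootlike_sroot. Qed.
Lemma rootlike_reflw l v : rootlike v -> rootlike (reflw A l v).
Proof. by move=> rv; elim: l => //= i l; apply: rootlike_refl. Qed.
Lemma rootlike_cox v : rootlike v -> rootlike (cox A v).
Proof. exact: rootlike_reflw. Qed.
Lemma rootlike_coxinv v : rootlike v -> rootlike (coxinv A v).
Proof. by rewrite coxinvE; apply: rootlike_reflw. Qed.
Lemma real_rootlike v : real_root A v -> rootlike v.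
Proof. by elim=> [i|i w _]; [apply: rootlike_sroot | apply: rootlike_refl]. Qed.

Lemma trefl_conj i x v : trefl (refl A i x) v = refl A i (trefl x (refl A i v)).
Proof.
have Ei : refl A i (refl A i v) = v by rewrite (reflK cartan).
rewrite {2}/trefl reflD Ei reflN reflZ /trefl !ef_Kf (Kf_refl cartan).
by rewrite -[Kf A d x (refl A i v)](Kf_refl cartan i) Ei.
Qed.

Lemma real_root_trefl x v : real_root A x -> real_root A v -> real_root A (trefl x v).
Proof.
move=> rx; elim: rx v => [i|i w _ IH] v rv.
  by rewrite trefl_sroot; apply: RR_refl.
by rewrite trefl_conj; apply/RR_refl/IH/RR_refl.
Qed.

Lemma real_root_cox v : real_root A v -> real_root A (cox A v).
Proof. exact: real_root_reflw. Qed.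
Lemma real_root_coxinv v : real_root A v -> real_root A (coxinv A v).
Proof. by rewrite coxinvE; apply: real_root_reflw. Qed.
Lemma real_rootN v : real_root A v -> real_root A (- v).
Proof.
move=> rv; have [v0 _ _] := real_rootlike rv.
suff -> : - v = trefl v v by apply: real_root_trefl.
rewrite /trefl (Kf_diag cartan) mulfK ?gt_eqF //.
by rewrite -[2]/(1 + 1) scalerDl scale1r opprD addrA subrr add0r.
Qed.

(** The pairing [ef] of x with y, divided by the half norm of x or by that of y, is a or its
    inverse; hence both are integers. *)
Lemma rootlike_prop (a : rat) x y : rootlike x -> rootlike y -> y = a *: x ->
  a = 1 \/ a = -1.
Proof.
move=> rx ry yE; have [x0 xi _] := rx; have [y0 yi _] := ry.
have a0 : a != 0 by apply: contraTneq (rootlike_neq0 ry) => a0; rewrite yE a0 scale0r eqxx.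
have ai : a \is a Num.int.
  by have := rootlike_efl rx yi; rewrite yE efZr mulfK ?gt_eqF.
have vi : a^-1 \is a Num.int.
  have := rootlike_efl ry xi; rewrite yE !(efZl, efZr).
  by rewrite !invfM mulrACA divff // mul1r mulrCA divff ?gt_eqF // mulr1.
have := norm_intr_ge1 ai a0; have := norm_intr_ge1 vi; rewrite invr_eq0 => /(_ a0).
have na : 0 < `|a| by rewrite normr_gt0.
rewrite normfV -[1 <= _^-1](ler_pM2l na) mulr1 divff ?gt_eqF // => h1 h2.
have /eqP : `|a| = 1 by apply/eqP; rewrite eq_le h1 h2.
by rewrite eqr_norml ler01 andbT => /orP[] /eqP; [left|right].
Qed.

Lemma rootlike_sroot_prop (a : rat) i : rootlike (a *: sroot i) ->
  a = 1 \/ a = -1.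
Proof. by move=> r; apply: rootlike_prop (rootlike_sroot i) r erefl. Qed.

Hypothesis Kge0 : forall v, 0 <= Kf A d v v.
Hypothesis null_full :
  forall v, pos v -> Kf A d v v = 0 -> v = 0 \/ forall i, 0 < v 0 i.

(* Split [v] into positive and negative parts: both lie in the lattice on which
   the squared length is a multiple of that of [v], and they pair nonpositively. *)
Lemma rootlike_sign v : rootlike v -> pos v \/ pos (- v).
Proof.
case=> k0 vi vci; set k := ef A d v v in k0 vci.
pose p : 'rV[rat]_n := \row_i Num.max (v 0 i) 0.
pose m : 'rV[rat]_n := \row_i Num.max (- v 0 i) 0.
have pE i : p 0 i = Num.max (v 0 i) 0 by rewrite mxE.
have mE i : m 0 i = Num.max (- v 0 i) 0 by rewrite mxE.
have vE : v = p - m.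
  apply/rowP => i; rewrite !mxE; case: (lerP (v 0 i) 0) => h.
    by rewrite max_l ?oppr_ge0 // sub0r opprK.
  by rewrite max_r ?subr0 // oppr_le0 ltW.
have vEi i : v 0 i = p 0 i - m 0 i by rewrite {1}vE !mxE.
clearbody p m.
have pp : pos p by move=> i; rewrite pE le_max lexx orbT.
have mp : pos m by move=> i; rewrite mE le_max lexx orbT.
have pm i : p 0 i * m 0 i = 0.
  rewrite pE mE; case: (lerP (v 0 i) 0) => h; first by rewrite mul0r.
  by rewrite max_r ?mulr0 // oppr_le0 ltW.
have Kpm : Kf A d p m <= 0.
  apply: sumr_le0 => i _; apply: sumr_le0 => j _.
  have [<-|nij] := eqVneq i j; first by rewrite pm !mul0r.
  by rewrite mulr_ge0_le0 ?lerz0 ?Ale // !mulr_ge0 // ltW.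
have int1 (u : 'rV_n) : (forall i, u 0 i = p 0 i) \/ (forall i, u 0 i = m 0 i) ->
    ef A d u u / k \is a Num.int.
  move=> hu.
  have ui i : u 0 i \is a Num.int.
    by case: hu => ->; rewrite (pE, mE); case: (lerP _ 0) => _; rewrite ?rpred0 ?rpredN.
  have uci i : d i * u 0 i / k \is a Num.int.
    case: hu => ->; rewrite (pE, mE); case: (lerP _ 0) => _ //; rewrite ?mulr0 ?mul0r ?rpred0 //.
    by rewrite mulrN mulNr rpredN.
  by have /andP[] := ef_div_int uci ui.
have pi := int1 p (or_introl (fun=> erefl)).
have mi := int1 m (or_intror (fun=> erefl)).
have e0 u : 0 <= ef A d u u by rewrite ef_Kf divr_ge0.
have sum1 : ef A d p p / k + ef A d m m / k <= 1.
  rewrite -mulrDl ler_pdivrMr // mul1r /k {1 2}vE !(efBl, efBr).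
  move: Kpm; rewrite (KfE cartan); lra.
have : ef A d p p = 0 \/ ef A d m m = 0.
  have [->|np] := eqVneq (ef A d p p) 0; first by left.
  have [->|nm] := eqVneq (ef A d m m) 0; first by right.
  have p1 : 1 <= ef A d p p / k by apply: int_ge1 => //; rewrite divr_gt0 // lt_def np e0.
  have m1 : 1 <= ef A d m m / k by apply: int_ge1 => //; rewrite divr_gt0 // lt_def nm e0.
  by move: sum1 p1 m1; lra.
have mneg : (forall i, v 0 i <= 0) -> pos (- v) by move=> h i; rewrite mxE oppr_ge0.
case=> h; have := null_full.
(* The null part is zero or has full support, and either alternative fixes the sign of every
   coordinate of v. *)
- move=> /(_ p pp); rewrite (Kf_diag cartan) h mulr0 => /(_ erefl)[p0|p0].
    by right; apply: mneg => i; have := mp i; rewrite vEi p0 mxE; lra.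
  left=> i; have := p0 i; rewrite pE; case: (lerP (v 0 i) 0); rewrite ?ltxx //.
  by move=> /ltW.
- move=> /(_ m mp); rewrite (Kf_diag cartan) h mulr0 => /(_ erefl)[p0|p0].
    by left=> i; have := pp i; rewrite vEi p0 mxE subr0.
  right; apply: mneg => i; have := p0 i; rewrite mE; case: (lerP (- v 0 i) 0); rewrite ?ltxx //.
  by rewrite oppr_gt0 => /ltW.
Qed.

End RootLike.

(** * The action of [tau_c] *)

Section Tau.
Variables (n : nat) (A : 'M[int]_n) (d : 'I_n -> rat).
Hypothesis cartan : sym_cartan A d.
Hypothesis sgn : forall v, rootlike A d v -> pos v \/ pos (- v).
Implicit Types (u v w x y : 'rV[rat]_n) (i j : 'I_n) (l : seq 'I_n).

Let dgt0 i : 0 < d i. Proof. by case: cartan. Qed.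

(* Dimension vectors of the indecomposable injective and projective modules at [i]. *)
Definition injtype v i :=
  [/\ v 0 i = 1, forall w, ef A d w v = d i * w 0 i & forall j, (j < i)%N -> v 0 j = 0].
Definition projtype u i :=
  [/\ u 0 i = 1, forall w, ef A d u w = d i * w 0 i & forall j, (i < j)%N -> u 0 j = 0].

Lemma pos_opp0 v : pos v -> pos (- v) -> v = 0.
Proof.
move=> pv nv; apply/rowP => i; rewrite mxE; have := pv i; have := nv i.
by rewrite mxE; row_lra.
Qed.

Lemma rootlike_npos v : rootlike A d v -> pos v -> ~ pos (- v).
Proof.
by move=> rv pv nv; have := rootlike_neq0 rv; rewrite (pos_opp0 pv nv) eqxx.
Qed.

Lemma pos_sroot i : pos (sroot i).
Proof. by move=> j; rewrite srootE; case: eqP. Qed.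

Lemma sroot_inj : injective (@sroot n).
Proof.
move=> i j /(congr1 (fun v : 'rV_n => v 0 i)); rewrite !srootE eqxx.
by case: eqP.
Qed.

Lemma sigma_pos i v : pos v -> sigma A i v = refl A i v.
Proof.
move=> pv; rewrite /sigma; case: existsP => // -[j /andP[_ /eqP vE]].
by have := pv j; rewrite vE oppE srootii; row_lra.
Qed.

Lemma sigma_neg i j : i != j -> sigma A i (- sroot j) = - sroot j.
Proof.
move=> nij; rewrite /sigma; case: existsP => // -[]; exists j.
by rewrite eq_sym nij eqxx.
Qed.

Lemma refl_sroot i : refl A i (sroot i) = - sroot i.
Proof.
rewrite /refl pairc_sroot; case: cartan => -> _ _ _ _.
by rewrite -[(2%R : int)%:~R]/(1 + 1 : rat) scalerDl scale1r opprD addrA subrr sub0r.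
Qed.

Lemma sigma_self i : sigma A i (- sroot i) = sroot i.
Proof.
rewrite /sigma; case: existsP => [[j /andP[nij /eqP]]|_].
  by move=> /oppr_inj/sroot_inj ij; rewrite ij eqxx in nij.
by rewrite reflN refl_sroot opprK.
Qed.

Definition sigmaw l v := foldr (sigma A) v l.

Lemma tauE v : tau A v = sigmaw (enum 'I_n) v. Proof. by []. Qed.
Lemma sigmaw_cat l1 l2 v : sigmaw (l1 ++ l2) v = sigmaw l1 (sigmaw l2 v).
Proof. exact: foldr_cat. Qed.

Lemma sigmaw_neg l j : j \notin l -> sigmaw l (- sroot j) = - sroot j.
Proof.
by elim: l => //= i l IH; rewrite inE negb_or => /andP[nij /IH ->]; rewrite sigma_neg // eq_sym.
Qed.

(** Only coordinate i changes. If the image is negative, the other coordinates of u are both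
    nonnegative and nonpositive, so u is a multiple of alpha_i. *)
Lemma refl_pos i u : rootlike A d u -> pos u -> pos (refl A i u) \/ u = sroot i.
Proof.
move=> ru pu; have [|nu] := sgn (rootlike_refl cartan i ru); first by left.
have uE : u = u 0 i *: sroot i.
  apply/rowP => j; rewrite mxE srootE; have [->|nji] := eqVneq j i; first by rewrite mulr1.
  have := nu j; have := pu j; rewrite oppE reflE (negPf nji) mulr0 subr0 mulr0; row_lra.
right; move: ru; rewrite uE => /(rootlike_sroot_prop cartan)[->|u1].
  by rewrite scale1r.
by have := pu i; rewrite u1; row_lra.
Qed.

(** The hypothesis describes the moment at which [tau] leaves the positive cone: s_i comes next. The
    rows of L v up to i see only the coordinates up to i, which are those of alpha_i; the rows
    beyond i become, by [cox_row], rows of U (c v), and c v vanishes above i. *)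
Lemma injtype_of v i : reflw A (drop i.+1 (enum 'I_n)) v = sroot i -> injtype v i.
Proof.
move=> vE.
have lo j : (j <= i)%N -> v 0 j = (j == i)%:R.
  by move=> ji; rewrite -srootE -vE reflw_dropE // ltnS ji.
have hi j : (i < j)%N -> cox A v 0 j = 0.
  move=> ij; have := srootE i j; rewrite -vE reflw_dropE // ltnS leqNgt ij /= => ->.
  by rewrite -val_eqE gtn_eqF.
split=> [|w|j ji]; first by rewrite lo // eqxx.
  have rowE a : \sum_j lowc A a j * v 0 j = (a == i)%:R.
    have [ai|ia] := leqP a i; last first.
      apply: oppr_inj; rewrite -(cox_row cartan) big1 => [|j _].
        by rewrite -val_eqE gtn_eqF // oppr0.
      rewrite /uppc; case: ltnP => aj; first by rewrite hi ?mulr0 // (ltn_trans ia).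
      by have [aj'|] := eqVneq a j; rewrite ?mul0r // -aj' hi ?mulr0.
    rewrite (bigD1 i) //= lo // eqxx mulr1 big1 => [|j nji].
      by rewrite addr0 /lowc ltnNge ai.
    have [ji|ij] := leqP j i; first by rewrite lo // (negPf nji) mulr0.
    rewrite /lowc ltnNge (leq_trans ai (ltnW ij)) /= -val_eqE ltn_eqF ?mul0r //.
    exact: leq_ltn_trans ai ij.
  rewrite efE (bigD1 i) //= [X in _ + X]big1 => [|a nai].
    under eq_bigr => j _ do rewrite -mulrA.
    by rewrite -mulr_sumr rowE eqxx addr0 mulr1 mulrC.
  under eq_bigr => j _ do rewrite -mulrA.
  by rewrite -mulr_sumr rowE (negPf nai) mulr0.
by rewrite lo ?(ltnW ji) // -val_eqE ltn_eqF.
Qed.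

Lemma tau_pos v : rootlike A d v -> pos v ->
  (pos (cox A v) /\ tau A v = cox A v) \/
  exists i, tau A v = - sroot i /\ injtype v i.
Proof.
move=> rv pv.
(* Induction on the number m of letters applied so far, from the right end of the word. Once -
   alpha_i is reached, all remaining letters have smaller index and fix it. *)
have H m : (m <= n)%N -> let l := drop (n - m) (enum 'I_n) in
    (pos (reflw A l v) /\ sigmaw l v = reflw A l v) \/
    exists i, [/\ (n - m <= i)%N, sigmaw l v = - sroot i & injtype v i].
  elim: m => [_|m IH mn].
    by left; rewrite subn0 drop_oversize ?size_enum_ord.
  have kn : (n - m.+1 < n)%N by lia.
  set k := (n - m.+1)%N in kn *; have kE : (n - m = k.+1)%N by rewrite /k; lia.
  pose i := Ordinal kn; have dE : drop k (enum 'I_n) = i :: drop k.+1 (enum 'I_n).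
    by rewrite (drop_nth i) ?size_enum_ord // -[X in nth _ _ X]/(val i) nth_ord_enum.
  have /= := IH (ltnW mn); rewrite kE dE /= => -[[p sE]|[j [kj sE inj]]]; last first.
    right; exists j; split=> //; first exact: ltnW.
    by rewrite sE sigma_neg // -val_eqE /= ltn_eqF.
  rewrite sE sigma_pos //.
  have [|iE] := refl_pos i (rootlike_reflw cartan _ rv) p; first by left.
  right; exists i; split=> //; last exact: injtype_of.
  by rewrite iE refl_sroot.
have /= := H n (leqnn n); rewrite subnn drop0 => -[[p sE]|[i [_ sE inj]]].
  by left.
by right; exists i.
Qed.

Lemma sigmaw_sroot l i : i \notin l ->
  sigmaw l (sroot i) = reflw A l (sroot i) /\ pos (reflw A l (sroot i)).
Proof.
elim: l => [|j l IH]; first by split=> //; apply: pos_sroot.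
move=> il; have [|sE p] := IH; first by apply: contra il; rewrite inE orbC => ->.
rewrite /= sE sigma_pos //; split=> //.
have [//|np] := sgn (rootlike_reflw cartan (j :: l) (rootlike_sroot cartan i)).
by have := np i; rewrite oppE reflw_notin // srootii; row_lra.
Qed.

(** The last clause says that c sends the injective vector at i to minus the projective one; with
    [ef_cox] it carries the coordinate functional from one side of [ef] to the other. *)
Lemma injtype_ex i : exists x, [/\ real_root A x, pos x, injtype x i
  & cox A x = - reflw A (take i (enum 'I_n)) (sroot i)].
Proof.
pose l := drop i.+1 (enum 'I_n); pose x := reflw A (rev l) (sroot i).
have xE : reflw A l x = sroot i by rewrite (reflwK_rev cartan).
have inj := injtype_of xE.
have rx : real_root A x by apply/real_root_reflw/RR_simple.
exists x; split=> //.
  have [//|np] := sgn (real_rootlike cartan rx).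
  by have := np i; case: inj => x1 _ _; rewrite oppE x1; row_lra.
rewrite coxE [in LHS](enum_ord_split i) reflw_cat /= xE -reflwN; congr (reflw _ _ _).
exact: refl_sroot.
Qed.

Lemma tau_negsimple i :
  tau A (- sroot i) = reflw A (take i (enum 'I_n)) (sroot i) /\
  [/\ real_root A (tau A (- sroot i)), pos (tau A (- sroot i))
    & projtype (tau A (- sroot i)) i].
Proof.
have ti : i \notin take i (enum 'I_n) by rewrite mem_take_ord ltnn.
have [sE p] := sigmaw_sroot ti.
have E : tau A (- sroot i) = reflw A (take i (enum 'I_n)) (sroot i).
  rewrite tauE [in LHS](enum_ord_split i) sigmaw_cat /= sigmaw_neg ?sigma_self ?sE //.
  by rewrite mem_drop_ord ltnn.
split=> //; rewrite E; split=> //; first exact/real_root_reflw/RR_simple.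
split=> [|w|j ij]; first by rewrite reflw_notin // srootE eqxx.
  have [x [_ _ [_ xw _] cx]] := injtype_ex i.
  by rewrite -[X in ef A d X w]opprK -cx efNl (ef_cox cartan) opprK.
by rewrite reflw_notin ?srootE -?val_eqE ?gtn_eqF // mem_take_ord -leqNgt ltnW.
Qed.

Lemma ef_inj_r v v' : (forall w, ef A d w v = ef A d w v') -> v = v'.
Proof.
move=> h; apply/rowP => j; have [_ [_ _ [_ uw _]]] := tau_negsimple j.
by have := h (tau A (- sroot j)); rewrite !uw => /mulfI; apply; rewrite gt_eqF.
Qed.
Lemma ef_inj_l v v' : (forall w, ef A d v w = ef A d v' w) -> v = v'.
Proof.
move=> h; apply/rowP => j; have [x [_ _ [_ xw _] _]] := injtype_ex j.
by have := h x; rewrite !xw => /mulfI; apply; rewrite gt_eqF.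
Qed.

Lemma injtype_uniq v v' i : injtype v i -> injtype v' i -> v = v'.
Proof. by move=> [_ h _] [_ h' _]; apply: ef_inj_r => w; rewrite h h'. Qed.
Lemma injtype_index v i j : injtype v i -> injtype v j -> i = j.
Proof.
move=> [vi h _] [vj h' _]; apply/eqP/negPn/negP => nij.
have := h (sroot i); rewrite h' !srootE eqxx eq_sym (negPf nij) mulr0 mulr1 => /eqP.
by rewrite eq_sym gt_eqF.
Qed.

Lemma tau_injtype v i : rootlike A d v -> pos v -> injtype v i -> tau A v = - sroot i.
Proof.
move=> rv pv vi; have [[pc _]|[j [-> /injtype_index]]] := tau_pos rv pv; last by move=> /(_ i vi) ->.
have [x [rx px xi cx]] := injtype_ex i.
move: pc; rewrite (injtype_uniq vi xi) cx; have [<- [ru pu _]] := tau_negsimple i.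
by move=> /(rootlike_npos (real_rootlike cartan ru) pu).
Qed.

(** Dual to [cox_npos]: the positive root - c^-1 v has the negative image - v under c, so it is of
    injective type, and v is the corresponding projective vector. *)
Lemma coxinv_npos v : rootlike A d v -> pos v -> ~ pos (coxinv A v) ->
  exists2 i, v = tau A (- sroot i) & projtype v i.
Proof.
move=> rv pv npv; have rc := rootlike_coxinv cartan rv.
have [//|pn] := sgn rc.
have cE : cox A (- coxinv A v) = - v by rewrite coxN (coxinvK cartan).
have [[]|[i [_ xi]]] := tau_pos (rootlikeN rc) pn.
  by rewrite cE => /(rootlike_npos rv pv).
have [_ [_ _ ui]] := tau_negsimple i.
suff vE : v = tau A (- sroot i) by exists i; rewrite // vE.
apply: ef_inj_l => w; case: ui => _ -> _; case: xi => _ xw _.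
by rewrite -xw -[v in LHS]opprK -cE efNl (ef_cox cartan) opprK.
Qed.

Lemma cox_npos v : rootlike A d v -> pos v -> ~ pos (cox A v) ->
  exists2 i, tau A v = - sroot i & injtype v i.
Proof. by move=> rv pv npv; have [[]|[i []]] := tau_pos rv pv => //; exists i. Qed.

Lemma tau_cox v : rootlike A d v -> pos v -> pos (cox A v) -> tau A v = cox A v.
Proof.
move=> rv pv pc; have [[]//|[i [_ vi]]] := tau_pos rv pv.
have [x [rx px xi cx]] := injtype_ex i.
move: pc; rewrite (injtype_uniq vi xi) cx; have [<- [ru pu _]] := tau_negsimple i.
by move=> /(rootlike_npos (real_rootlike cartan ru) pu).
Qed.

End Tau.

(** * The compatibility degree expressed by the Euler form *)

Section Compat.
Variables (n : nat) (A : 'M[int]_n) (d : 'I_n -> rat).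
Hypothesis cartan : sym_cartan A d.
Implicit Types (u v w x y a b : 'rV[rat]_n) (i j : 'I_n) (lam : rat).

Let dgt0 i : 0 < d i. Proof. by case: cartan. Qed.
Let dV i (x : rat) : (d i)^-1 * (d i * x) = x.
Proof. by rewrite mulKf // gt_eqF. Qed.

(* [lam] is the scalar with [a^\vee = lam * (d a)]; it is [2 / K(a, a)] for a real root
   but another constant for [delta]. *)
Definition cpt lam a b : rat :=
  Num.max (compat_right A (fun i => lam * (d i * a 0 i)) b)
          (compat_left A (fun i => lam * (d i * a 0 i)) b).

Lemma lowc_sum i v :
  \sum_j lowc A i j * v 0 j = v 0 i + \sum_(j < n | (j < i)%N) (A i j)%:~R * v 0 j.
Proof.
rewrite (bigD1 i) //= lowcii mul1r; congr (_ + _).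
rewrite big_mkcond [RHS]big_mkcond; apply: eq_bigr => j _ /=.
rewrite /lowc; have [->|nji] := eqVneq j i; first by rewrite ltnn.
by case: ifP => // _; rewrite mul0r.
Qed.

Lemma uppc_sum i v :
  \sum_j uppc A i j * v 0 j = v 0 i + \sum_(j < n | (i < j)%N) (A i j)%:~R * v 0 j.
Proof.
rewrite (bigD1 i) //= {1}/uppc ltnn eqxx mul1r; congr (_ + _).
rewrite big_mkcond [RHS]big_mkcond; apply: eq_bigr => j _ /=.
rewrite /uppc; have [->|nji] := eqVneq j i; first by rewrite ltnn.
by case: ifP => // _; rewrite mul0r.
Qed.

Lemma cpt_pos lam a b : 0 <= lam -> pos a -> pos b ->
  cpt lam a b = Num.max (- (lam * ef A d a b)) (- (lam * ef A d b a)).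
Proof.
move=> l0 pa pb.
have pp i : pospart (lam * (d i * a 0 i)) = lam * (d i * a 0 i).
  by rewrite /pospart max_l // !mulr_ge0 // ltW.
have ppb i : pospart (b 0 i) = b 0 i by rewrite /pospart max_l.
rewrite /cpt /compat_right /compat_left efE (efEupp cartan) !mulr_sumr -!sumrN.
congr (Num.max _ _); rewrite -big_split; apply: eq_bigr => i _ /=.
  have -> : \sum_j a 0 i * d i * lowc A i j * b 0 j =
            a 0 i * d i * \sum_j lowc A i j * b 0 j.
    by rewrite mulr_sumr; apply: eq_bigr => j _; rewrite mulrA.
  rewrite lowc_sum mulrDr mulrDr mulr_sumr mulr_sumr opprD; congr (- _ - _); first ring.
  by apply: eq_bigr => j _; rewrite pp ppb; ring.
have -> : \sum_j a 0 i * d i * uppc A i j * b 0 j =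
          a 0 i * d i * \sum_j uppc A i j * b 0 j.
  by rewrite mulr_sumr; apply: eq_bigr => j _; rewrite mulrA.
rewrite uppc_sum mulrDr mulrDr mulr_sumr mulr_sumr opprD; congr (- _ - _); first ring.
by apply: eq_bigr => j _; rewrite pp ppb; ring.
Qed.

Lemma cpt_negl i b : cpt (d i)^-1 (- sroot i) b = b 0 i.
Proof.
have E j : (d i)^-1 * (d j * (- sroot i) 0 j) = - (j == i)%:R.
  rewrite oppE srootE; have [->|_] := eqVneq j i; last by rewrite !(oppr0, mulr0).
  by rewrite dV.
have p0 j : pospart ((d i)^-1 * (d j * (- sroot i) 0 j)) = 0.
  by rewrite /pospart E max_r // oppr_le0 ler0n.
rewrite /cpt /compat_right /compat_left.
have -> : \sum_(j < n) (d i)^-1 * (d j * (- sroot i) 0 j) * b 0 j = - b 0 i.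
  rewrite (bigD1 i) //= E eqxx mulN1r big1 ?addr0 // => j /negPf nji.
  by rewrite E nji oppr0 mul0r.
rewrite !big1 ?subr0 ?opprK ?maxxx // => j _; apply: big1 => k _; rewrite p0; ring.
Qed.

Lemma cpt_negr lam a i : cpt lam a (- sroot i) = lam * (d i * a 0 i).
Proof.
have p0 j : pospart ((- sroot i) 0 j) = 0.
  by rewrite /pospart oppE srootE max_r // oppr_le0 ler0n.
rewrite /cpt /compat_right /compat_left.
have -> : \sum_(j < n) lam * (d j * a 0 j) * (- sroot i) 0 j = - (lam * (d i * a 0 i)).
  rewrite (bigD1 i) //= oppE srootii mulrN1 big1 ?addr0 // => j /negPf nji.
  by rewrite oppE srootE nji oppr0 mulr0.
rewrite !big1 ?subr0 ?opprK ?maxxx // => j _; apply: big1 => k _; rewrite p0; ring.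
Qed.

(** [la] and [la'] are the co-root scalars of a and of its image under [tau]. Keeping them abstract
    lets delta, whose scalar is not 2 / K, fall under the first case. *)
Inductive tau_case a (la la' : rat) : Prop :=
| TauCox of 0 <= la & la' = la & pos a & pos (cox A a) & tau A a = cox A a
| TauInj i of la = (d i)^-1 & la' = (d i)^-1 & pos a & injtype A d a i
    & tau A a = - sroot i
| TauNeg i of la = (d i)^-1 & la' = (d i)^-1 & a = - sroot i & pos (tau A a)
    & projtype A d (tau A a) i.

(** If just one argument is of injective or projective type, one order of [ef] gives a coordinate
    and the other, through [ef_cox], minus a coordinate of an image under c; the signs differ, so
    the maximum is known. If both have the same type, the support condition makes one candidate 0
    unless the indices agree. *)
Lemma cpt_tau a b la la' lb lb' : tau_case a la la' -> tau_case b lb lb' ->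
  cpt la a b = cpt la' (tau A a) (tau A b).
Proof.
have dV0 i : 0 <= (d i)^-1 by rewrite invr_ge0 ltW.
have mr (x y : rat) : x <= 0 -> 0 <= y -> Num.max x y = y.
  by move=> x0 y0; rewrite max_r // (le_trans x0).
have ml (x y : rat) : y <= 0 -> 0 <= x -> Num.max x y = x.
  by move=> x0 y0; rewrite max_l // (le_trans x0).
case=> [l0 -> pa pca ->|i -> -> pa [ai1 aw asup] ->|i -> -> aE pta [ui1 uw usup]].
- case=> [_ _ pb pcb ->|j _ _ pb [bj1 bw bsup] ->|j _ _ -> ptb [uj1 uw usup]].
  + by rewrite !cpt_pos // !(ef_cox2 cartan).
  + rewrite cpt_negr cpt_pos // bw -[ef A d b a]opprK -(ef_cox cartan) bw mulrN opprK.
    by rewrite mr // ?oppr_le0 !mulr_ge0 // ltW.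
  + rewrite cpt_negr cpt_pos // uw (ef_cox cartan) uw mulrN opprK.
    by rewrite ml // ?oppr_le0 !mulr_ge0 // ltW.
- case=> [_ _ pb pcb ->|j _ _ pb [bj1 bw bsup] ->|j _ _ bE ptb [uj1 uw usup]].
  + rewrite cpt_negl cpt_pos // aw -[ef A d a b]opprK -(ef_cox cartan) aw mulrN opprK.
    by rewrite !dV ml // oppr_le0.
  + rewrite cpt_negl cpt_pos // aw bw oppE srootE dV.
    have [ij|nij] := eqVneq i j; first by rewrite -ij dV ai1 ij bj1 maxxx.
    move: nij; rewrite -val_eqE neq_ltn => /orP[ij|ji].
      by rewrite (bsup i ij) mulr0n oppr0 mr // oppr_le0 !mulr_ge0 // ltW.
    by rewrite (asup j ji) !mulr0 mulr0n oppr0 max_l // oppr_le0.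
  + rewrite [in LHS]bE cpt_negr cpt_negl -uw aw.
    by rewrite dV.
- case=> [_ _ pb pcb ->|j _ _ pb [bj1 bw bsup] ->|j _ _ bE ptb [uj1 uwb usupb]].
  + rewrite [in LHS]aE cpt_negl cpt_pos // uw (ef_cox cartan) uw mulrN opprK !dV.
    by rewrite mr // oppr_le0.
  + rewrite [in LHS]aE cpt_negl cpt_negr -bw uw dV //.
  + rewrite [in LHS]aE cpt_negl {1}bE oppE srootE cpt_pos // uw uwb dV.
    have [ij|nij] := eqVneq i j; first by rewrite {1}ij -ij dV ui1 {1}ij uj1 maxxx.
    move: nij; rewrite -val_eqE neq_ltn => /orP[ij|ji].
      by rewrite (usup j ij) !mulr0 !mulr0n oppr0 max_r // oppr_le0.
    by rewrite (usupb i ji) mulr0n oppr0 max_l // oppr_le0 !mulr_ge0 // ltW.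
Qed.

End Compat.

(** * Orbits of the Coxeter element and their exits through the negative simple roots *)

Lemma sum_shift (V : zmodType) (F : nat -> V) N :
  \sum_(m < N) F m.+1 = \sum_(m < N) F m + (F N - F 0%N).
Proof.
have : \sum_(m < N.+1) F m = \sum_(m < N.+1) F m by [].
rewrite {1}big_ord_recl big_ord_recr /= => E.
by rewrite addrA -E [_ + \sum_(i < N) _]addrC addrK.
Qed.

Section Orbits.
Variables (n : nat) (A : 'M[int]_n) (d : 'I_n -> rat).
Hypothesis cartan : sym_cartan A d.
Hypothesis Kge0 : forall v, 0 <= Kf A d v v.
Implicit Types (u v w x y a b : 'rV[rat]_n) (i j : 'I_n).

Let dgt0 i : 0 < d i. Proof. by case: cartan. Qed.

Lemma iter_coxD m u v : iter m (cox A) (u + v) = iter m (cox A) u + iter m (cox A) v.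
Proof. by elim: m => //= m ->; rewrite coxD. Qed.
Lemma iter_coxN m v : iter m (cox A) (- v) = - iter m (cox A) v.
Proof. by elim: m => //= m ->; rewrite coxN. Qed.

Lemma pairc_sq_le i v : pairc A i v ^+ 2 <= 2 * Kf A d v v / d i.
Proof.
have := Kge0 (v - (pairc A i v / 2) *: sroot i).
rewrite (KfBl cartan) !(KfBr cartan) !(KfZl cartan) !(KfZr cartan).
rewrite (KfC cartan v) !Kf_sroot pairc_sroot; case: cartan => -> _ _ _ _.
rewrite -[(2%R : int)%:~R]/(2 : rat) ler_pdivlMr // => h.
by move: h; rewrite expr2; lra.
Qed.

Lemma null_rad v : Kf A d v v = 0 -> forall i, pairc A i v = 0.
Proof.
move=> v0 i; apply/eqP; rewrite -sqrf_eq0 eq_le sqr_ge0 andbT.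
by have := pairc_sq_le i v; rewrite v0 mulr0 mul0r.
Qed.

Lemma pairc_int i v : (forall j, v 0 j \is a Num.int) -> pairc A i v \is a Num.int.
Proof. by move=> vi; apply: rpred_sum => j _; rewrite rpredM ?intr_int. Qed.

Lemma rootlike_itercox m v : rootlike A d v -> rootlike A d (iter m (cox A) v).
Proof. by move=> rv; elim: m => //= m; apply: rootlike_cox. Qed.
Lemma rootlike_itercoxinv m v : rootlike A d v -> rootlike A d (iter m (coxinv A) v).
Proof. by move=> rv; elim: m => //= m; apply: rootlike_coxinv. Qed.

(* Modulo the radical a real root is determined by its integral pairings with
   the simple co-roots, which are bounded along an orbit by Cauchy-Schwarz. *)
Lemma cox_return v : rootlike A d v ->
  exists2 N, (0 < N)%N & forall i, pairc A i (iter N (cox A) v - v) = 0.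
Proof.
move=> rv; pose X m := iter m (cox A) v.
have KX m : Kf A d (X m) (X m) = Kf A d v v by apply: Kf_itercox.
pose B := (\sum_i Num.bound (2 * Kf A d v v / d i))%N.
have bd m i : `|pairc A i (X m)| <= B%:R.
  have xi : pairc A i (X m) \is a Num.int.
    by apply: pairc_int; case: (rootlike_itercox m rv).
  apply: (@le_trans _ _ (pairc A i (X m) ^+ 2)).
    have [->|p0] := eqVneq (pairc A i (X m)) 0; first by rewrite normr0 sqr_ge0.
    by rewrite -real_normK ?num_real // expr2 ler_peMr // norm_intr_ge1.
  apply: le_trans (pairc_sq_le i _) _; rewrite KX ltW //.
  apply: lt_le_trans (archi_boundP _) _.
    by rewrite mulr_ge0 ?invr_ge0 ?(ltW (dgt0 i)) // mulr_ge0.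
  by rewrite ler_nat /B (bigD1 i) //= leq_addr.
pose z m i : int := Num.floor (pairc A i (X m)).
have zE m i : (z m i)%:~R = pairc A i (X m) :> rat.
  by rewrite /z floorK // pairc_int //; case: (rootlike_itercox m rv).
have zb m i : `|z m i| <= B%:Z.
  by have := bd m i; rewrite -zE -intr_norm -[B%:R]/((B : int)%:~R : rat) ler_int.
(* The pairings lie in [-B, B]; the shift by B makes them natural numbers at most 2 B, so that two
   of finitely many codes must collide. *)
pose code m : {ffun 'I_n -> 'I_(B + B).+1} := [ffun i => inord (absz (z m i + B%:Z)%R)].
have code_inj m m' : code m = code m' -> forall i, pairc A i (X m) = pairc A i (X m').
  move=> /ffunP h i; have := h i; rewrite !ffunE => /(congr1 val) /=.
  have b1 := zb m i; have b2 := zb m' i.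
  rewrite !inordK; [|lia|lia]; rewrite -!zE => e; congr (_ %:~R); lia.
pose T := {ffun 'I_n -> 'I_(B + B).+1}.
have : ~~ injectiveb (fun m : 'I_(#|T|.+1) => code m).
  by apply/negP => /injectiveP/leq_card; rewrite card_ord ltnn.
case/injectivePn => [m1 [m2 nm /code_inj E]].
wlog lt12 : m1 m2 nm E / (m1 < m2)%N => [hw|].
  have := nm; rewrite -val_eqE neq_ltn => /orP[]; first exact: hw.
  by apply: hw; rewrite // eq_sym.
exists (m2 - m1)%N; first by rewrite subn_gt0.
pose r := iter (m2 - m1) (cox A) v - v.
have rE : iter m1 (cox A) r = X m2 - X m1.
  by rewrite /r iter_coxD iter_coxN -iterD subnKC ?(ltnW lt12).
have rad i : pairc A i (iter m1 (cox A) r) = 0.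
  by rewrite rE paircD -scaleN1r paircZ E mulN1r subrr.
(* Vectors of the radical are fixed by c, so the coincidence between the times m1 and m2 can be
   moved back to time 0. *)
have {}rE : iter m1 (coxinv A) (iter m1 (cox A) r) = iter m1 (cox A) r.
  by apply: iter_fix; apply: coxinv_rad.
by rewrite (iter_coxK cartan) in rE; rewrite -/r rE.
Qed.

Hypothesis sgn : forall v, rootlike A d v -> pos v \/ pos (- v).

Lemma itertau_cox m v : rootlike A d v -> (forall k, (k <= m)%N -> pos (iter k (cox A) v)) ->
  iter m (tau A) v = iter m (cox A) v.
Proof.
move=> rv; elim: m => // m IH h; rewrite !iterS IH => [|k km]; last by apply/h/leqW.
by apply: (tau_cox cartan sgn); [apply: rootlike_itercox|apply: h|apply: (h m.+1)].
Qed.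

Lemma forward_exit v : rootlike A d v -> pos v -> (exists m, ~ pos (iter m (cox A) v)) ->
  exists m i, iter m.+1 (tau A) v = - sroot i /\ injtype A d (iter m (cox A) v) i.
Proof.
move=> rv pv ex.
have exb : exists m, ~~ `[< pos (iter m (cox A) v) >].
  by case: ex => m hm; exists m; apply/asboolPn.
case: (ex_minnP exb) => -[|m] /asboolPn npm mmin; first by [].
have h k : (k <= m)%N -> pos (iter k (cox A) v).
  by move=> km; apply/asboolP/negPn/negP => /mmin; rewrite ltnNge km.
have [i tE inj] := cox_npos cartan sgn (rootlike_itercox m rv) (h m (leqnn m)) npm.
by exists m, i; split=> //; rewrite iterS itertau_cox.
Qed.

Lemma backward_exit v : rootlike A d v -> pos v -> (exists m, ~ pos (iter m (coxinv A) v)) ->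
  exists m i, [/\ v = iter m.+1 (tau A) (- sroot i),
    v = iter m (cox A) (tau A (- sroot i)) & projtype A d (tau A (- sroot i)) i].
Proof.
move=> rv pv ex.
have exb : exists m, ~~ `[< pos (iter m (coxinv A) v) >].
  by case: ex => m hm; exists m; apply/asboolPn.
case: (ex_minnP exb) => -[|m] /asboolPn npm mmin; first by [].
have h k : (k <= m)%N -> pos (iter k (coxinv A) v).
  by move=> km; apply/asboolP/negPn/negP => /mmin; rewrite ltnNge km.
have [i tE pr] := coxinv_npos cartan sgn (rootlike_itercoxinv m rv) (h m (leqnn m)) npm.
have vE : v = iter m (cox A) (tau A (- sroot i)) by rewrite -tE (iter_coxinvK cartan).
exists m, i; split=> //; last by rewrite -tE.
rewrite iterSr -tE itertau_cox ?(iter_coxinvK cartan) //.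
  exact: rootlike_itercoxinv.
move=> k km; rewrite -(subnKC km) iterD (iter_coxinvK cartan); apply: h.
exact: leq_subr.
Qed.

Lemma halfnorm_inj v i : injtype A d v i -> ef A d v v = d i.
Proof. by case=> v1 -> _; rewrite v1 mulr1. Qed.
Lemma halfnorm_proj v i : projtype A d v i -> ef A d v v = d i.
Proof. by case=> v1 -> _; rewrite v1 mulr1. Qed.

Lemma inv_norm v : 2 / Kf A d v v = (ef A d v v)^-1.
Proof. by rewrite (Kf_diag cartan) invfM mulrA divff // mul1r. Qed.

Lemma tau_caseP a : (rootlike A d a /\ pos a) \/ (exists i, a = - sroot i) ->
  tau_case A d a (2 / Kf A d a a) (2 / Kf A d (tau A a) (tau A a)).
Proof.
rewrite !inv_norm => -[[ra pa]|[i aE]].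
  have [[pc tE]|[i [tE inj]]] := tau_pos cartan sgn ra pa.
    apply: TauCox => //; first by rewrite invr_ge0 ltW //; case: ra.
    by rewrite tE (ef_cox2 cartan).
  apply: (@TauInj _ _ _ _ _ _ i) => //; first by rewrite (halfnorm_inj inj).
  by rewrite tE efNl efNr opprK (ef_sroot cartan).
have [_ [ru pu pr]] := tau_negsimple cartan sgn i.
apply: (@TauNeg _ _ _ _ _ _ i); rewrite ?aE //.
  by rewrite efNl efNr opprK (ef_sroot cartan).
by rewrite (halfnorm_proj pr).
Qed.

Lemma corcE a : corc A d a = (fun i => (2 / Kf A d a a) * (d i * a 0 i)).
Proof. by apply/funext => i; rewrite /corc; ring. Qed.

Lemma corc_sroot i : 2 / Kf A d (- sroot i) (- sroot i) = (d i)^-1.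
Proof. by rewrite inv_norm efNl efNr opprK (ef_sroot cartan). Qed.

End Orbits.

(** * Uniqueness on orbits that reach the negative simple roots *)

Section Uniqueness.
Variables (n : nat) (A : 'M[int]_n) (Phi : 'rV[rat]_n -> Prop).
Variable h : 'rV[rat]_n -> 'I_n -> rat.
Implicit Types (a b : 'rV[rat]_n) (f g : 'rV[rat]_n -> 'rV[rat]_n -> rat).
Hypothesis Phi_tau : forall a, Phi a -> Phi (tau A a).
Hypothesis Phi_surj : forall b, Phi b -> exists2 b', Phi b' & tau A b' = b.
Hypothesis Phi_neg : forall i, Phi (- sroot i).

Definition tau_degree f := [/\ forall i b, Phi b -> f (- sroot i) b = b 0 i,
  forall i b, Phi b -> f b (- sroot i) = h b i
  & forall a b, Phi a -> Phi b -> f a b = f (tau A a) (tau A b)].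

(** There are two directions because [tau] comes without an inverse; in the backward one the other
    argument is lifted along [tau] by [Phi_surj]. *)
Definition reaches_neg a := exists m i,
  iter m (tau A) a = - sroot i \/ a = iter m (tau A) (- sroot i).

Lemma Phi_itertau m a : Phi a -> Phi (iter m (tau A) a).
Proof. by move=> pa; elim: m => //= m; apply: Phi_tau. Qed.
Lemma Phi_itersurj m b : Phi b -> exists2 b', Phi b' & iter m (tau A) b' = b.
Proof.
elim: m b => [|m IH] b pb; first by exists b.
by have [b1 /IH[b2 p2 <-] <-] := Phi_surj pb; exists b2.
Qed.
Lemma degree_itertau f m a b : tau_degree f -> Phi a -> Phi b ->
  f a b = f (iter m (tau A) a) (iter m (tau A) b).
Proof.
move=> [_ _ vi] pa pb; elim: m => // m IH.
by rewrite IH !iterS -vi //; apply: Phi_itertau.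
Qed.

Lemma degree_uniq f g a b : tau_degree f -> tau_degree g -> Phi a -> Phi b ->
  reaches_neg a \/ reaches_neg b -> f a b = g a b.
Proof.
move=> df dg pa pb; have [f1 f2 _] := df; have [g1 g2 _] := dg.
case=> -[m [i [E|E]]].
- rewrite (degree_itertau m df) // (degree_itertau m dg) // E f1 ?g1 //; exact: Phi_itertau.
- have [b' pb' <-] := Phi_itersurj m pb.
  by rewrite E -(degree_itertau m df) // -(degree_itertau m dg) // f1 ?g1.
- rewrite (degree_itertau m df) // (degree_itertau m dg) // E f2 ?g2 //; exact: Phi_itertau.
- have [a' pa' <-] := Phi_itersurj m pa.
  by rewrite E -(degree_itertau m df) // -(degree_itertau m dg) // f2 ?g2.
Qed.

End Uniqueness.

(** * Finite type *)

Section FiniteType.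
Variables (n : nat) (A : 'M[int]_n) (d : 'I_n -> rat).
Hypothesis cartan : sym_cartan A d.
Hypothesis fin : finite_type A d.
Implicit Types (u v w x y a b : 'rV[rat]_n) (i j : 'I_n).

Lemma fin_Kge0 v : 0 <= Kf A d v v.
Proof. by have [->|/fin/ltW//] := eqVneq v 0; rewrite (Kf0l cartan). Qed.

Lemma fin_rad v : (forall i, pairc A i v = 0) -> v = 0.
Proof.
move=> /(pairc_rad cartan) h; apply/eqP/negPn/negP => /fin.
by rewrite h ltxx.
Qed.

Lemma fin_sgn v : rootlike A d v -> pos v \/ pos (- v).
Proof.
apply: (rootlike_sign cartan) => [w|w _ w0]; first exact: fin_Kge0.
by left; apply/eqP/negPn/negP => /fin; rewrite w0 ltxx.
Qed.

(** In finite type the orbit closes up exactly. Its sum is fixed by c, hence 0, which is impossible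
    for a sum of positive nonzero vectors. *)
Lemma fin_backward v : rootlike A d v -> pos v -> exists m, ~ pos (iter m (coxinv A) v).
Proof.
move=> rv pv; have [N N0 /fin_rad/eqP] := cox_return cartan fin_Kge0 rv.
rewrite subr_eq0 => /eqP NE; apply: contrapT => nex.
have pX m : pos (iter m (coxinv A) v) by apply: contrapT => h; apply: nex; exists m.
pose S := \sum_(m < N) iter m (coxinv A) v.
have cS : coxinv A S = S.
  rewrite /S coxinv_sum -[LHS]/(\sum_(m < N) (iter m.+1 (coxinv A) v)).
  rewrite (sum_shift (fun m => iter m (coxinv A) v)) -{2}NE (iter_coxK cartan).
  by rewrite subrr addr0.
have /fin_rad S0 : forall i, pairc A i S = 0.
  apply: (rad_pairc cartan); apply: (cox_fix_rad cartan).
  by rewrite -{1}cS (coxinvK cartan).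
have : v == 0; last by rewrite (negPf (rootlike_neq0 rv)).
apply/eqP/rowP => i; rewrite mxE; apply/eqP; rewrite eq_le pv andbT.
have := congr1 (fun w : 'rV_n => w 0 i) S0; rewrite /S summxE mxE.
case: N N0 {NE S cS S0} => // N _; rewrite big_ord_recl /= => E.
have : 0 <= \sum_(m < N) iter m.+1 (coxinv A) v 0 i.
  by apply: sumr_ge0 => m _; apply: (pX m.+1).
by move: E; rewrite /bump /=; lra.
Qed.

Lemma fin_real v : Defs.root A v -> real_root A v.
Proof. by case=> // -[/negP v0 _ /fin_rad v0']; case: v0; rewrite v0'. Qed.

Lemma fin_Phi_cases a : PhiC_fin A a ->
  (rootlike A d a /\ pos a) \/ (exists i, a = - sroot i).
Proof.
case=> [[/fin_real/(real_rootlike cartan) ra pa]|[i ->]]; first by left.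
by right; exists i.
Qed.

Lemma fin_Phi_neg i : PhiC_fin A (- sroot i).
Proof. by right; exists i. Qed.

Lemma fin_Phi_tau a : PhiC_fin A a -> PhiC_fin A (tau A a).
Proof.
case=> [[/fin_real ra pa]|[i ->]]; last first.
  by have [_ [ru pu _]] := tau_negsimple cartan fin_sgn i; left; split=> //; left.
have [[pc ->]|[i [-> _]]] := tau_pos cartan fin_sgn (real_rootlike cartan ra) pa.
  by left; split=> //; left; apply: real_root_cox.
exact: fin_Phi_neg.
Qed.

Lemma fin_Phi_surj b : PhiC_fin A b -> exists2 b', PhiC_fin A b' & tau A b' = b.
Proof.
case=> [[/fin_real rb pb]|[i ->]]; last first.
  have [x [rx px xi _]] := injtype_ex cartan fin_sgn i.
  exists x; first by left; split=> //; left.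
  exact: (tau_injtype cartan fin_sgn (real_rootlike cartan rx)).
have [pc|npc] := pselect (pos (coxinv A b)); last first.
  have [i -> _] := coxinv_npos cartan fin_sgn (real_rootlike cartan rb) pb npc.
  by exists (- sroot i) => //; apply: fin_Phi_neg.
have rc := real_root_coxinv rb.
exists (coxinv A b); first by left; split=> //; left.
by rewrite (tau_cox cartan fin_sgn (real_rootlike cartan rc)) ?(coxinvK cartan).
Qed.

Lemma compat_finE a b : compat_fin A d a b = cpt A d (2 / Kf A d a a) a b.
Proof. by rewrite /compat_fin corcE. Qed.

Lemma fin_degree : tau_degree A (PhiC_fin A) (corc A d) (compat_fin A d).
Proof.
split=> [i b _|i b _|a b pa pb]; rewrite !compat_finE.
- by rewrite (corc_sroot cartan) (cpt_negl cartan).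
- by rewrite cpt_negr corcE.
- exact: (cpt_tau cartan (tau_caseP cartan fin_sgn (fin_Phi_cases pa))
                         (tau_caseP cartan fin_sgn (fin_Phi_cases pb))).
Qed.

Lemma fin_reaches a : PhiC_fin A a -> reaches_neg A a.
Proof.
case/fin_Phi_cases=> [[ra pa]|[i ->]]; last by exists 0%N, i; left.
have [m [i [aE _ _]]] := backward_exit cartan fin_sgn ra pa (fin_backward ra pa).
by exists m.+1, i; right.
Qed.

Theorem fin_compat_unique :
  axioms_fin A d (compat_fin A d) /\
  (forall f : 'rV[rat]_n -> 'rV[rat]_n -> rat, axioms_fin A d f ->
     forall a b, PhiC_fin A a -> PhiC_fin A b -> f a b = compat_fin A d a b).
Proof.
split=> [|f df a b pa pb]; first exact: fin_degree.
apply: (degree_uniq fin_Phi_tau fin_Phi_surj fin_Phi_neg df fin_degree pa pb).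
by left; apply: fin_reaches.
Qed.

(* A root [x] of finite type is moved to a simple root [alpha_i] by a word [l] such
   that the functional [ef x] becomes the [i]-th coordinate. *)
Lemma fin_rotate x : rootlike A d x -> pos x -> exists i l,
  reflw A l x = sroot i /\ forall v, ef A d x v = d i * reflw A l v 0 i.
Proof.
move=> rx px.
have [m [i [_ xE [_ uw _]]]] := backward_exit cartan fin_sgn rx px (fin_backward rx px).
have [uE _] := tau_negsimple cartan fin_sgn i.
(* The word first undoes c^m, leaving the projective vector at i, and then undoes the prefix that
   built it from alpha_i. That prefix does not contain i, so coordinate i survives. *)
pose l := rev (take i (enum 'I_n)) ++ flatten (nseq m (rev (enum 'I_n))).
have lE v : reflw A l v = reflw A (rev (take i (enum 'I_n))) (iter m (coxinv A) v).
  rewrite reflw_cat; congr (reflw _ _ _); elim: (m) => // k IH.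
  by rewrite /= reflw_cat IH coxinvE.
exists i, l; split=> [|v]; rewrite lE.
  by rewrite {1}xE (iter_coxK cartan) uE (reflw_revK cartan).
by rewrite {1}xE (ef_itercoxl cartan) uw reflw_notin // mem_rev mem_take_ord ltnn.
Qed.

End FiniteType.

(** * The finite subsystem obtained by removing the affine node *)

Section Parabolic.
Variables (n : nat) (A : 'M[int]_n) (d : 'I_n -> rat) (aff : 'I_n).
Hypothesis cartan : sym_cartan A d.
Hypothesis fin_sub : forall v : 'rV[rat]_n, v 0 aff = 0 -> v != 0 -> 0 < Kf A d v v.
Implicit Types (u v w x y : 'rV[rat]_n) (i j : 'I_n).

Definition subcartan : 'M[int]_n.-1 := \matrix_(i, j) A (lift aff i) (lift aff j).
Definition subd (i : 'I_n.-1) := d (lift aff i).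
Definition restr v : 'rV[rat]_n.-1 := \row_j v 0 (lift aff j).
Definition extn (v : 'rV[rat]_n.-1) : 'rV[rat]_n :=
  \row_j (if unlift aff j is Some k then v 0 k else 0).

Lemma restrE v k : restr v 0 k = v 0 (lift aff k). Proof. by rewrite mxE. Qed.
Lemma extnK (v : 'rV[rat]_n.-1) : restr (extn v) = v.
Proof. by apply/rowP => k; rewrite !mxE liftK. Qed.
Lemma extn_aff (v : 'rV[rat]_n.-1) : extn v 0 aff = 0.
Proof. by rewrite mxE unlift_none. Qed.

Lemma ltn_lift (k l : 'I_n.-1) : (lift aff k < lift aff l)%N = (k < l)%N.
Proof. by rewrite /= /bump; lia. Qed.

Lemma restr_inj u v : u 0 aff = 0 -> v 0 aff = 0 -> restr u = restr v -> u = v.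
Proof.
move=> u0 v0 E; apply/rowP => j; case: (unliftP aff j) => [k|] ->; last by rewrite u0.
by rewrite -!restrE E.
Qed.

Lemma lowc_sub k l : lowc subcartan k l = lowc A (lift aff k) (lift aff l).
Proof. by rewrite /lowc ltn_lift mxE (inj_eq lift_inj). Qed.

(** [lift aff] is increasing, so the triangular part of the matrix restricts to that of the
    submatrix, and the order of the reflections is kept. *)
Lemma ef_sub v w : v 0 aff = 0 -> w 0 aff = 0 ->
  ef subcartan subd (restr v) (restr w) = ef A d v w.
Proof.
move=> v0 w0; rewrite [RHS]efE (bigD1_ord aff) //= [X in X + _]big1 ?add0r => [|j _]; last first.
  by rewrite v0 !mul0r.
rewrite efE; apply: eq_bigr => k _; rewrite [RHS](bigD1_ord aff) //= w0 mulr0 add0r.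
by apply: eq_bigr => l _; rewrite lowc_sub !restrE.
Qed.

Lemma subcartan_cartan : sym_cartan subcartan subd.
Proof.
case: cartan => h1 h2 h3 h4 h5; split=> [k|k l kl|k l|k|k l]; rewrite ?mxE //.
- by apply: h2; rewrite (inj_eq lift_inj).
- exact: h3.
- exact: h4.
- exact: h5.
Qed.

Lemma Kf_sub v : v 0 aff = 0 -> Kf subcartan subd (restr v) (restr v) = Kf A d v v.
Proof. by move=> v0; rewrite (Kf_diag cartan) (Kf_diag subcartan_cartan) ef_sub. Qed.

Lemma subcartan_finite : finite_type subcartan subd.
Proof.
move=> v v0; rewrite -(extnK v) Kf_sub ?extn_aff //; apply: fin_sub; rewrite ?extn_aff //.
apply: contra v0 => /eqP E; rewrite -(extnK v) E.
by apply/eqP/rowP => k; rewrite !mxE.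
Qed.

(** Here the lattice notion pays off: the corresponding statement for [real_root] would require a
    theorem on parabolic subgroups. *)
Lemma rootlike_sub v : v 0 aff = 0 -> rootlike A d v -> rootlike subcartan subd (restr v).
Proof.
move=> v0 [p vi vci]; split=> [|k|k]; rewrite ?ef_sub // !restrE //; exact: vci.
Qed.

Lemma pairc_sub k v : v 0 aff = 0 -> pairc subcartan k (restr v) = pairc A (lift aff k) v.
Proof.
move=> v0; rewrite /pairc [RHS](bigD1_ord aff) //= v0 mulr0 add0r.
by apply: eq_bigr => l _; rewrite restrE mxE.
Qed.

Lemma restr_reflw l v : v 0 aff = 0 ->
  restr (reflw A (map (lift aff) l) v) = reflw subcartan l (restr v) /\
  reflw A (map (lift aff) l) v 0 aff = 0.
Proof.
move=> v0; elim: l => //= k l [IH IH0]; split.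
  rewrite -IH; apply/rowP => j; rewrite restrE !reflE pairc_sub // restrE.
  by rewrite (inj_eq lift_inj).
by rewrite reflE IH0 (negPf (neq_lift _ _)) mulr0 subr0.
Qed.

Lemma parabolic_rotate x : rootlike A d x -> pos x -> x 0 aff = 0 -> exists i l,
  [/\ i != aff, aff \notin l, reflw A l x = sroot i
    & forall v, v 0 aff = 0 -> ef A d x v = d i * reflw A l v 0 i].
Proof.
move=> rx px x0; have px' : pos (restr x) by move=> k; rewrite restrE.
have [k [l [lE lw]]] := fin_rotate subcartan_cartan subcartan_finite (rootlike_sub x0 rx) px'.
exists (lift aff k), (map (lift aff) l); split.
- by rewrite eq_sym neq_lift.
- by apply/mapP => -[j _ E]; have := neq_lift aff j; rewrite -E eqxx.
- have [E E0] := restr_reflw l x0; apply: restr_inj => //.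
    by rewrite srootE (negPf (neq_lift _ _)).
  rewrite E lE; apply/rowP => j; rewrite restrE !srootE (inj_eq lift_inj) //.
- move=> v v0; have [E E0] := restr_reflw l v0.
  by rewrite -ef_sub // lw -E restrE.
Qed.

End Parabolic.

(** * Combinatorics of intervals on a cycle *)

Lemma arc_shape (k : nat) (T : nat -> rat) (r : rat) :
    (1 < k)%N -> T k = T 0%N -> T k.-1 = 0 -> 0 < T 0%N -> 0 < r ->
    (forall m, T m.+1 - T m \is a Num.int) ->
    (forall m, (T m.+1 - T m) / r \is a Num.int) ->
    \sum_(m < k) (T m.+1 - T m) ^+ 2 = 2 * r ->
  exists2 l, (0 < l < k)%N & forall m, (m < k)%N -> T m = (m < l)%N%:R.
Proof.
(* Around the cycle T rises at k-1 and must fall at some q. By integrality each of these steps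
   satisfies |D| >= 1 and |D| >= r, so D^2 >= |D| >= r. Together they exhaust the total 2 r: both
   have absolute value 1 and all other steps are 0. *)
move=> k1 Tk Tl T0 r0 Di Dr sE; pose D m := T m.+1 - T m.
have pk : (k.-1 < k)%N by lia.
have Dp : D k.-1 = T 0%N by rewrite /D prednK ?Tk ?Tl ?subr0 //; lia.
have [q qk Dq] : exists2 q, (q < k.-1)%N & D q < 0.
  apply: contrapT => nex.
  have mono m : (m <= k.-1)%N -> T 0%N <= T m.
    elim: m => // m IH mk; apply: le_trans (IH (ltnW mk)) _.
    rewrite -subr_ge0 leNgt; apply/negP => h; apply: nex; exists m => //.
  by have := mono k.-1 (leqnn _); rewrite Tl leNgt T0.
have qk' : (q < k)%N by lia.
have bnd (x : rat) : x \is a Num.int -> x / r \is a Num.int -> 0 < x -> 1 <= x /\ r <= x.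
  move=> xi xr x0; split; first exact: int_ge1.
  by have := int_ge1 xr; rewrite divr_gt0 // ler_pdivlMr // mul1r => /(_ isT).
have [p1 pr] : 1 <= D k.-1 /\ r <= D k.-1 by apply: bnd; rewrite ?Dp // -Dp; [apply: Di|apply: Dr].
have [q1 qr] : 1 <= - D q /\ r <= - D q.
  apply: bnd; rewrite ?oppr_gt0 // ?mulNr rpredN; [exact: Di|exact: Dr].
move: sE; rewrite (bigD1 (Ordinal pk)) //= (bigD1 (Ordinal qk')) /=; last first.
  by rewrite -val_eqE /= ltn_eqF.
set rest := \sum_(i < k | _) _; rewrite -/(D k.-1) -/(D q) => sE.
have rest0 : 0 <= rest by apply: sumr_ge0 => m _; apply: sqr_ge0.
have sp : D k.-1 <= D k.-1 ^+ 2 by rewrite expr2 ler_peMr // (le_trans ler01).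
have sq : - D q <= D q ^+ 2 by rewrite -sqrrN expr2 ler_peMr // (le_trans ler01).
have re0 : rest = 0 by lra.
have Dp1 : D k.-1 = 1.
  have : D k.-1 ^+ 2 = D k.-1 by lra.
  rewrite expr2 -[RHS]mul1r => /mulIf; apply; rewrite gt_eqF //; exact: lt_le_trans ltr01 p1.
have Dq1 : D q = -1.
  have : (- D q) ^+ 2 = - D q by rewrite sqrrN; lra.
  rewrite expr2 -[RHS]mul1r => /mulIf h; apply: oppr_inj; rewrite opprK; apply: h.
  rewrite gt_eqF //; exact: lt_le_trans ltr01 q1.
have D0 m : (m < k)%N -> m != k.-1 -> m != q -> D m = 0.
  move=> mk mp mq; move/eqP: re0; rewrite psumr_eq0 => [|i _]; last exact: sqr_ge0.
  have mp' : Ordinal mk != Ordinal pk by rewrite -val_eqE.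
  have mq' : Ordinal mk != Ordinal qk' by rewrite -val_eqE.
  move=> /allP/(_ (Ordinal mk)); rewrite mem_index_enum mp' mq' /= => /(_ isT).
  by rewrite sqrf_eq0 => /eqP.
have T01 : T 0%N = 1 by rewrite -Dp.
exists q.+1 => [|m mk]; first by clear -qk k1; lia.
have lo a : (a <= q)%N -> T a = 1.
  elim: a => // a IH aq; have := D0 a; rewrite /D => h.
  have /eqP : T a.+1 - T a = 0 by apply: h; clear -aq qk k1; lia.
  by rewrite subr_eq0 => /eqP ->; apply: IH; apply: ltnW.
have hi a : (q < a < k)%N -> T a = 0.
  elim: a => // a IH aq; have [aE|aq'] := eqVneq a q.
    by have := Dq1; rewrite /D -aE (lo a) ?aE //; lra.
  have := D0 a; rewrite /D => h; have /eqP : T a.+1 - T a = 0 by apply: h; clear -aq aq' k1; lia.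
  by rewrite subr_eq0 => /eqP ->; apply: IH; clear -aq aq' k1; lia.
rewrite ltnS; case: leqP => mq; [exact: lo|by apply: hi; rewrite mq].
Qed.

Lemma sum_eq_mem (T : eqType) (s : seq T) (w : T) : uniq s ->
  \sum_(z <- s) (z == w)%:R = (w \in s)%:R :> rat.
Proof.
elim: s => [|z s IH] /=; first by rewrite big_nil.
move=> /andP[zs us]; rewrite big_cons IH // inE eq_sym.
by case: eqP => [->|_]; rewrite ?(negPf zs) ?addr0 ?add0r.
Qed.

Lemma max_eqP (x y z : rat) : x <= z -> y <= z -> (z <= x) || (z <= y) -> Num.max x y = z.
Proof.
by move=> xz yz h; apply: le_anti; rewrite ge_max xz yz le_max.
Qed.

(** The cyclic interval of length m starting at s, for positions q and s below k; the second
    alternative is the part that wraps around past k - 1. *)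
Definition in_arc (k s m q : nat) : bool := (s <= q < s + m)%N || (q + k < s + m)%N.

Lemma in_arc_gap k s m : (0 < m < k)%N -> (s < k)%N ->
  exists2 q, (q < k)%N & ~~ in_arc k s m q.
Proof.
move=> mk sk; case: (ltnP (s + m) k) => h; rewrite /in_arc.
  by exists (s + m)%N => //; lia.
exists (s + m - k)%N; lia.
Qed.

Lemma in_arc_superset k l s m q : (0 < l < k)%N -> (0 < m < k)%N -> (s < k)%N ->
  in_arc k s m 0 -> in_arc k s m l.-1 -> in_arc k s m q -> (l <= q < k)%N ->
  in_arc k s m k.-1 || in_arc k s m l.
Proof. by rewrite /in_arc; lia. Qed.

Lemma in_arc_subset k l s m q : (0 < l < k)%N -> (0 < m < k)%N -> (s < k)%N ->
  in_arc k s m k.-1 = false -> in_arc k s m l = false -> (q < l)%N -> ~~ in_arc k s m q ->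
  ~~ (in_arc k s m 0 && in_arc k s m l.-1).
Proof. by rewrite /in_arc; lia. Qed.

(** The interval [0, l) and the arc leave a common gap q0, and neither contains the other. Hence the
    arc contains at most one of the neighbours k-1 and l of the interval (one point if l = k-1), and
    if it contains one, it misses the opposite end of the interval. *)
Lemma in_arc_overlap k l s m q0 qa qb :
    (0 < l < k)%N -> (0 < m < k)%N -> (s < k)%N ->
    (l <= q0 < k)%N -> ~~ in_arc k s m q0 -> (qa < l)%N -> ~~ in_arc k s m qa ->
    (l <= qb < k)%N -> in_arc k s m qb ->
  [\/ [/\ in_arc k s m k.-1, ~~ in_arc k s m l.-1, l = k.-1 -> in_arc k s m l
        & l != k.-1 -> ~~ in_arc k s m l],
      [/\ in_arc k s m l, ~~ in_arc k s m 0 & ~~ in_arc k s m k.-1]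
    | ~~ in_arc k s m k.-1 /\ ~~ in_arc k s m l ].
Proof.
move=> h1 h2 h3 h4 h5 h6 h7 h8 h9.
case E1 : (in_arc k s m k.-1).
  apply: Or31; move: E1 h5 h7 h9; rewrite /in_arc => E1 h5 h7 h9; split=> //; lia.
case E2 : (in_arc k s m l); last exact: Or33.
by apply: Or32; move: E1 E2 h5 h7 h9; rewrite /in_arc => E1 E2 h5 h7 h9; split=> //; lia.
Qed.

(** [i0] makes n positive, so that rank [n.-1] means a kernel of dimension 1. *)
Lemma kernel_line (n : nat) (B : 'M[int]_n) (i0 : 'I_n) (u v : 'rV[rat]_n) :
  \rank (map_mx (fun x : int => x%:~R : rat) B) = n.-1 -> u != 0 ->
  (forall i, pairc B i u = 0) -> (forall i, pairc B i v = 0) -> exists s, v = s *: u.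
Proof.
set M := map_mx _ B => rM u0 ku kv.
have kE w : (forall i, pairc B i w = 0) -> (w <= kermx M^T)%MS.
  move=> kw; apply/sub_kermxP/rowP => i; rewrite !mxE -[RHS](kw i).
  by apply: eq_bigr => j _; rewrite !mxE mulrC.
have rk : \rank (kermx M^T) = 1%N.
  by rewrite mxrank_ker mxrank_tr rM; case: (n) i0 => [[]|k _]//; rewrite subSnn.
have : (kermx M^T <= u)%MS.
  have := mxrank_leqif_sup (kE u ku); rewrite rk rank_rV u0 => -[_ <-]; exact: eqxx.
by move=> /(submx_trans (kE v kv))/sub_rVP.
Qed.

(** * Affine type *)

Section Affine.
Variables (n : nat) (A : 'M[int]_n) (d : 'I_n -> rat) (delta dv : 'rV[rat]_n).
Variables (aff : 'I_n) (g : 'rV[rat]_n).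
Hypothesis cartan : sym_cartan A d.
Hypothesis affA : affine_type A d.
Hypothesis delta_def : is_delta A delta.
Implicit Types (u v w x y z a b : 'rV[rat]_n) (i j : 'I_n).

Let dgt0 i : 0 < d i. Proof. by case: cartan. Qed.

Lemma aff_Kge0 v : 0 <= Kf A d v v. Proof. by case: affA. Qed.

Lemma delta_neq0 : delta != 0. Proof. by case: delta_def => -[]. Qed.
Lemma pairc_delta i : pairc A i delta = 0.
Proof. by case: delta_def => -[_ _ h] _ _; apply: h. Qed.

Lemma aff_rad v : (forall i, pairc A i v = 0) -> exists s, v = s *: delta.
Proof.
by case: affA => _ _ rA; apply: (kernel_line aff rA delta_neq0 pairc_delta).
Qed.

(** If delta vanished somewhere, indecomposability would give an edge from its zero set to the
    complement; the row of A delta at that end has only nonpositive terms and one negative term, yet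
    its sum is 0. *)
Lemma delta_gt0 i : 0 < delta 0 i.
Proof.
have [imd pd _] := delta_def; pose S := [set i | delta 0 i == 0].
have [S0|S0] := eqVneq S set0.
  rewrite lt_def pd andbT; apply/negP => h.
  by have := in_set0 i; rewrite -S0 inE h.
have ST : S != setT.
  apply/eqP => ST; have := delta_neq0; rewrite (_ : delta = 0) ?eqxx //.
  apply/rowP => j; rewrite mxE; apply/eqP.
  by have := in_setT j; rewrite -ST inE.
case: affA => indec _ _; have [a [b [aS bS]]] := indec S S0 ST.
have := pairc_delta a; rewrite /pairc (bigD1 b) //=.
move: aS bS; rewrite !inE => /eqP a0 b0 /eqP E nz; exfalso; move: nz.
have nab : a != b by apply: contraNneq b0 => <-; rewrite a0.
have bpos : 0 < delta 0 b by rewrite lt_def b0 pd.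
have Ale c : c != a -> (A a c)%:~R <= 0 :> rat.
  by move=> ca; rewrite lerz0; case: cartan => _ h _ _ _; apply: h; rewrite eq_sym.
have rest : \sum_(j < n | j != b) (A a j)%:~R * delta 0 j <= 0.
  apply: sumr_le0 => j _; have [->|ja] := eqVneq j a; first by rewrite a0 mulr0.
  by rewrite mulr_le0_ge0 ?Ale.
have t0 : (A a b)%:~R * delta 0 b <= 0 by rewrite mulr_le0_ge0 ?Ale 1?eq_sym // ltW.
have /eqP : (A a b)%:~R * delta 0 b = 0 by move: E t0 rest; lra.
by rewrite mulf_eq0 (gt_eqF bpos) orbF intr_eq0 => /eqP -> /eqP.
Qed.

Lemma delta_pos : pos delta. Proof. by move=> i; rewrite ltW ?delta_gt0. Qed.

Lemma aff_null_full v : pos v -> Kf A d v v = 0 -> v = 0 \/ forall i, 0 < v 0 i.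
Proof.
move=> pv /(null_rad cartan aff_Kge0)/aff_rad[s vE].
have [s0|s0] := eqVneq s 0; first by left; rewrite vE s0 scale0r.
right=> i; rewrite lt_def pv andbT vE mxE mulf_neq0 // gt_eqF //; exact: delta_gt0.
Qed.

Lemma aff_sgn v : rootlike A d v -> pos v \/ pos (- v).
Proof. exact: (rootlike_sign cartan aff_Kge0 aff_null_full). Qed.

(** * The defect and regular roots *)

Lemma Kf_delta v : Kf A d delta v = 0.
Proof. exact: (pairc_rad cartan pairc_delta). Qed.
Lemma ef_deltar v : ef A d v delta = - ef A d delta v.
Proof. by have := Kf_delta v; rewrite (KfE cartan); lra. Qed.
Lemma ef_delta2 : ef A d delta delta = 0.
Proof. by have := Kf_delta delta; rewrite (Kf_diag cartan); lra. Qed.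
Lemma cox_delta : cox A delta = delta.
Proof. exact/cox_rad/pairc_delta. Qed.
Lemma coxinv_delta : coxinv A delta = delta.
Proof. exact/coxinv_rad/pairc_delta. Qed.
Lemma ef_delta_cox v : ef A d delta (cox A v) = ef A d delta v.
Proof. by rewrite -{1}cox_delta (ef_cox2 cartan). Qed.
Lemma ef_delta_coxinv v : ef A d delta (coxinv A v) = ef A d delta v.
Proof. by rewrite -ef_delta_cox (coxinvK cartan). Qed.
Lemma ef_delta_itercox m v : ef A d delta (iter m (cox A) v) = ef A d delta v.
Proof. by elim: m => //= m IH; rewrite ef_delta_cox. Qed.

(** [ef delta] is the defect. It is constant on c-orbits and has opposite strict signs on the
    injective and the projective type, so a root of defect 0 can never leave the positive cone. *)
Lemma injtype_delta v i : injtype A d v i -> 0 < ef A d delta v.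
Proof. by case=> _ -> _; rewrite mulr_gt0 // delta_gt0. Qed.
Lemma projtype_delta v i : projtype A d v i -> ef A d delta v < 0.
Proof.
by case=> _ h _; rewrite -oppr_gt0 -ef_deltar h mulr_gt0 // delta_gt0.
Qed.

Lemma U_cox_pos v : rootlike A d v -> pos v -> ef A d delta v = 0 -> pos (cox A v).
Proof.
move=> rv pv v0; apply: contrapT => /(cox_npos cartan aff_sgn rv pv)[i _ /injtype_delta].
by rewrite v0 ltxx.
Qed.
Lemma U_coxinv_pos v : rootlike A d v -> pos v -> ef A d delta v = 0 -> pos (coxinv A v).
Proof.
move=> rv pv v0; apply: contrapT => /(coxinv_npos cartan aff_sgn rv pv)[i _ /projtype_delta].
by rewrite v0 ltxx.
Qed.

Definition regular v :=
  (forall m, pos (iter m (cox A) v)) /\ (forall m, pos (iter m (coxinv A) v)).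

Lemma U_regular v : rootlike A d v -> pos v -> ef A d delta v = 0 -> regular v.
Proof.
move=> rv pv v0; split=> m.
  suff [] : [/\ rootlike A d (iter m (cox A) v), pos (iter m (cox A) v)
    & ef A d delta (iter m (cox A) v) = 0] by [].
  elim: m => // m [r p e]; split; rewrite iterS.
  - exact: rootlike_cox.
  - exact: U_cox_pos.
  - by rewrite ef_delta_cox.
suff [] : [/\ rootlike A d (iter m (coxinv A) v), pos (iter m (coxinv A) v)
  & ef A d delta (iter m (coxinv A) v) = 0] by [].
elim: m => // m [r p e]; split; rewrite iterS.
- exact: rootlike_coxinv.
- exact: U_coxinv_pos.
- by rewrite ef_delta_coxinv.
Qed.
Lemma regular_coxinv v : regular v -> regular (coxinv A v).
Proof.
move=> [h1 h2]; split=> m; last by rewrite -iterSr; apply: h2.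
case: m => [|m]; first exact: (h2 1%N).
by rewrite iterSr (coxinvK cartan).
Qed.

Lemma iter_translate f v s : (forall u w, f (u + w) = f u + f w) ->
    (forall c w, f (c *: w) = c *: f w) -> f delta = delta ->
  forall N, iter N f v = v + s *: delta ->
  forall m, iter (m * N) f v = v + (m%:R * s) *: delta.
Proof.
move=> fD fZ fd N h.
have hd k c : iter k f (c *: delta) = c *: delta.
  by elim: k => //= k ->; rewrite fZ fd.
have hD k u w : iter k f (u + w) = iter k f u + iter k f w.
  by elim: k => //= k ->; rewrite fD.
elim=> [|m IH]; first by rewrite mul0r scale0r addr0.
rewrite mulSn iterD IH hD h hd -addrA -scalerDl; congr (_ + _ *: _).
by rewrite -natr1; ring.
Qed.

Lemma translate_exit f v s : (forall u w, f (u + w) = f u + f w) ->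
    (forall c w, f (c *: w) = c *: f w) -> f delta = delta ->
  forall N, iter N f v = v + s *: delta -> s < 0 -> exists m, ~ pos (iter m f v).
Proof.
(* After more than b periods the coordinate at [aff] has become negative. *)
move=> fD fZ fd N h s0; pose b := v 0 aff / (- s * delta 0 aff).
have den : 0 < - s * delta 0 aff by rewrite mulr_gt0 ?oppr_gt0 ?delta_gt0.
pose m := (Num.bound b); exists (m * N)%N => /(_ aff).
rewrite (iter_translate fD fZ fd h) !mxE leNgt => /negP; apply.
have [b0|b0] := lerP 0 b; last first.
  have v0 : v 0 aff < 0 by move: b0; rewrite /b pmulr_llt0 // invr_gt0.
  rewrite -mulrA; have : m%:R * (s * delta 0 aff) <= 0; last by move: v0; lra.
  by rewrite mulr_ge0_le0 // mulr_le0_ge0 ?ltW ?delta_gt0.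
have := archi_boundP b0; rewrite -/m /b ltr_pdivrMr //; lra.
Qed.

(** By [cox_return] some power of c translates v by s delta. If s is not 0, the orbit leaves the
    positive cone in one direction. If s = 0, the sum of the N terms is a multiple of delta, so its
    defect, N times that of v, is 0. *)
Lemma regular_U v : rootlike A d v -> regular v -> ef A d delta v = 0.
Proof.
move=> rv [h1 h2].
have [N N0 /aff_rad[s /eqP]] := cox_return cartan aff_Kge0 rv.
rewrite subr_eq [X in _ == X]addrC => /eqP NE.
have [s0|s0|s0] := ltrgtP s 0.
- by have [m []] := translate_exit (@coxD _ A) (@coxZ _ A) cox_delta NE s0.
- have NE' : iter N (coxinv A) v = v + (- s) *: delta.
    have : iter N (coxinv A) (iter N (cox A) v) = v by rewrite (iter_coxK cartan).
    rewrite NE; have hD k u w : iter k (coxinv A) (u + w) = iter k (coxinv A) u + iter k (coxinv A) w.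
      by elim: k => //= k ->; rewrite coxinvD.
    have hd k c : iter k (coxinv A) (c *: delta) = c *: delta.
      by elim: k => //= k ->; rewrite coxinvZ coxinv_delta.
    by rewrite hD hd => E; rewrite -[in RHS]E scaleNr addrK.
  have ns0 : - s < 0 by rewrite oppr_lt0.
  by have [m []] := translate_exit (@coxinvD _ A) (@coxinvZ _ A) coxinv_delta NE' ns0.
pose S := \sum_(m < N) iter m (cox A) v.
have cS : cox A S = S.
  rewrite /S cox_sum -[LHS]/(\sum_(m < N) (iter m.+1 (cox A) v)).
  rewrite (sum_shift (fun m => iter m (cox A) v)) NE s0 scale0r addr0.
  by rewrite subrr addr0.
have [t SE] := aff_rad (rad_pairc cartan (cox_fix_rad cartan cS)).
have := ef_delta2; move/(congr1 (fun c => t * c)); rewrite -efZr -SE mulr0 /S ef_sumr.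
under eq_bigr => m _ do rewrite ef_delta_itercox.
rewrite sumr_const card_ord => /eqP; rewrite mulrn_eq0 => /orP[|/eqP//].
by rewrite eqn0Ngt N0.
Qed.

(* Preprojective roots pair nonnegatively with regular ones: along its orbit
   [eta] becomes a root representing a coordinate functional. *)
Lemma ef_regular_ge0 eta x : rootlike A d eta -> 0 < ef A d eta delta -> regular x ->
  0 <= ef A d eta x.
Proof.
have H e : rootlike A d e -> pos e -> regular x ->
    (0 < ef A d e delta -> 0 <= ef A d e x) /\ (ef A d e delta < 0 -> ef A d e x <= 0).
  move=> re pe [h1 h2].
  have [e0|e0] := eqVneq (ef A d delta e) 0.
    by rewrite ef_deltar e0 oppr0 ltxx.
  have : (exists m, ~ pos (iter m (cox A) e)) \/ (exists m, ~ pos (iter m (coxinv A) e)).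
    apply: contrapT => /not_orP[n1 n2]; move/eqP: e0; apply.
    apply: regular_U => //; split=> m; apply: contrapT => h.
      by apply: n1; exists m.
    by apply: n2; exists m.
  case=> [/(forward_exit cartan aff_sgn re pe)[m [i [_ ij]]]
         |/(backward_exit cartan aff_sgn re pe)[m [i [_ eE pj]]]].
    split=> [|_].
      rewrite ef_deltar oppr_gt0 -(ef_delta_itercox m) => h.
      by have := lt_trans (injtype_delta ij) h; rewrite ltxx.
    rewrite -[e](iter_coxK cartan m) (ef_itercoxinvl cartan) -[ef A d _ _]opprK.
    rewrite -(ef_cox cartan); case: ij => _ -> _; rewrite oppr_le0 mulr_ge0 ?(ltW (dgt0 i)) //.
    by rewrite -iterS; apply: h1.
  split=> [_|].
    rewrite eE (ef_itercoxl cartan); case: pj => _ -> _.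
    by rewrite mulr_ge0 ?(ltW (dgt0 i)) //; apply: h2.
  rewrite ef_deltar oppr_lt0 eE ef_delta_itercox => h.
  by have := lt_trans (projtype_delta pj) h; rewrite ltxx.
move=> re e0 xr; have [pe|ne] := aff_sgn re; first by case: (H eta re pe xr) => h _; apply: h.
have [_] := H _ (rootlikeN re) ne xr; rewrite !efNl oppr_lt0 oppr_le0; exact.
Qed.

Lemma ef_regular_sign eta x : rootlike A d eta -> regular x -> 0 < ef A d x eta ->
  ef A d eta delta <= 0.
Proof.
move=> re xr; rewrite (ef_coxinv cartan) => h; rewrite leNgt; apply/negP => e0.
by have := ef_regular_ge0 re e0 (regular_coxinv xr); move: h; lra.
Qed.

Hypothesis g_def : cox A g = g + delta.

(** Expand [ef (cox A g) v = - ef v g] at c g = g + delta. The equation of gamma_c serves only to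
    identify U_c with the kernel of the defect. *)
Lemma UcE v : Uc A d g v <-> ef A d delta v = 0.
Proof.
rewrite /Uc; suff -> : Kf A d g v = - ef A d delta v.
  by split=> [/eqP|->]; rewrite ?oppr0 // oppr_eq0 => /eqP.
by have := ef_cox cartan v g; rewrite g_def efDl (KfE cartan); lra.
Qed.

Definition ups v := [/\ Defs.root A v, pos v & ef A d delta v = 0].

Lemma Ups_posE v : Ups_pos A d g v <-> ups v.
Proof. by split=> -[rv pv /UcE]. Qed.

Lemma ups_real v : real_root A v -> pos v -> ef A d delta v = 0 -> ups v.
Proof. by split=> //; left. Qed.

Lemma ups_delta : ups delta.
Proof. by split; [right; case: delta_def|apply: delta_pos|apply: ef_delta2]. Qed.

Lemma ups_neq0 v : ups v -> v != 0.
Proof. by case=> -[/(real_rootlike cartan)/rootlike_neq0|[]]. Qed.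

Lemma ups_cox v : ups v -> ups (cox A v).
Proof.
move=> [[rv|[v0 iv kv]] pv ev]; last first.
  by rewrite cox_rad //; split=> //; right.
have rl := real_rootlike cartan rv.
by apply: ups_real; [apply: real_root_cox|apply: U_cox_pos|rewrite ef_delta_cox].
Qed.
Lemma ups_coxinv v : ups v -> ups (coxinv A v).
Proof.
move=> [[rv|[v0 iv kv]] pv ev]; last first.
  by rewrite coxinv_rad //; split=> //; right.
have rl := real_rootlike cartan rv.
by apply: ups_real; [apply: real_root_coxinv|apply: U_coxinv_pos|rewrite ef_delta_coxinv].
Qed.

Lemma ups_regular v : real_root A v -> pos v -> ef A d delta v = 0 -> regular v.
Proof. by move=> /(real_rootlike cartan); apply: U_regular. Qed.

Lemma root_Kneq0 v : Defs.root A v -> Kf A d v v != 0 -> real_root A v.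
Proof.
by case=> // -[_ _ /(pairc_rad cartan) ->]; rewrite eqxx.
Qed.

(** * The cone spanned by the canonical simple system of Upsilon_c *)

Variable P : seq 'rV[rat]_n.
Hypothesis Pic : is_Pic A d g P.

(** [nonneg_span] admits a list with repetitions; here each element of [P] has exactly one
    coefficient. *)
Definition cone v := exists2 c : 'rV[rat]_n -> rat,
  (forall z, 0 <= c z) & v = \sum_(z <- P) c z *: z.

Lemma P_uniq : uniq P. Proof. by case: Pic. Qed.
Lemma P_ups z : z \in P -> ups z.
Proof. by case: Pic => _ h _ _ /h/Ups_posE. Qed.

Lemma ups_cone v : ups v -> cone v.
Proof.
case: Pic => _ _ h _ /Ups_posE/h[s [hs ->]].
exists (fun z => \sum_(x <- s | x.1 == z) x.2) => [z|].
  by rewrite big_seq_cond; apply: sumr_ge0 => x /andP[/hs[]].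
rewrite (eq_bigr _ (fun z _ => scaler_suml _ _ _ _)).
rewrite (exchange_big_dep xpredT) //= big_seq [RHS]big_seq; apply: eq_bigr => x xs.
have [xP _] := hs x xs.
rewrite -big_filter (eq_filter (a2 := pred1 x.1)) => [|z]; last by rewrite /= eq_sym.
by rewrite (filter_pred1_uniq P_uniq xP) big_seq1.
Qed.

Lemma coneD u v : cone u -> cone v -> cone (u + v).
Proof.
move=> [c c0 ->] [e e0 ->]; exists (fun z => c z + e z) => [z|]; first exact: addr_ge0.
by rewrite -big_split; apply: eq_bigr => z _; rewrite scalerDl.
Qed.
Lemma coneZ s v : 0 <= s -> cone v -> cone (s *: v).
Proof.
move=> s0 [c c0 ->]; exists (fun z => s * c z) => [z|]; first exact: mulr_ge0.
by rewrite scaler_sumr; apply: eq_bigr => z _; rewrite scalerA.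
Qed.
Lemma cone0 : cone 0.
Proof. by exists (fun=> 0) => //; rewrite big1 // => z _; rewrite scale0r. Qed.
Lemma cone_sum (I : eqType) (r : seq I) (Q : pred I) (F : I -> 'rV_n) :
  (forall k, k \in r -> Q k -> cone (F k)) -> cone (\sum_(k <- r | Q k) F k).
Proof.
move=> h; rewrite big_seq_cond; apply: (big_ind cone); [exact: cone0|exact: coneD|].
by move=> i /andP[]; apply: h.
Qed.

Lemma cone_free c z : (forall z, 0 <= c z) -> \sum_(z <- P) c z *: z = 0 ->
  z \in P -> c z = 0.
Proof.
move=> c0 s0 zP; have [_ pz _] := P_ups zP.
have [i zi] : exists i, z 0 i != 0.
  apply/existsP; rewrite -negb_forall; apply: contra (ups_neq0 (P_ups zP)) => /forallP h.
  by apply/eqP/rowP => i; rewrite mxE; apply/eqP.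
have /eqP := congr1 (fun w : 'rV_n => w 0 i) s0; rewrite summxE mxE big_seq.
rewrite psumr_eq0 => [/allP/(_ z zP)|y yP]; last first.
  by rewrite mxE mulr_ge0 //; case: (P_ups yP).
by rewrite zP mxE mulf_eq0 (negPf zi) orbF => /eqP.
Qed.

(** This replaces the uniqueness of coefficients, which fails as soon as [P] contains two c-orbits.
    Let m be the coefficient of z in u + v. If m >= 1, the surplus is a nonnegative combination
    equal to 0, so nothing but z occurs. If m < 1, z is a combination of the others, against the
    minimality of [P]. *)
Lemma P_extremal z u v : z \in P -> cone u -> cone v -> z = u + v ->
  exists2 s, 0 <= s & u = s *: z.
Proof.
move=> zP [c c0 uE] [e e0 vE] zE.
have split1 (f : 'rV_n -> rat) :
    \sum_(y <- P) f y *: y = f z *: z + \sum_(y <- P | y != z) f y *: y.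
  by rewrite (bigD1_seq z) //= P_uniq.
pose m : rat := c z + e z; have sE : z = \sum_(y <- P) (c y + e y) *: y.
  by rewrite zE uE vE -big_split; apply: eq_bigr => y _; rewrite scalerDl.
have [m1|m1] := ltrP m 1; last first.
  pose f y : rat := c y + e y - (y == z)%:R.
  have f0 y : 0 <= f y.
    rewrite /f; case: eqP => [->|_]; first by rewrite subr_ge0.
    by rewrite subr0 addr_ge0.
  have fs : \sum_(y <- P) f y *: y = 0.
    rewrite split1 (eq_bigr (fun y => (c y + e y) *: y)) => [|y /negPf yz]; last first.
      by rewrite /f yz subr0.
    by rewrite /f eqxx scalerBl scale1r addrAC -split1 -sE subrr.
  exists (c z) => //; rewrite {1}uE split1 big_seq_cond big1 ?addr0 // => y /andP[yP yz].
  have := cone_free f0 fs yP; rewrite /f (negPf yz) subr0 => cy.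
  have -> : c y = 0 by have := c0 y; have := e0 y; row_lra.
  by rewrite scale0r.
exfalso; pose f y : rat := (c y + e y) / (1 - m).
have f0 y : 0 <= f y by apply: divr_ge0; [apply: addr_ge0|rewrite subr_ge0 ltW].
have zf : z = \sum_(y <- P | y != z) f y *: y.
  have m1' : 1 - m != 0 by rewrite subr_eq0 gt_eqF.
  apply: (scalerI m1'); rewrite scaler_sumr.
  rewrite (eq_bigr (fun y => (c y + e y) *: y)) => [|y _]; last first.
    by rewrite scalerA /f mulrC divfK.
  apply/eqP; rewrite scalerBl scale1r subr_eq addrC -/m; apply/eqP.
  by rewrite {1}sE split1.
case: Pic => _ _ _ /(_ (fun y => y \in P /\ y != z)) h.
have [] : z \in P /\ z != z; last by rewrite eqxx.
apply: h => // [y []//|v' /Ups_posE/ups_cone[b b0 v'E]].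
exists [seq (y, b y + b z * f y) | y <- P & y != z]; split.
  move=> x /mapP[y]; rewrite mem_filter => /andP[yz yP] -> /=; split=> //.
  by rewrite addr_ge0 // mulr_ge0.
have bz : b z *: z = \sum_(y <- P | y != z) (b z * f y) *: y.
  by rewrite {2}zf scaler_sumr; apply: eq_bigr => y _; rewrite scalerA.
rewrite big_map big_filter v'E split1 bz -big_split; apply: eq_bigr => y _ /=.
by rewrite -scalerDl addrC.
Qed.

(** [P] may contain an imaginary root, as it does in rank two, where U_c contains no real root. *)
Definition PR x := x \in P /\ real_root A x.

Lemma PR_ups x : PR x -> [/\ rootlike A d x, pos x & ef A d delta x = 0].
Proof. by case=> /P_ups[_ px ex] /(real_rootlike cartan). Qed.

Lemma real_pos_prop s x y : real_root A x -> real_root A y -> pos x -> pos y ->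
  y = s *: x -> y = x.
Proof.
move=> /(real_rootlike cartan) rx /(real_rootlike cartan) ry px py yE.
have [s1|s1] := rootlike_prop cartan rx ry yE; rewrite s1 in yE.
  by rewrite yE scale1r.
by case: (rootlike_npos rx px); rewrite -scaleN1r -yE.
Qed.

Lemma ups_root v : real_root A v -> ef A d delta v = 0 -> ups v \/ ups (- v).
Proof.
move=> rv ev; have [pv|nv] := aff_sgn (real_rootlike cartan rv).
  by left; apply: ups_real.
by right; apply: ups_real; rewrite ?efNr ?ev ?oppr0 //; apply: real_rootN cartan _ _.
Qed.

(** Were K (x, y) positive, the reflection t = y - k x would be a root of U_c with k > 0. According
    to its sign, y = k x + t or x = (y - t) / k is a decomposition in the cone that contradicts
    [P_extremal]. *)
Lemma PR_Kle0 x y : PR x -> PR y -> x != y -> Kf A d x y <= 0.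
Proof.
move=> [xP rx] [yP ry] nxy; rewrite leNgt; apply/negP => K0.
have [[x0 _ _] px ex] := PR_ups (conj xP rx); have [ry' py ey] := PR_ups (conj yP ry).
set k := Kf A d x y / ef A d x x; have k0 : 0 < k by rewrite divr_gt0.
pose t := trefl A d x y; have tE : t = y - k *: x by [].
have rt : real_root A t by apply: real_root_trefl.
have et : ef A d delta t = 0 by rewrite tE efBr efZr ex ey mulr0 subr0.
have xne0 := ups_neq0 (P_ups xP); have yne0 := ups_neq0 (P_ups yP).
case: (ups_root rt et) => ut.
  have yE : y = k *: x + t by rewrite tE addrC subrK.
  have [s s0 sE] := P_extremal yP (coneZ (ltW k0) (ups_cone (P_ups xP))) (ups_cone ut) yE.
  have xE : x = (k^-1 * s) *: y by rewrite -scalerA -sE scalerA mulVf ?scale1r ?gt_eqF.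
  by move/eqP: nxy; apply; apply: real_pos_prop ry rx py px xE.
have xE : x = k^-1 *: y + k^-1 *: (- t).
  by rewrite -scalerDr tE opprB addrC subrK scalerA mulVf ?scale1r ?gt_eqF.
have kV : 0 <= k^-1 by rewrite invr_ge0 ltW.
have [s s0 sE] := P_extremal xP (coneZ kV (ups_cone (P_ups yP))) (coneZ kV (ups_cone ut)) xE.
have yE : y = (k * s) *: x by rewrite -scalerA -sE scalerA divff ?scale1r ?gt_eqF.
by move/eqP: nxy; apply; apply/esym; apply: real_pos_prop rx ry px py yE.
Qed.

(** Let y occur in the expansion of f z. Applying [finv] exhibits z as a sum of cone vectors with a
    multiple of [finv y] among them, so y is proportional to f z by extremality. The two maps are
    kept abstract to serve c and c^-1 alike. *)
Lemma PR_map (f finv : 'rV[rat]_n -> 'rV[rat]_n) :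
    (forall u v, finv (u + v) = finv u + finv v) ->
    (forall c v, finv (c *: v) = c *: finv v) ->
    cancel f finv -> cancel finv f -> (forall c v, f (c *: v) = c *: f v) ->
    (forall v, ups v -> ups (f v)) -> (forall v, ups v -> ups (finv v)) ->
    (forall v, real_root A v -> real_root A (f v)) ->
  forall z, PR z -> PR (f z).
Proof.
move=> fD fZ fK fVK gZ uf ufV rf z [zP rz]; split; last exact: rf.
have [c c0 fE] := ups_cone (uf z (P_ups zP)).
have [y yP cy] : exists2 y, y \in P & c y != 0.
  apply/hasP/negPn/negP => /hasPn h; have := ups_neq0 (uf z (P_ups zP)).
  rewrite fE big_seq big1 ?eqxx // => y yP.
  by have := h y yP; rewrite negbK => /eqP ->; rewrite scale0r.
have finv0 : finv 0 = 0 by rewrite -(scale0r (0 : 'rV_n)) fZ !scale0r.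
have zE : z = c y *: finv y + \sum_(y' <- P | y' != y) c y' *: finv y'.
  rewrite -{1}(fK z) fE (big_morph finv fD finv0) (bigD1_seq y) //= ?P_uniq //.
  by rewrite fZ; congr (_ + _); apply: eq_bigr => y' _; rewrite fZ.
have [||s s0 sE] := P_extremal zP _ _ zE.
- by apply: coneZ => //; apply/ups_cone/ufV/P_ups.
- by apply: cone_sum => y' y'P _; apply: coneZ => //; apply/ups_cone/ufV/P_ups.
have [t yE] : exists t, y = t *: f z.
  exists ((c y)^-1 * s); by rewrite -scalerA -gZ -sE gZ fVK scalerA mulVf ?scale1r.
have ry : real_root A y.
  have [Ry _ _] := P_ups yP; apply: root_Kneq0 => //; rewrite yE.
  rewrite (KfZl cartan) (KfZr cartan); have := ups_neq0 (P_ups yP); rewrite yE scaler_eq0.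
  rewrite negb_or => /andP[t0 _]; rewrite !mulf_neq0 // (Kf_diag cartan) mulf_neq0 // gt_eqF //.
  by have [] := real_rootlike cartan (rf z rz).
have [_ py _] := P_ups yP; have [_ pf _] := uf z (P_ups zP).
by rewrite -(real_pos_prop (rf z rz) ry pf py yE).
Qed.

Lemma PR_cox z : PR z -> PR (cox A z).
Proof.
apply: (PR_map (finv := coxinv A)); [exact: coxinvD|exact: coxinvZ|exact: (coxK cartan)|exact: (coxinvK cartan)
  |exact: coxZ|exact: ups_cox|exact: ups_coxinv|exact: real_root_cox].
Qed.
Lemma PR_coxinv z : PR z -> PR (coxinv A z).
Proof.
apply: (PR_map (finv := cox A)); [exact: coxD|exact: coxZ|exact: (coxinvK cartan)|exact: (coxK cartan)
  |exact: coxinvZ|exact: ups_coxinv|exact: ups_cox|exact: real_root_coxinv].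
Qed.
Lemma PR_itercox m z : PR z -> PR (iter m (cox A) z).
Proof. by move=> zP; elim: m => //= m; apply: PR_cox. Qed.

(** * Orbits of the Coxeter element on the simple system *)

Definition orb x (k : nat) := [/\ PR x, (0 < k)%N, iter k (cox A) x = x
  & forall m : nat, (0 < m < k)%N -> iter m (cox A) x != x].

Lemma itercox_inj m : injective (iter m (cox A)).
Proof. exact: can_inj (iter_coxK cartan m). Qed.

Lemma orb_ex x : PR x -> exists k, orb x k.
Proof.
move=> xP; pose s := [seq iter m (cox A) x | m <- iota 0 (size P).+1].
have : ~~ uniq s.
  apply/negP => us; have : {subset s <= P}.
    by move=> y /mapP[m _ ->]; case: (PR_itercox m xP).
  by move=> /(uniq_leq_size us); rewrite size_map size_iota ltnn.
case/(uniqPn x) => a [b [ab bs]]; move: (bs); rewrite size_map size_iota => bP.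
rewrite !(nth_map 0%N) ?size_iota ?(ltn_trans ab) // !nth_iota ?(ltn_trans ab) // !add0n.
rewrite -(subnKC (ltnW ab)) iterD => /itercox_inj E.
have ex : exists m, (0 < m)%N && (iter m (cox A) x == x).
  by exists (b - a)%N; rewrite subn_gt0 ab -E eqxx.
case: (ex_minnP ex) => k /andP[k0 /eqP kE] kmin; exists k; split=> // m /andP[m0 mk].
by apply/negP => /eqP mE; have := kmin m; rewrite m0 mE eqxx leqNgt mk => /(_ isT).
Qed.

Section Orbit.
Variables (x : 'rV[rat]_n) (k : nat).
Hypothesis ox : orb x k.
Let X m := iter m (cox A) x.

Lemma orb_PR : PR x. Proof. by case: ox. Qed.
Lemma orb_k0 : (0 < k)%N. Proof. by case: ox. Qed.
Lemma orb_mod m : X m = X (m %% k).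
Proof.
rewrite /X {1}(divn_eq m k) addnC iterD; congr (iter _ _ _).
by elim: (m %/ k)%N => // q IH; rewrite mulSn iterD IH; case: ox.
Qed.

Lemma orb_inj (a b : nat) : (a < k)%N -> (b < k)%N -> X a = X b -> a = b.
Proof.
wlog ab : a b / (a <= b)%N => [hw|].
  by case: (leqP a b) => [|/ltnW] ab ak bk E; [apply: hw|apply/esym/hw].
move=> ak bk; rewrite /X -(subnKC ab) iterD => /itercox_inj E.
have [/eqP|ba] := posnP (b - a)%N; first by rewrite subn_eq0; lia.
by case: ox => _ _ _ /(_ (b - a)%N); rewrite ba -E eqxx => h; have := h ltac:(lia).
Qed.

Lemma orb_sum : exists2 m, 0 < m & \sum_(j < k) X j = m *: delta.
Proof.
pose S := \sum_(j < k) X j.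
have cS : cox A S = S.
  rewrite /S cox_sum -[LHS]/(\sum_(m < k) (X m.+1)) (sum_shift X) /X.
  by case: ox => _ _ -> _; rewrite subrr addr0.
have [m SE] := aff_rad (rad_pairc cartan (cox_fix_rad cartan cS)); exists m => //.
have [_ px _] := P_ups (proj1 orb_PR).
have [i xi] : exists i, 0 < x 0 i.
  have : x != 0 by apply/ups_neq0/P_ups/(proj1 orb_PR).
  move=> x0; have /existsP[i xi] : [exists i, x 0 i != 0].
    rewrite -negb_forall; apply: contra x0 => /forallP h.
    by apply/eqP/rowP => i; rewrite mxE; apply/eqP.
  by exists i; rewrite lt_def xi px.
have : 0 < S 0 i.
  rewrite /S summxE; case: (k) orb_k0 => // k' _; rewrite big_ord_recl ltr_pwDl //.
  by apply: sumr_ge0 => j _; have [_ ->] := P_ups (proj1 (PR_itercox (lift ord0 j) orb_PR)).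
by rewrite SE mxE pmulr_lgt0 ?delta_gt0.
Qed.

(** The pairings of y with the orbit are all nonpositive, and their sum is a pairing with a multiple
    of delta, hence 0. *)
Lemma orb_Kf_out y m : PR y -> y \notin traject (cox A) x k -> Kf A d y (X m) = 0.
Proof.
move=> yP yout; have [s s0 sE] := orb_sum.
have K0 : \sum_(j < k) Kf A d y (X j) = 0.
  by rewrite -(Kf_sumr cartan) sE (KfZr cartan) (KfC cartan) Kf_delta mulr0.
have Kle (j : 'I_k) : Kf A d y (X j) <= 0.
  apply: PR_Kle0 => //; first exact: (PR_itercox j orb_PR).
  by apply: contra yout => /eqP ->; apply/trajectP; exists j.
rewrite orb_mod; have mk : (m %% k < k)%N by rewrite ltn_mod orb_k0.
have : \sum_(j < k) - Kf A d y (X j) == 0 by rewrite sumrN K0 oppr0.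
rewrite psumr_eq0 => [/allP/(_ (Ordinal mk))|j _]; last by rewrite oppr_ge0.
by rewrite mem_index_enum oppr_eq0 => /(_ isT)/eqP.
Qed.

(** Orthogonality together with [ef_cox] makes [ef y] constant along the orbit, and its sum there is
    a multiple of the defect of y, which is 0. *)
Lemma orb_ef_out y m : PR y -> y \notin traject (cox A) x k ->
  ef A d y (X m) = 0 /\ ef A d (X m) y = 0.
Proof.
move=> yP yout; have [s s0 sE] := orb_sum.
have K0 q : ef A d y (X q) + ef A d (X q) y = 0 by rewrite -(KfE cartan) orb_Kf_out.
have cst q : ef A d y (X q) = ef A d y x.
  elim: q => // q <-; have := K0 q.+1; rewrite /X iterS (ef_cox cartan) => /eqP.
  by rewrite subr_eq0 => /eqP.
have : \sum_(j < k) ef A d y (X j) = 0.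
  have [_ _ ey] := PR_ups yP.
  by rewrite -ef_sumr sE efZr ef_deltar ey oppr0 mulr0.
under eq_bigr => j _ do rewrite cst.
rewrite sumr_const card_ord => /eqP; rewrite mulrn_eq0 eqn0Ngt orb_k0 /= => /eqP e0.
by have := K0 m; rewrite cst e0 add0r.
Qed.

End Orbit.

(** * Connected components of the simple system *)

Definition plink a b := [/\ PR a, PR b & Kf A d a b != 0].
Definition pconn := clos_refl_trans _ plink.

Lemma ht_ge1 z : (forall i, z 0 i \is a Num.int) -> pos z -> z != 0 -> 1 <= \sum_i z 0 i.
Proof.
move=> zi pz z0; apply: int_ge1; first exact: rpred_sum.
rewrite lt_def sumr_ge0 // andbT psumr_eq0 //; apply: contra z0 => /allP h.
apply/eqP/rowP => i; rewrite mxE; apply/eqP; exact: h (mem_index_enum i).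
Qed.

(** Induction on the height. Some z of [P] has K (z, u) > 0; reflecting in z lowers the height by at
    least 1 unless u = z. The reflected root t still pairs nontrivially with z, and whatever pairs
    with u pairs with t or with z. *)
Lemma root_one_component u : real_root A u -> ups u ->
  exists2 z, PR z & forall y, PR y -> Kf A d u y != 0 -> pconn z y.
Proof.
have [N] : exists N : nat, \sum_i u 0 i < N%:R.
  exists (Num.bound `|\sum_i u 0 i|).
  exact: le_lt_trans (ler_norm _) (archi_boundP (normr_ge0 _)).
elim: N u => [|N IH] u hN ru uu.
  by case: uu => _ pu _; move: hN; rewrite ltNge sumr_ge0.
have rl := real_rootlike cartan ru; have [u0 _ _] := rl.
have [uP|uP] := boolP (u \in P).
  by exists u => // y yP K0; apply: rt_step.
have [c c0 uE] := ups_cone uu.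
have [z zP zK] : exists2 z, z \in P & 0 < c z * Kf A d z u.
  apply/hasP/negPn/negP => /hasPn h.
  have : Kf A d u u <= 0; last by rewrite (Kf_diag cartan) leNgt mulr_gt0.
  rewrite {1}uE (Kf_suml cartan) big_seq; apply: sumr_le0 => z zP.
  by rewrite (KfZl cartan) leNgt; apply: h.
have K0 : 0 < Kf A d z u.
  rewrite ltNge; apply: contraTN zK => ?; rewrite -leNgt; exact: mulr_ge0_le0.
have rz : real_root A z.
  have [[//|[_ _ /(pairc_rad cartan) h]] _ _] := P_ups zP.
  by move: K0; rewrite h ltxx.
have PRz : PR z by [].
have [rlz pz ez] := PR_ups PRz; have [z0 zi _] := rlz; have [_ ui _] := rl.
set q := Kf A d z u / ef A d z z.
have q1 : 1 <= q by apply: int_ge1; [apply: rootlike_Kf|rewrite divr_gt0].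
have q0 : 0 < q by apply: lt_le_trans q1.
pose t := trefl A d z u; have tE : t = u - q *: z by [].
have rt : real_root A t by apply: real_root_trefl.
have [_ pu eu] := uu.
have et : ef A d delta t = 0 by rewrite tE efBr efZr ez eu mulr0 subr0.
case: (ups_root rt et) => ut.
  have ht : \sum_i t 0 i < N%:R.
    have -> : \sum_i t 0 i = \sum_i u 0 i - q * \sum_i z 0 i.
      by rewrite mulr_sumr -sumrB; apply: eq_bigr => i _; rewrite tE !mxE.
    have h1 := ht_ge1 zi pz (ups_neq0 (P_ups zP)).
    have h2 : 1 <= q * \sum_i z 0 i by rewrite mulr_ege1.
    by move: hN h2; rewrite -natr1; row_lra.
  have [z0' z0P hz] := IH t ht rt ut; exists z0' => // y yP Ky.
  have cz : pconn z0' z.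
    apply: hz => //; rewrite tE (KfBl cartan) (KfZl cartan) (Kf_diag cartan) (KfC cartan).
    have zz : ef A d z z != 0 by rewrite gt_eqF.
    rewrite /q mulrCA divfK // mulr2n mulrDl mul1r opprD addrA subrr sub0r.
    by rewrite oppr_eq0 gt_eqF.
  have [Kt|] := eqVneq (Kf A d t y) 0; last exact: hz.
  apply: rt_trans cz _; apply: rt_step; split=> //.
  apply: contraNneq Ky => Kz; move/eqP: Kt.
  by rewrite tE (KfBl cartan) (KfZl cartan) Kz mulr0 subr0.
have qV : 0 <= q^-1 by rewrite invr_ge0 ltW.
have zE : z = q^-1 *: u + q^-1 *: (- t).
  by rewrite -scalerDr tE opprB addrC subrK scalerA mulVf ?scale1r ?gt_eqF.
have [s s0 sE] := P_extremal zP (coneZ qV (ups_cone uu)) (coneZ qV (ups_cone ut)) zE.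
have uE' : u = (q * s) *: z by rewrite -scalerA -sE scalerA divff ?scale1r ?gt_eqF.
by move: uP; rewrite (real_pos_prop rz ru pz pu uE') zP.
Qed.

Lemma plink_sym a b : plink a b -> plink b a.
Proof. by case=> *; split; rewrite // (KfC cartan). Qed.
Lemma pconn_sym a b : pconn a b -> pconn b a.
Proof.
elim=> [x y /plink_sym|x|x y z _ h1 _ h2]; first exact: rt_step.
  exact: rt_refl.
exact: rt_trans h2 h1.
Qed.
Lemma pconn_coxinv a b : pconn a b -> pconn (coxinv A a) (coxinv A b).
Proof.
elim=> [x y [xP yP xy]|x|x y z _ h1 _ h2]; last exact: rt_trans h1 h2.
  by apply: rt_step; split; rewrite ?(Kf_coxinv cartan) //; apply: PR_coxinv.
exact: rt_refl.
Qed.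

(* Conjugating by the [s_j] with [j] orthogonal to [i] keeps [alpha_i] and the
   half space [0 < z_i] fixed and shortens [y], until some [alpha_j] is linked
   to both; it lies in the kernel of [theta] because both its signs are excluded. *)
Lemma link_descent i (N : nat) (theta : 'rV[rat]_n -> rat) y :
    i != aff -> (forall u v, theta (u + v) = theta u + theta v) ->
    (forall c v, theta (c *: v) = c * theta v) ->
    (forall z, rootlike A d z -> z 0 aff = 0 -> 0 < z 0 i -> theta z <= 0) ->
    theta (sroot i) = 0 -> rootlike A d y -> y 0 aff = 0 -> 0 < y 0 i -> theta y = 0 ->
    Kf A d (sroot i) y <= 0 -> \sum_j y 0 j < N%:R ->
  exists z, [/\ real_root A z, theta z = 0, Kf A d z (sroot i) != 0 & Kf A d z y != 0].
Proof.
move=> ia; elim: N theta y => [|N IH] theta y tD tZ tneg ti ry ya yi ty Kiy hN.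
  have [py|/(_ i)] := aff_sgn ry; last by rewrite oppE; move: yi; row_lra.
  by move: hN; rewrite ltNge sumr_ge0.
have [py|/(_ i)] := aff_sgn ry; last by rewrite oppE; move: yi; row_lra.
have [y0 yint _] := ry.
have tB u v : theta (u - v) = theta u - theta v.
  by rewrite tD -scaleN1r tZ mulN1r.
(* Such a j exists because K (y, y) > 0 is the sum of the y_j d_j times the pairings. *)
have [j yj pj] : exists2 j, 0 < y 0 j & 0 < pairc A j y.
  have [/existsP[j /andP[h1 h2]]|nex] := boolP [exists j, (0 < y 0 j) && (0 < pairc A j y)].
    by exists j.
  exfalso; have : Kf A d y y <= 0; last by rewrite (Kf_diag cartan) leNgt mulr_gt0.
  rewrite (Kf_srootE cartan); apply: sumr_le0 => j _.
  move: nex; rewrite negb_exists => /forallP/(_ j); rewrite negb_and -!leNgt => /orP[h|h].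
    by have -> : y 0 j = 0; [have := py j; move: h; row_lra|rewrite mul0r].
  by rewrite mulr_ge0_le0 // mulr_ge0_le0 // ltW.
have nji : j != i.
  apply: contraTneq pj => ->; rewrite -leNgt; move: Kiy; rewrite Kf_sroot.
  by rewrite pmulr_rle0.
have nja : j != aff by apply: contraTneq yj => ->; rewrite ya ltxx.
pose y' := refl A j y; have ry' : rootlike A d y' by apply: rootlike_refl.
have y'i : y' 0 i = y 0 i by rewrite reflE eq_sym (negPf nji) mulr0 subr0.
have y'a : y' 0 aff = 0 by rewrite reflE eq_sym (negPf nja) mulr0 subr0.
(* Both y - p alpha_j, where p > 0, and s_j alpha_i = alpha_i - a_ji alpha_j lie in the half space.
   The first bounds theta (alpha_j) from below by 0; the second bounds it from above if a_ji is not
   0. *)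
have tj : 0 <= theta (sroot j).
  have := tneg y' ry' y'a; rewrite y'i yi => /(_ isT).
  by rewrite /y' /refl tB tZ ty sub0r oppr_le0 pmulr_rge0.
have [Aji|Aji] := eqVneq (A j i) 0; last first.
  exists (sroot j); split; first exact: RR_simple.
  - apply/eqP; rewrite eq_le tj andbT.
    have rz := rootlike_refl cartan j (rootlike_sroot cartan i).
    have za : refl A j (sroot i) 0 aff = 0.
      by rewrite reflE srootE eq_sym (negPf ia) [aff == _]eq_sym (negPf nja) mulr0 subr0.
    have := tneg _ rz za; rewrite reflE srootii eq_sym (negPf nji) mulr0 subr0 ltr01.
    move=> /(_ isT); rewrite /refl tB tZ ti sub0r pairc_sroot -mulNr pmulr_rle0 //.
    rewrite oppr_gt0 ltrz0 lt_neqAle Aji; case: cartan => _ h _ _ _; exact: h.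
  - by rewrite Kf_sroot pairc_sroot mulf_neq0 ?intr_eq0 // gt_eqF.
  - by rewrite Kf_sroot mulf_neq0 // gt_eqF ?dgt0.
have si : refl A j (sroot i) = sroot i.
  by rewrite /refl pairc_sroot Aji scale0r subr0.
have ht : \sum_l y' 0 l < N%:R.
  have -> : \sum_l y' 0 l = \sum_l y 0 l - pairc A j y.
    rewrite (eq_bigr (fun l => y 0 l - pairc A j y * (l == j)%:R)) => [|l _]; last exact: reflE.
    rewrite sumrB; congr (_ - _); rewrite (bigD1 j) //= eqxx mulr1 big1 ?addr0 // => l /negPf ->.
    by rewrite mulr0.
  have p1 := int_ge1 (pairc_int A j yint) pj.
  by move: hN p1; rewrite -natr1; row_lra.
have [|||||||z [rz tz Kzi Kzy]] := IH (fun v => theta (refl A j v)) y' _ _ _ _ ry' y'a _ _ _ ht.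
- by move=> u v; rewrite reflD tD.
- by move=> c v; rewrite reflZ tZ.
- move=> z rz za zi; apply: tneg; first exact: rootlike_refl.
    by rewrite reflE za eq_sym (negPf nja) mulr0 subr0.
  by rewrite reflE eq_sym (negPf nji) mulr0 subr0.
- by rewrite si.
- by rewrite y'i.
- by rewrite (reflK cartan).
- by rewrite -si (Kf_refl cartan).
exists (refl A j z); split=> //; first exact: RR_refl.
  by rewrite -si (Kf_refl cartan).
by rewrite -[y](reflK cartan j) (Kf_refl cartan).
Qed.

Lemma aff_sub_finite v : v 0 aff = 0 -> v != 0 -> 0 < Kf A d v v.
Proof.
move=> va v0; rewrite lt_def aff_Kge0 andbT; apply: contra v0 => /eqP.
move=> /(null_rad cartan aff_Kge0)/aff_rad[s vE]; move: va; rewrite vE mxE => /eqP.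
by rewrite mulf_eq0 (gt_eqF (delta_gt0 aff)) orbF => /eqP ->; rewrite scale0r.
Qed.

(** Rotating x to a simple root turns the condition [0 < ef x] into a coordinate half space. There
    [ef_regular_sign] bounds the pairing with delta, so that pairing, rotated along, can serve as
    the functional of [link_descent]. *)
Lemma link_pair x y : PR x -> PR y -> x != y -> x 0 aff = 0 -> y 0 aff = 0 ->
  0 < ef A d x y ->
  exists z, [/\ real_root A z, ef A d delta z = 0, Kf A d z x != 0 & Kf A d z y != 0].
Proof.
move=> xP yP nxy xa ya exy.
have [rx px ex] := PR_ups xP; have [ry py ey] := PR_ups yP.
have [i [l [ia al lx lw]]] := parabolic_rotate cartan aff_sub_finite rx px xa.
pose y' := reflw A l y; pose theta v := ef A d (reflw A (rev l) v) delta.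
have ral : aff \notin rev l by rewrite mem_rev.
have xl : reflw A (rev l) (sroot i) = x by rewrite -lx (reflw_revK cartan).
have [N hN] : exists N : nat, \sum_j y' 0 j < N%:R.
  exists (Num.bound `|\sum_i y' 0 i|).
  exact: le_lt_trans (ler_norm _) (archi_boundP (normr_ge0 _)).
have [|||||||||z [rz tz Kzx Kzy]] := @link_descent i N theta y' ia _ _ _ _ _ _ _ _ _ hN.
- by move=> u v; rewrite /theta reflwD efDl.
- by move=> c v; rewrite /theta reflwZ efZl.
- move=> z rz za zi; have xr : regular x by case: xP => _ rr; apply: ups_regular.
  apply: (ef_regular_sign (x := x)); [exact: rootlike_reflw|exact: xr|].
  by rewrite lw ?(reflwK_rev cartan) ?mulr_gt0 // reflw_notin.
- by rewrite /theta xl ef_deltar ex oppr0.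
- exact: rootlike_reflw.
- by rewrite /y' reflw_notin.
- by move: exy; rewrite lw // pmulr_rgt0.
- by rewrite /theta (reflw_revK cartan) ef_deltar ey oppr0.
- by rewrite -lx (Kf_reflw cartan); apply: PR_Kle0.
exists (reflw A (rev l) z); split.
- exact: real_root_reflw.
- by move: tz; rewrite /theta ef_deltar => /eqP; rewrite oppr_eq0 => /eqP.
- by rewrite -xl (Kf_reflw cartan).
- by rewrite -[y](reflw_revK cartan l) (Kf_reflw cartan).
Qed.

(** * Excluding orbits with K (x, c x) = 0 that meet the finite root system *)

Hypothesis node_root : Defs.root A (delta - delta 0 aff *: sroot aff).

Lemma translate_aff v : real_root A v ->
  (* The product of the reflections in alpha_aff and in delta - [delta : alpha_aff] alpha_aff is
     this translation. *)
  real_root A (v - (pairc A aff v / delta 0 aff) *: delta).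
Proof.
move=> rv; set D := delta 0 aff; have D0 : D != 0 by rewrite gt_eqF ?delta_gt0.
have da0 : d aff != 0 by rewrite gt_eqF.
pose th := delta - D *: sroot aff.
have Kth w : Kf A d th w = - (D * (d aff * pairc A aff w)).
  by rewrite (KfBl cartan) Kf_delta (KfZl cartan) Kf_sroot sub0r.
have pth : pairc A aff th = - (D * 2).
  rewrite /th -scaleNr paircD paircZ pairc_delta add0r pairc_sroot; case: cartan => -> _ _ _ _.
  by rewrite mulNr.
have eth : ef A d th th = D * D * d aff.
  by rewrite (ef_Kf cartan) Kth pth; field.
have rth : real_root A th.
  apply: root_Kneq0 => //; rewrite (Kf_diag cartan) eth.
  by rewrite !mulf_neq0.
have := real_root_trefl cartan rth (RR_refl aff rv).
congr (real_root A); rewrite /trefl Kth eth (pairc_refl cartan).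
have -> : - (D * (d aff * - pairc A aff v)) / (D * D * d aff) = pairc A aff v / D by field; rewrite D0.
rewrite /refl /th scalerBr scalerA divfK // opprB addrACA.
by rewrite addrA addrK.
Qed.

(** The translation is conjugated by the word carrying alpha_aff to the projective root at [aff],
    since [ef] of that root reads the coordinate at [aff]. *)
Lemma translate_real v : real_root A v ->
  real_root A (v - (Kf A d (tau A (- sroot aff)) v / d aff / delta 0 aff) *: delta).
Proof.
move=> rv; have [-> _] := tau_negsimple cartan aff_sgn aff.
set l := take _ _; have := translate_aff (real_root_reflw (rev l) rv).
move/(real_root_reflw l); rewrite reflwD reflwN reflwZ (reflwK_rev cartan).
rewrite (reflw_rad l pairc_delta) -[Kf A d _ v in X in _ -> X](Kf_reflw cartan (rev l)).
rewrite (reflw_revK cartan) Kf_sroot [d aff * _]mulrC mulfK //.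
by rewrite gt_eqF.
Qed.

Lemma cone_aff0 c v : (forall z, 0 <= c z) -> v = \sum_(z <- P) c z *: z -> v 0 aff = 0 ->
  forall z, z \in P -> c z * z 0 aff = 0.
Proof.
move=> c0 vE va z zP; have := va; rewrite vE summxE big_seq => /eqP.
rewrite psumr_eq0 => [/allP/(_ z zP)|y yP]; last first.
  by rewrite mxE mulr_ge0 //; case: (P_ups yP).
by rewrite zP mxE => /eqP.
Qed.

Section BadOrbit.
(* [w] is the last element before its orbit leaves the finite root system. *)
Variable w : 'rV[rat]_n.
Hypotheses (wP : PR w) (wa : w 0 aff = 0) (w1a : 0 < cox A w 0 aff).
Hypothesis wK : Kf A d w (cox A w) = 0.
Let z1 := cox A w.
Let z2 := cox A z1.

Let z1P : PR z1. Proof. exact: PR_cox. Qed.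
Let z2P : PR z2. Proof. exact: PR_cox. Qed.
Let K12 : Kf A d z1 z2 = 0. Proof. by rewrite (Kf_cox cartan). Qed.
Let s := z1 0 aff / delta 0 aff.
Let s0 : 0 < s. Proof. by rewrite divr_gt0 ?delta_gt0. Qed.

Lemma ef_bad v : Kf A d v (cox A v) = 0 -> ef A d v (cox A v) = ef A d v v.
Proof. by rewrite (KfE cartan) (ef_cox cartan) => /eqP; rewrite subr_eq0 => /eqP. Qed.

Let Kproj : Kf A d (tau A (- sroot aff)) z1 = d aff * z1 0 aff.
Proof.
have [_ [_ _ [_ uw _]]] := tau_negsimple cartan aff_sgn aff.
by rewrite (KfE cartan) uw (ef_cox cartan) uw wa mulr0 oppr0 addr0.
Qed.

(** Reflect the projective root u at [aff] in z1. The image eta still satisfies [0 < ef eta delta],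
    so it pairs nonnegatively with the regular root z2. By [ef_bad] and [Kproj] this pairing is
    d_aff times the difference of the two coordinates. *)
Lemma bad_aff_le : z1 0 aff <= z2 0 aff.
Proof.
have [_ [ru pu [_ uw _]]] := tau_negsimple cartan aff_sgn aff.
set u := tau A (- sroot aff) in ru pu uw.
have [r1 p1 e1] := PR_ups z1P; have [n1 _ _] := r1.
pose eta := trefl A d z1 u.
have reta : rootlike A d eta by apply: rootlike_trefl; rewrite //; apply: real_rootlike.
have e0 : 0 < ef A d eta delta.
  rewrite /eta /trefl efBl efZl uw (ef_deltar z1) e1 oppr0 mulr0 subr0.
  by rewrite mulr_gt0 ?delta_gt0.
have z2r : regular z2 by have [r2 p2 e2] := PR_ups z2P; apply: U_regular.
have := ef_regular_ge0 reta e0 z2r.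
rewrite /eta /trefl efBl efZl uw (ef_bad K12) divfK ?gt_eqF // (KfC cartan) Kproj.
by rewrite subr_ge0 ler_pM2l.
Qed.

(** The translate z1 - s delta is a root of U_c with coordinate 0 at [aff]. It cannot be positive
    because z1 is extremal, and its negative expands in elements of [P] that have coordinate 0 at
    [aff]. *)
Lemma bad_decomposition : exists c : 'rV[rat]_n -> rat, [/\ forall z, 0 <= c z,
  s *: delta = z1 + \sum_(z <- P) c z *: z & forall z, z \in P -> c z * z 0 aff = 0].
Proof.
have [[z1in rz1] [r1 p1 e1]] := (z1P, PR_ups z1P).
pose y := z1 - s *: delta.
have ry : real_root A y.
  have := translate_real rz1; by rewrite Kproj [d aff * _]mulrC mulfK ?gt_eqF.
have ya : y 0 aff = 0.
  by rewrite /y !mxE /s divfK ?subrr // gt_eqF ?delta_gt0.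
have ey : ef A d delta y = 0 by rewrite /y efBr efZr ef_delta2 e1 mulr0 subr0.
case: (ups_root ry ey) => uy.
  have zE : z1 = y + s *: delta by rewrite subrK.
  have [t t0 yE] := P_extremal z1in (ups_cone uy) (coneZ (ltW s0) (ups_cone ups_delta)) zE.
  have := ups_neq0 uy; rewrite yE; move: ya; rewrite yE mxE => /eqP; rewrite mulf_eq0.
  by rewrite (gt_eqF w1a) orbF => /eqP ->; rewrite scale0r eqxx.
have [c c0 cE] := ups_cone uy; exists c; split=> //.
  by rewrite -cE /y opprB addrC subrK.
by apply: cone_aff0 c0 cE _; rewrite oppE ya oppr0.
Qed.

Lemma bad_orbit : False.
Proof.
have [[z1in rz1] [r1 p1 e1]] := (z1P, PR_ups z1P); have [n1 _ _] := r1.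
have [c [c0 sE ca]] := bad_decomposition.
have imK z v : z \in P -> ~ real_root A z -> Kf A d z v = 0.
  by move=> /P_ups[[//|[_ _ h]] _ _] _; apply: (pairc_rad cartan).
have c1 : c z1 = 0.
  by have /eqP := ca z1 z1in; rewrite mulf_eq0 (gt_eqF w1a) orbF => /eqP.
pose b z : rat := c z + (z == z1)%:R.
have b0 z : 0 <= b z by rewrite addr_ge0.
have sEb : s *: delta = \sum_(z <- P) b z *: z.
  rewrite sE [RHS](eq_bigr (fun z => c z *: z + (z == z1)%:R *: z)) => [|z _]; last by rewrite scalerDl.
  rewrite big_split /= addrC; congr (_ + _).
  rewrite (bigD1_seq z1) ?P_uniq //= eqxx scale1r big1 ?addr0 // => z /negPf ->.
  by rewrite scale0r.
have Ks v : \sum_(z <- P) b z * Kf A d z v = 0.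
  transitivity (Kf A d (s *: delta) v); last by rewrite (KfZl cartan) Kf_delta mulr0.
  by rewrite sEb (Kf_suml cartan); apply: eq_bigr => z _; rewrite (KfZl cartan).
(* If b y = 0, all terms of the pairing of s delta with y are nonpositive with sum 0, so y is
   orthogonal to every v that occurs. *)
have closed v y : PR v -> 0 < b v -> PR y -> Kf A d v y != 0 -> 0 < b y.
  move=> [vP rv] bv yP Kvy; rewrite lt_def b0 andbT; apply: contra Kvy => /eqP by0.
  have : \sum_(z <- P) - (b z * Kf A d z y) == 0 by rewrite sumrN Ks oppr0.
  rewrite big_seq psumr_eq0 => [/allP/(_ v vP)|z zP].
    by rewrite vP oppr_eq0 mulf_eq0 (gt_eqF bv).
  rewrite oppr_ge0; have [->|zy] := eqVneq z y; first by rewrite by0 mul0r.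
  have [rz|nrz] := pselect (real_root A z); last by rewrite imK ?mulr0.
  by rewrite mulr_ge0_le0 // PR_Kle0.
have bz1 : 0 < b z1 by rewrite /b c1 eqxx add0r.
have conn_b v : pconn z1 v -> PR v -> 0 < b v.
  move=> h; have : PR z1 -> 0 < b z1 -> 0 < b v; last by move=> h' _; apply: h'.
  elim: h => [x y [xP yP Kxy] _ bx|//|x y z h1 H1 h2 H2 xP bx]; first exact: closed Kxy.
  have yP : PR y by elim: h1 xP {H1 H2 h2} => // [? ? [] //|*]; auto.
  exact: H2 yP (H1 xP bx).
have b_aff v : PR v -> v != z1 -> 0 < b v -> v 0 aff = 0.
  move=> [vP _] vz; rewrite /b (negPf vz) addr0 => cv.
  by have /eqP := ca v vP; rewrite mulf_eq0 (gt_eqF cv) => /eqP.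
(* In the component of z1 only z1 itself has a nonzero coordinate at [aff], whereas that of z2 is at
   least that of z1. *)
have nconn : ~ pconn z1 z2.
  move=> /conn_b/(_ z2P)/(b_aff z2 z2P) h; have := bad_aff_le; rewrite h.
    by rewrite leNgt w1a.
  apply: contra_eq_neq K12 => ->; rewrite (Kf_diag cartan) gt_eqF // mulr_gt0 //.
pose inC z := `[< pconn z1 z /\ PR z >].
(* The part of s delta in the component of z1 is orthogonal to itself, hence a multiple of delta and
   fixed by c. *)
pose W := \sum_(z <- P | inC z) b z *: z.
have KW v : PR v -> pconn z1 v -> Kf A d W v = 0.
  move=> vP cv; rewrite -[RHS](Ks v) /W (Kf_suml cartan) big_mkcond big_seq [RHS]big_seq.
  apply: eq_bigr => z zP; rewrite /inC; case: asboolP => h; first by rewrite (KfZl cartan).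
  have [rz|nrz] := pselect (real_root A z); last by rewrite imK ?mulr0.
  have [->|Kzv] := eqVneq (Kf A d z v) 0; first by rewrite mulr0.
  case: h; split=> //; apply: rt_trans cv _; apply: rt_step; split=> //.
  by rewrite (KfC cartan).
have WW : Kf A d W W = 0.
  rewrite {2}/W (Kf_sumr cartan) big1 // => z /asboolP[cz zP].
  by rewrite (KfZr cartan) KW ?mulr0.
have [s' WE] := aff_rad (null_rad cartan aff_Kge0 WW).
have inC1 : inC z1 by apply/asboolP; split=> //; apply: rt_refl.
have Wsplit (f : 'rV_n -> rat) : \sum_(z <- P | inC z) f z =
    f z1 + \sum_(z <- P | inC z && (z != z1)) f z.
  rewrite big_mkcond (bigD1_seq z1) ?P_uniq //= inC1; congr (_ + _).
  rewrite [RHS]big_mkcond [LHS]big_mkcond; apply: eq_bigr => z _.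
  by case: (inC z); case: (z != z1).
have bE1 : b z1 = 1 by rewrite /b c1 eqxx add0r.
have Waff : W 0 aff = z1 0 aff.
  rewrite /W summxE Wsplit mxE bE1 mul1r big1 ?addr0 // => z /andP[/asboolP[cz zP] zz].
  by rewrite mxE (b_aff z) ?mulr0 // conn_b.
have cWaff : \sum_(z <- P | inC z) b z * cox A z 0 aff = z1 0 aff.
  transitivity (cox A W 0 aff).
    by rewrite /W cox_sum summxE; apply: eq_bigr => z _; rewrite coxZ mxE.
  by rewrite -Waff WE coxZ cox_delta.
(* Compare the coordinates of W and c W at [aff]: the term of z1 alone already contributes at least
   the whole value. *)
have rest0 : \sum_(z <- P | inC z && (z != z1)) b z * cox A z 0 aff == 0.
  move: cWaff; rewrite Wsplit bE1 mul1r -/z2 => h.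
  rewrite eq_le sumr_ge0 ?andbT => [|z /andP[/asboolP[_ zP] _]].
    by have := bad_aff_le; move: h; row_lra.
  by rewrite mulr_ge0 //; have [_ ->] := PR_ups (PR_cox zP).
have [z [zin cz zP zz Kz]] : exists z, [/\ z \in P, pconn z1 z, PR z, z != z1 & Kf A d z z1 != 0].
  apply: contrapT => nex; have := KW z1 z1P (rt_refl _ _ _).
  have -> : Kf A d W z1 = \sum_(z <- P | inC z) b z * Kf A d z z1.
    by rewrite /W (Kf_suml cartan); apply: eq_bigr => z _; rewrite (KfZl cartan).
  rewrite Wsplit bE1 mul1r big_seq_cond big1 => [|z /andP[zin /andP[/asboolP[cz zP] zz]]].
    by rewrite addr0 (Kf_diag cartan) => /eqP; rewrite gt_eqF // mulr_gt0.
  apply/eqP; rewrite mulf_eq0; apply/orP; right; apply/negPn/negP => Kz.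
  by apply: nex; exists z.
have bz := conn_b z cz zP; have za := b_aff z zP zz bz.
have cza : cox A z 0 aff = 0.
  move: rest0; rewrite big_seq_cond psumr_eq0 => [/allP/(_ z zin)|y /andP[yin /andP[/asboolP[_ yP] _]]].
    rewrite zin /= zz andbT; have -> : inC z by apply/asboolP.
    by rewrite mulf_eq0 (gt_eqF bz) => /eqP.
  by rewrite mulr_ge0 //; have [_ ->] := PR_ups (PR_cox yP).
have [k oz] := orb_ex z1P.
have /trajectP[m mk zE] : z \in traject (cox A) z1 k.
  by apply/negPn/negP => /(orb_Kf_out oz 0 zP)/eqP; rewrite (negPf Kz).
have Kzc : Kf A d z (cox A z) = 0 by rewrite zE -iterS iterSr (Kf_itercox cartan).
have [rlz _ _] := PR_ups zP; have [nz _ _] := rlz.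
have ezc : 0 < ef A d z (cox A z) by rewrite ef_bad.
have zc : z != cox A z.
  apply: contra_eq_neq Kzc => <-; rewrite (Kf_diag cartan) gt_eqF // mulr_gt0 //.
(* The root r links z with c z, which are then connected. As z = c^m z1, applying c^-m connects z1
   with z2. *)
have [r [rr er Krz Krc]] := link_pair zP (PR_cox zP) zc za cza ezc.
have [z0 z0P hz] : exists2 z0, PR z0 & forall y, PR y -> Kf A d r y != 0 -> pconn z0 y.
  case: (ups_root rr er) => ur; first exact: root_one_component.
  have [z0 z0P hz] := root_one_component (real_rootN cartan rr) ur.
  by exists z0 => // y yP Ky; apply: hz => //; rewrite (KfNl cartan) oppr_eq0.
have : pconn z (cox A z) by apply: rt_trans (pconn_sym (hz z zP Krz)) (hz _ (PR_cox zP) Krc).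
rewrite zE => h; apply: nconn.
have {h} : pconn (iter m (coxinv A) (iter m (cox A) z1)) (iter m (coxinv A) (cox A (iter m (cox A) z1))).
  elim: (m) (iter m (cox A) z1) (cox A (iter m (cox A) z1)) h => // q IH u v h.
  by rewrite !iterSr; apply/IH/pconn_coxinv.
by rewrite -iterS iterSr !(iter_coxK cartan).
Qed.

End BadOrbit.

(** The orbit sum is a positive multiple of delta, so the orbit leaves the finite root system; the
    element just before the first exit would satisfy the hypotheses of [bad_orbit]. *)
Lemma good_orbit x : PR x -> x 0 aff = 0 -> Kf A d x (cox A x) != 0.
Proof.
move=> xP xa; apply/eqP => K0; have [k ox] := orb_ex xP.
have [s s0 sE] := orb_sum ox.
have ex : exists m, iter m (cox A) x 0 aff != 0.
  apply: contrapT => nex; have := congr1 (fun v : 'rV_n => v 0 aff) sE.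
  rewrite summxE big1 => [|j _]; last first.
    by apply/eqP/negPn/negP => h; apply: nex; exists j.
  by rewrite mxE => /esym/eqP; rewrite mulf_eq0 !gt_eqF ?delta_gt0.
case: (ex_minnP ex) => -[|m] hm mmin; first by rewrite xa eqxx in hm.
have mP := PR_itercox m xP; apply: (@bad_orbit (iter m (cox A) x)) => //.
- by apply/eqP/negPn/negP => /mmin; rewrite ltnn.
- by rewrite lt_def -iterS hm; have [_ ->] := PR_ups (PR_itercox m.+1 xP).
- by rewrite -iterS iterSr (Kf_itercox cartan).
Qed.

(** * The Euler form on an orbit with K (x, c x) nonzero *)

Section GoodOrbit.
Variables (x : 'rV[rat]_n) (k : nat).
Hypothesis ox : orb x k.
Hypothesis gx : Kf A d x (cox A x) != 0.
Let X m := iter m (cox A) x.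
Let eps := ef A d x x.

Let xP : PR x := orb_PR ox.
Let rx : rootlike A d x. Proof. by case: (PR_ups xP). Qed.
Let eps0 : 0 < eps. Proof. by case: rx. Qed.
Let Xk : X k = x. Proof. by case: ox. Qed.

Lemma orb_gt1 : (1 < k)%N.
Proof.
case: (k) ox => [|[|//]] [_ // _ xE _]; have := cox_fix_rad cartan xE x.
by rewrite (Kf_diag cartan) => /eqP; rewrite gt_eqF // mulr_gt0.
Qed.

Lemma orb_step m : ef A d x (X m.+1) = ef A d x (X m) + Kf A d x (X m.+1).
Proof. by rewrite (KfE cartan) [ef A d (X m.+1) x](ef_cox cartan) addrCA subrr addr0. Qed.

Lemma orb_K_le m : (0 < m < k)%N -> Kf A d x (X m) <= 0.
Proof.
move=> mk; apply: PR_Kle0 => //; first exact: PR_itercox.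
by rewrite eq_sym; case: ox => _ _ _; apply.
Qed.

Lemma orb_K1 : Kf A d x (X 1) <= - eps.
Proof.
have K0 : Kf A d x (X 1) <= 0 by apply: orb_K_le; rewrite orb_gt1.
have := rootlike_Kf cartan rx (w := X 1); have [_ Xi _] := rootlike_cox cartan rx.
move=> /(_ Xi)/norm_intr_ge1; rewrite -/eps mulf_neq0 ?invr_eq0 ?(gt_eqF eps0) // => /(_ isT).
by rewrite normrM normfV (gtr0_norm eps0) ler_pdivlMr // mul1r ler0_norm // lerNr.
Qed.

Lemma orb_e_mono (a b : nat) : (0 < a <= b)%N -> (b < k)%N ->
  ef A d x (X b) <= ef A d x (X a).
Proof.
move=> /andP[a0]; elim: b => [|b IH]; first by rewrite leqn0 => /eqP <-.
rewrite leq_eqVlt => /orP[/eqP<- //|ab] bk; rewrite orb_step.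
by apply: le_trans (IH ab (ltnW bk)); rewrite gerDl orb_K_le.
Qed.

Lemma orb_e_last : ef A d x (X k.-1) = - eps.
Proof.
by rewrite -[LHS]opprK -(ef_cox cartan) -iterS prednK ?(orb_k0 ox) // -/(X k) Xk.
Qed.

(** The values decrease from m = 1 to m = k-1. Since K (x, X 1) and K (x, X (k-1)) agree and are at
    most - eps, the value at 1 is at most 0 and the one at k-2 is at least 0, which squeezes
    everything in between. *)
Lemma orb_e m : (m < k)%N -> ef A d x (X m) = eps * ((m == 0)%N%:R - (m == k.-1)%:R).
Proof.
have k1 := orb_gt1; have [->|m0] := posnP m => mk.
  by rewrite -[k in k.-1]prednK ?(orb_k0 ox) //; case: (k) k1 => [|[|q]] //= _; rewrite subr0 mulr1.
have [->|mk1] := eqVneq m k.-1.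
  by rewrite orb_e_last sub0r mulrN1.
rewrite subr0 mulr0; apply/eqP; rewrite eq_le; apply/andP; split.
  apply: (@le_trans _ _ (ef A d x (X 1))); first by apply: orb_e_mono => //; lia.
  by rewrite orb_step; have := orb_K1; rewrite -/eps; lra.
have mk2 : (m <= k.-2)%N by lia.
apply: (@le_trans _ _ (ef A d x (X k.-2))); last by apply: orb_e_mono; lia.
have := orb_step k.-2; have -> : k.-2.+1 = k.-1 by lia.
rewrite orb_e_last; have : Kf A d x (X k.-1) <= - eps; last by lra.
suff -> : Kf A d x (X k.-1) = Kf A d x (X 1) by apply: orb_K1.
rewrite -(Kf_cox cartan) -[cox A (X _)]/(X k.-1.+1) prednK ?(orb_k0 ox) // Xk.
by rewrite (KfC cartan).
Qed.

Lemma orb_e_dvd m : ef A d x (X m) = eps * ((k %| m)%:R - (k %| m.+1)%:R).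
Proof.
have k1 := orb_gt1; have mk : (m %% k < k)%N by rewrite ltn_mod; lia.
rewrite /X (orb_mod ox) orb_e //; congr (_ * (_%:R - _%:R)).
rewrite /dvdn -addn1 -modnDml addn1; move: (m %% k)%N mk => r rk.
have [->|rk1] := eqVneq r k.-1; first by rewrite prednK ?modnn //; lia.
by rewrite modn_small //; lia.
Qed.

Lemma orb_ef (a b : nat) :
  ef A d (X a) (X b) = eps * ((b == a %[mod k])%:R - (b.+1 == a %[mod k])%:R).
Proof.
(* Adding a multiple of the period moves b past a, which keeps the subtraction of exponents from
   truncating. *)
have k1 := orb_gt1; have ab : (a <= b + a * k)%N.
  by rewrite -[X in (X <= _)%N]add0n leq_add // leq_pmulr //; lia.
have Xb : X b = X (b + a * k) by rewrite /X (orb_mod ox) (orb_mod ox (b + _)) addnC modnMDl.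
rewrite Xb -(subnKC ab) /X iterD (ef_itercoxl cartan) (iter_coxK cartan) orb_e_dvd.
congr (_ * (_%:R - _%:R)).
  by rewrite -eqn_mod_dvd // addnC modnMDl.
rewrite -subSn // -eqn_mod_dvd ?(leq_trans ab) // -addSn addnC modnMDl //.
Qed.

Lemma orb_eq (a b : nat) : (X a == X b) = (a == b %[mod k]).
Proof.
have k0 := orb_k0 ox; apply/eqP/eqP => [|E].
  by rewrite /X (orb_mod ox) (orb_mod ox b); apply: (orb_inj ox); rewrite ltn_mod.
by rewrite /X (orb_mod ox) (orb_mod ox b) E.
Qed.

Definition arc (y : 'rV[rat]_n) l := \sum_(j < l) iter j (cox A) y.

Lemma arc_efl l y : PR y ->
  ef A d (arc x l) y = eps * ((cox A y == X l)%:R - (cox A y == x)%:R).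
Proof.
move=> yP; have k1 := orb_gt1.
have [/trajectP[b bk ->]|yout] := boolP (y \in traject (cox A) x k).
  rewrite /arc ef_suml (eq_bigr (fun j : 'I_l =>
    eps * ((b.+1 == j.+1 %[mod k])%:R - (b.+1 == j %[mod k])%:R))) => [|j _]; last first.
    by rewrite orb_ef -[b.+1]addn1 -[j.+1]addn1 eqn_modDr.
  rewrite -mulr_sumr sumrB (sum_shift (fun m => (b.+1 == m %[mod k])%:R)) addrC addKr.
  by rewrite -iterS -/(X b.+1) -[x in RHS]/(X 0%N) !orb_eq.
have cn m : (cox A y == X m) = false.
  apply: contraNF yout => /eqP E; apply/trajectP; exists ((m + k.-1) %% k)%N.
    by rewrite ltn_mod; lia.
  rewrite -(orb_mod ox); apply: (can_inj (coxK cartan)); rewrite E -iterS; apply/eqP.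
  by rewrite -/(X _.+1) orb_eq -addnS prednK ?modnDr //; lia.
rewrite cn -[x in _ == x]/(X 0%N) cn subrr mulr0 /arc ef_suml big1 // => j _.
by have [] := orb_ef_out ox j yP yout.
Qed.

Lemma arc_efr l y : PR y ->
  ef A d y (arc x l) = eps * ((y == x)%:R - (y == X l)%:R).
Proof.
move=> yP; have k1 := orb_gt1.
have [/trajectP[a ak ->]|yout] := boolP (y \in traject (cox A) x k).
  rewrite /arc ef_sumr (eq_bigr (fun j : 'I_l =>
    eps * ((j == a %[mod k])%:R - (j.+1 == a %[mod k])%:R))) => [|j _]; last exact: orb_ef.
  rewrite -mulr_sumr sumrB (sum_shift (fun m => (m == a %[mod k])%:R)) opprD addNKr opprB.
  by rewrite -/(X a) -[x in RHS]/(X 0%N) !orb_eq ![a == _ %[mod k]]eq_sym.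
have cn m : (y == X m) = false.
  apply: contraNF yout => /eqP ->; apply/trajectP; exists (m %% k)%N.
    by rewrite ltn_mod; lia.
  exact: (orb_mod ox).
rewrite cn -[x in _ == x]/(X 0%N) cn subrr mulr0 /arc ef_sumr big1 // => j _.
by have [] := orb_ef_out ox j yP yout.
Qed.

Lemma orb_ef_comb (T : nat -> rat) m :
    (forall q, T (q + k)%N = T q) ->
  ef A d (X m.+1) (\sum_(j < k) T j *: X j) = eps * (T m.+1 - T m).
Proof.
move=> Tk; have k0 := orb_k0 ox.
have Tmod q : T q = T (q %% k)%N.
  by rewrite {1}(divn_eq q k) addnC; elim: (q %/ k)%N => [|r IH]; rewrite ?addn0 // mulSn addnCA addnC Tk.
have pick q : \sum_(j < k) T j * (j == q %[mod k])%:R = T q.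
  have qk : (q %% k < k)%N by rewrite ltn_mod.
  rewrite (bigD1 (Ordinal qk)) //= modn_mod eqxx mulr1 -Tmod big1 ?addr0 // => j.
  rewrite -val_eqE /= => /negPf jq; rewrite modn_small // jq mulr0 //.
rewrite ef_sumr -{1}(pick m.+1) -(pick m) -sumrB mulr_sumr; apply: eq_bigr => j _.
by rewrite efZr orb_ef -[j.+1]addn1 -[m.+1]addn1 eqn_modDr; ring.
Qed.

(** Pairing with the orbit shows that t is constant, and the orbit sum is a nonzero multiple of
    delta. *)
Lemma orb_free (t : nat -> rat) : \sum_(j < k) t j *: X j = 0 ->
  forall q, (q < k)%N -> t q = 0.
Proof.
move=> t0; pose T q := t (q %% k)%N; have k0 := orb_k0 ox.
have E : \sum_(j < k) T j *: X j = 0.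
  by rewrite -[RHS]t0; apply: eq_bigr => j _; rewrite /T modn_small.
have Tk q : T (q + k)%N = T q by rewrite /T modnDr.
have cst q : T q = T 0%N.
  elim: q => // q <-; have /eqP := orb_ef_comb q Tk; rewrite E ef0r eq_sym mulf_eq0.
  by rewrite (gt_eqF eps0) subr_eq0 => /eqP.
have [s s0 sE] := orb_sum ox.
have T0 : T 0%N = 0.
  move: E; under eq_bigr => j _ do rewrite cst.
  rewrite -scaler_sumr sE scalerA => /eqP; rewrite scaler_eq0 (negPf delta_neq0) orbF.
  by rewrite mulf_eq0 (gt_eqF s0) orbF => /eqP.
by move=> q qk; have := cst q; rewrite T0 /T modn_small.
Qed.

End GoodOrbit.
Lemma orb_cox x k : orb x k -> orb (cox A x) k.
Proof.
move=> [xP k0 xk xm]; split=> //; first exact: PR_cox.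
  by rewrite -iterSr iterS xk.
move=> m mk; rewrite -iterSr iterS; apply: contra (xm m mk) => /eqP E.
by apply/eqP; apply: (can_inj (coxK cartan)).
Qed.
Lemma orb_coxinv x k : orb x k -> orb (coxinv A x) k.
Proof.
move=> [xP k0 xk xm]; split=> //; first exact: PR_coxinv.
  by apply: (can_inj (coxK cartan)); rewrite -iterS iterSr (coxinvK cartan).
move=> m mk; apply: contra (xm m mk) => /eqP E.
by rewrite -{1}(coxinvK cartan x) -iterSr iterS E (coxinvK cartan).
Qed.
Lemma orb_iter m x k : orb x k -> orb (iter m (cox A) x) k.
Proof. by move=> ox; elim: m => //= m; apply: orb_cox. Qed.

Lemma traject_uniq x k : orb x k -> uniq (traject (cox A) x k).
Proof.
move=> ox; apply/(uniqP x) => a b; rewrite !inE size_traject => ak bk.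
by rewrite !nth_traject //; apply: (orb_inj ox).
Qed.
Lemma big_traject (V : nmodType) (F : 'rV[rat]_n -> V) x k :
  \sum_(y <- traject (cox A) x k) F y = \sum_(j < k) F (iter j (cox A) x).
Proof.
rewrite (big_nth x) size_traject big_mkord; apply: eq_bigr => j _.
by rewrite nth_traject.
Qed.
Lemma mem_orb x k m : orb x k -> iter m (cox A) x \in traject (cox A) x k.
Proof.
move=> ox; apply/trajectP; exists (m %% k)%N; last exact: (orb_mod ox).
by rewrite ltn_mod (orb_k0 ox).
Qed.

Lemma plink_traject x k u v : orb x k -> u \in traject (cox A) x k -> PR v ->
  Kf A d u v != 0 -> v \in traject (cox A) x k.
Proof.
move=> ox /trajectP[m _ ->] vP; rewrite (KfC cartan); apply: contraNT => vout.
by rewrite (orb_Kf_out ox).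
Qed.
Lemma pconn_traject x k u v : orb x k -> pconn u v -> u \in traject (cox A) x k ->
  v \in traject (cox A) x k.
Proof.
move=> ox; elim=> [a b [aP bP ab] ain|//|a b e _ h1 _ h2 /h1/h2 //].
exact: plink_traject ain bP ab.
Qed.

(** * The roots of Upsilon_c^re as proper arcs of orbits *)

Definition good_arc a x k l :=
  [/\ orb x k, Kf A d x (cox A x) != 0, (0 < l < k)%N & a = arc x l].

Lemma arc_cox x l : cox A (arc x l) = arc (cox A x) l.
Proof. by rewrite /arc cox_sum; apply: eq_bigr => j _; rewrite -iterS iterSr. Qed.

Lemma good_arc_cox a x k l : good_arc a x k l -> good_arc (cox A a) (cox A x) k l.
Proof.
move=> [ox gx lk ->]; split=> //; [exact: orb_cox|by rewrite (Kf_cox cartan)|exact: arc_cox].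
Qed.
Lemma good_arc_coxinv a x k l : good_arc a x k l -> good_arc (coxinv A a) (coxinv A x) k l.
Proof.
move=> [ox gx lk ->]; split=> //; first exact: orb_coxinv.
  by rewrite -(Kf_cox cartan) !(coxinvK cartan).
by apply: (can_inj (coxK cartan)); rewrite arc_cox !(coxinvK cartan).
Qed.

Lemma fin_arc a : real_root A a -> pos a -> ef A d delta a = 0 -> a 0 aff = 0 ->
  exists x k l, good_arc a x k l.
Proof.
move=> ra pa ea aa; have ua := ups_real ra pa ea.
have rla := real_rootlike cartan ra; have [a0 ai _] := rla.
have [c c0 aE] := ups_cone ua; have ca := cone_aff0 c0 aE aa.
have cP y : y \in P -> c y != 0 -> PR y /\ y 0 aff = 0.
  move=> yP cy; have ya : y 0 aff = 0.
    by have /eqP := ca y yP; rewrite mulf_eq0 (negPf cy) => /eqP.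
  split=> //; split=> //; have [Ry _ _] := P_ups yP; apply: root_Kneq0 => //.
  by rewrite gt_eqF // aff_sub_finite //; apply/ups_neq0/P_ups.
have [z zin zK] : exists2 z, z \in P & 0 < c z * Kf A d z a.
  apply/hasP/negPn/negP => /hasPn h.
  have : Kf A d a a <= 0; last by rewrite (Kf_diag cartan) leNgt mulr_gt0.
  rewrite {1}aE (Kf_suml cartan) big_seq; apply: sumr_le0 => z zP.
  by rewrite (KfZl cartan) leNgt; apply: h.
have cz : c z != 0 by apply: contraTneq zK => ->; rewrite mul0r ltxx.
have Kz : Kf A d a z != 0.
  by rewrite (KfC cartan); apply: contraTneq zK => ->; rewrite mulr0 ltxx.
have [zP za] := cP z zin cz; have gz := good_orbit zP za.
have [k oz] := orb_ex zP; have k0 := orb_k0 oz.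
(* Otherwise the whole orbit would have coordinate 0 at [aff], and so would its sum, a positive
   multiple of delta. *)
have [m mk cm] : exists2 m, (m < k)%N & c (iter m (cox A) z) = 0.
  apply: contrapT => nex; have [s s0 sE] := orb_sum oz.
  have := congr1 (fun v : 'rV_n => v 0 aff) sE; rewrite summxE big1 => [|j _]; last first.
    have [|_ //] := cP _ (proj1 (PR_itercox j zP)).
    by apply/eqP => h; apply: nex; exists j.
  by rewrite mxE => /esym/eqP; rewrite mulf_eq0 !gt_eqF ?delta_gt0.
(* The arc is to start directly after a vanishing coefficient. *)
have [p p0 p1] : exists2 p, c (iter p (cox A) z) = 0 & c (iter p.+1 (cox A) z) != 0.
  have ex : exists q, c (iter (m + q) (cox A) z) != 0.
    by exists (k - m)%N; rewrite subnKC ?(ltnW mk) //; case: oz => _ _ ->.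
  case: (ex_minnP ex) => -[|q] hq qmin; first by rewrite addn0 cm eqxx in hq.
  exists (m + q)%N; last by rewrite -addnS.
  by apply/eqP/negPn/negP => /qmin; rewrite ltnn.
pose x := iter p.+1 (cox A) z; have ox : orb x k by apply: orb_iter.
have gx : Kf A d x (cox A x) != 0.
  by rewrite -[cox A x]/(iter p.+2 (cox A) z) iterSr (Kf_itercox cartan).
have zx : z \in traject (cox A) x k.
  have -> : z = iter (p.+1 * k.-1) (cox A) x; last exact: mem_orb.
  by rewrite /x -iterD -mulnSr prednK // (orb_mod oz) modnMl.
have xsub : {subset traject (cox A) x k <= P}.
  by move=> y /trajectP[q _ ->]; case: (PR_itercox q (orb_PR ox)).
have [z0 z0P hz] := root_one_component ra ua.
(* By [root_one_component] whatever pairs with a is connected to z, and connected elements stay in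
   the orbit of z. *)
have out y : PR y -> y \notin traject (cox A) x k -> Kf A d a y = 0.
  move=> yP; apply: contraNeq => Ky; apply: pconn_traject ox _ zx.
  exact: rt_trans (pconn_sym (hz z zP Kz)) (hz y yP Ky).
pose O y := y \in traject (cox A) x k.
pose u' := \sum_(y <- P | ~~ O y) c y *: y; pose uO := \sum_(y <- P | O y) c y *: y.
have aS : a = uO + u' by rewrite aE (bigID O).
have Ku v : (forall y, PR y -> ~~ O y -> Kf A d y v = 0) -> Kf A d u' v = 0.
  move=> h; rewrite /u' (Kf_suml cartan) big_seq_cond big1 // => y /andP[yP yO].
  have [->|cy] := eqVneq (c y) 0; first by rewrite scale0r (Kf0l cartan).
  by rewrite (KfZl cartan) h ?mulr0 //; case: (cP y yP cy).
have KuO : Kf A d u' uO = 0.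
  apply: Ku => y yP yO; rewrite /uO (Kf_sumr cartan) big1 // => y2 /trajectP[q _ ->].
  by rewrite (KfZr cartan) (orb_Kf_out ox) ?mulr0.
have Kua : Kf A d u' a = 0 by apply: Ku => y yP yO; rewrite (KfC cartan) out.
have Kuu : Kf A d u' u' = 0 by move: Kua; rewrite aS (KfDr cartan) KuO add0r.
(* u' is isotropic, being orthogonal to a and to uO, and it lies in the finite part, where K is
   definite. *)
have u'0 : u' = 0.
  apply/eqP/negPn/negP => u0; have := aff_sub_finite _ u0; rewrite Kuu ltxx => h; suff /h : u' 0 aff = 0 by [].
  rewrite /u' summxE big_seq_cond big1 // => y /andP[yP _].
  by rewrite mxE ca.
pose T q := c (iter q (cox A) x); pose X q := iter q (cox A) x.
have aT : a = \sum_(j < k) T j *: X j.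
  rewrite aS u'0 addr0 /uO -big_filter -(big_traject (fun y => c y *: y)); apply: perm_big.
  apply: uniq_perm; [exact: filter_uniq P_uniq|exact: traject_uniq|move=> y].
  by rewrite mem_filter /O andbC; apply: andb_idl; apply: xsub.
have xk : iter k (cox A) x = x by case: ox.
have Tk q : T (q + k)%N = T q by rewrite /T iterD xk.
pose eps := ef A d x x; have eps0 : 0 < eps by have [[]] := PR_ups (orb_PR ox).
have eX q : ef A d (X q) (X q) = eps.
  by rewrite /X (ef_itercoxl cartan) (iter_coxK cartan).
have eD q : ef A d (X q.+1) a = eps * (T q.+1 - T q).
  by rewrite aT (orb_ef_comb ox gx).
have DE q : T q.+1 - T q = ef A d (X q.+1) a / eps by rewrite eD mulrC mulKf ?gt_eqF.
have Xrl q : rootlike A d (X q) by have [] := PR_ups (PR_itercox q (orb_PR ox)).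
have k1 := orb_gt1 ox.
(* r is the half norm of a in units of eps. The differences of T are the pairings of a with orbit
   roots, normalized by eps; divided by r they are normalized by the half norm of a instead. Hence
   both integrality conditions. *)
have [||||q|q||l lk lT] := @arc_shape k T (ef A d a a / eps) k1.
- by rewrite -[k]add0n Tk.
- rewrite /T /x -iterD (_ : (k.-1 + p.+1 = p + k)%N); last by rewrite addnS -addSn prednK // addnC.
  by rewrite iterD; case: oz => _ _ ->.
- by rewrite lt_def c0 andbT.
- by rewrite divr_gt0.
- by rewrite DE -(eX q.+1); apply: rootlike_efl.
- rewrite DE invf_div -mulrA mulKf ?gt_eqF //; apply: rootlike_efr => //.
  by have [_ xi _] := Xrl q.+1.
(* Since the differences of squares cancel around the cycle, 2 [ef a a] / eps is the sum of the
   squared differences of T. *)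
- have aa2 : ef A d a a = eps * \sum_(q < k) T q.+1 * (T q.+1 - T q).
    have -> : ef A d a a = \sum_(q < k) T q * ef A d (X q) a.
      by rewrite {1}aT ef_suml; apply: eq_bigr => q _; rewrite efZl.
    have := sum_shift (fun q => T q * ef A d (X q) a) k.
    rewrite -[k in T k]add0n Tk -[X k]/(iter k (cox A) x) xk subrr addr0 => <-.
    by rewrite mulr_sumr; apply: eq_bigr => q _; rewrite eD; ring.
  have tel : \sum_(q < k) (T q.+1 ^+ 2 - T q ^+ 2) = 0.
    rewrite sumrB (sum_shift (fun q => T q ^+ 2)) -[k in T k]add0n Tk.
    by rewrite subrr addr0 subrr.
  rewrite aa2 [eps * _]mulrC mulfK ?gt_eqF // mulr_sumr.
  transitivity (\sum_(q < k) (2 * (T q.+1 * (T q.+1 - T q)) - (T q.+1 ^+ 2 - T q ^+ 2))).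
    by apply: eq_bigr => q _; ring.
  by rewrite sumrB tel subr0.
exists x, k, l; split=> //; rewrite aT /arc (big_ord_widen k (fun q => iter q (cox A) x)); last first.
  by case/andP: lk => _ /ltnW.
rewrite [RHS]big_mkcond; apply: eq_bigr => j _; rewrite lT //.
by case: ifP; rewrite ?scale1r ?scale0r.
Qed.

Lemma Ups_re_arc a : Ups_re A d aff g a -> exists x k l, good_arc a x k l.
Proof.
case=> ra pa /UcE ea [m [[_ fa]|[_ fa]]].
  have [r1 r2] := ups_regular ra pa ea.
  have [x [k [l h]]] : exists x k l, good_arc (iter m (cox A) a) x k l.
    apply: fin_arc => //; last by rewrite ef_delta_itercox.
    by elim: (m) => //= q; apply: real_root_cox.
  rewrite -(iter_coxK cartan m a); elim: (m) {fa r1 r2} (iter m (cox A) a) x h => [|q IH] b x h.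
    by exists x, k, l.
  by rewrite iterSr; apply: IH (coxinv A x) _; apply: good_arc_coxinv.
have [r1 r2] := ups_regular ra pa ea.
have [x [k [l h]]] : exists x k l, good_arc (iter m (coxinv A) a) x k l.
  apply: fin_arc => //; first by elim: (m) => //= q; apply: real_root_coxinv.
  by elim: (m) => //= q IH; rewrite ef_delta_coxinv.
rewrite -(iter_coxinvK cartan m a); elim: (m) {fa r1 r2} (iter m (coxinv A) a) x h => [|q IH] b x h.
  by exists x, k, l.
by rewrite iterSr; apply: IH (cox A x) _; apply: good_arc_cox.
Qed.

Lemma orb_component x k : orb x k -> Kf A d x (cox A x) != 0 ->
  is_component A d P (traject (cox A) x k).
Proof.
move=> ox gx; have xP := orb_PR ox; set C := traject _ _ _.
have mem m : iter m (cox A) x \in C by apply: mem_orb.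
pose R := clos_refl_trans _ (fun a b => [/\ a \in C, b \in C & Kf A d a b != 0]).
have step m : Kf A d (iter m (cox A) x) (iter m.+1 (cox A) x) != 0.
  by rewrite iterSr (Kf_itercox cartan).
have up m : R x (iter m (cox A) x).
  by elim: m => [|m IH]; [apply: rt_refl|apply: rt_trans IH _; apply: rt_step].
have down m : R (iter m (cox A) x) x.
  elim: m => [|m IH]; first exact: rt_refl.
  by apply: rt_trans _ IH; apply: rt_step; split; rewrite // (KfC cartan).
split=> [|||y z /trajectP[a _ ->] /trajectP[b _ ->]|y z yC zP rz K].
- exact: traject_uniq.
- by rewrite -size_eq0 size_traject -lt0n (orb_k0 ox).
- by move=> y /trajectP[m _ ->]; have [] := PR_itercox m xP.
- exact: rt_trans (down a) (up b).
- exact: plink_traject yC _ K.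
Qed.

Lemma arc_sum x k l : (l <= k)%N ->
  arc x l = \sum_(q < k) (q < l)%N%:R *: iter q (cox A) x.
Proof.
move=> lk; rewrite /arc (big_ord_widen k (fun q => iter q (cox A) x)) // big_mkcond.
by apply: eq_bigr => q _; case: ifP; rewrite ?scale1r ?scale0r.
Qed.

(** * Tube supports of arcs *)

Section ArcSupport.
Variables (a x : 'rV[rat]_n) (k l : nat).
Hypothesis ga : good_arc a x k l.

Let ox : orb x k. Proof. by case: ga. Qed.
Let gx : Kf A d x (cox A x) != 0. Proof. by case: ga. Qed.
Let lk : (0 < l < k)%N. Proof. by case: ga. Qed.
Let aE : a = arc x l. Proof. by case: ga. Qed.
Let xP := orb_PR ox.
Let eps0 : 0 < ef A d x x. Proof. by have [[]] := PR_ups xP. Qed.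

(** By [arc_efl] only the last term of the arc pairs nontrivially with the whole arc; that x itself
    is not hit uses l < k. *)
Lemma arc_halfnorm : ef A d a a = ef A d x x.
Proof.
rewrite {2}aE ef_sumr; have k1 := orb_gt1 ox.
rewrite (eq_bigr (fun j : 'I_l => ef A d x x * (j.+1 == l)%:R)) => [|j _]; last first.
  rewrite aE (arc_efl ox gx l (PR_itercox j xP)) -iterS.
  rewrite (orb_eq ox j.+1 l) (orb_eq ox j.+1 0%N : (_ == x) = _).
  have jl := ltn_ord j; rewrite !modn_small; [|lia..].
  by rewrite subr0.
rewrite -mulr_sumr; have l1 : (l.-1 < l)%N by lia.
rewrite (bigD1 (Ordinal l1)) //= prednK ?eqxx; last by lia.
rewrite big1 ?addr0 ?mulr1 // => j; rewrite -val_eqE /= => jl.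
by have -> : (j.+1 == l) = false by lia.
Qed.

(** [in_supp] quantifies over all components and coefficient lists. A component that misses the
    orbit is impossible because a is not isotropic, one that meets it lies inside it, and [orb_free]
    then determines the coefficients. *)
Lemma supp_arc_sub z : in_supp A d P a z -> z \in traject (cox A) x l.
Proof.
case=> C [[uC _ CP Cc _] [ks [sk aC [j0 [j0C [Cj0 kj0]]]]]].
have CPR y : y \in C -> PR y by move=> /CP[].
have [y yC yt] : exists2 y, y \in C & y \in traject (cox A) x k.
  apply: contrapT => nex.
  have : Kf A d a a = 0; last by rewrite (Kf_diag cartan) arc_halfnorm => /eqP; rewrite gt_eqF // mulr_gt0.
  rewrite {2}aC (Kf_sumr cartan) big1 // => j _; rewrite (KfZr cartan).
  have Cj : C`_j \in C by rewrite mem_nth.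
  rewrite aE (Kf_suml cartan) big1 ?mulr0 // => q _.
  rewrite (KfC cartan) (orb_Kf_out ox) //; first exact: CPR.
  by apply/negP => h; apply: nex; exists C`_j.
have Ct v : v \in C -> v \in traject (cox A) x k.
  move=> vC; apply: pconn_traject ox _ yt; elim: (Cc y v yC vC) => [u w [uC' wC K]|u|u w t _ h1 _ h2].
  - by apply: rt_step; split=> //; apply: CPR.
  - exact: rt_refl.
  - exact: rt_trans h1 h2.
pose kap v : rat := if v \in C then ks`_(index v C) else 0.
have aS : a = \sum_(q < k) kap (iter q (cox A) x) *: iter q (cox A) x.
  rewrite -(big_traject (fun v => kap v *: v)) aC.
  transitivity (\sum_(v <- C) kap v *: v).
    rewrite (big_nth 0) big_mkord; apply: eq_bigr => j _.
    by rewrite /kap mem_nth // index_uniq.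
  rewrite [RHS](bigID (mem C)) /= [X in _ = _ + X]big1 ?addr0 => [|v /negPf vC]; last first.
    by rewrite /kap vC scale0r.
  rewrite -[RHS]big_filter; apply: perm_big; apply: uniq_perm => //.
    exact/filter_uniq/traject_uniq.
  by move=> v; rewrite mem_filter; apply/idP/andP => [vC|[]//]; split=> //; apply: Ct.
have tE q : (q < k)%N -> kap (iter q (cox A) x) = (q < l)%N%:R.
  move=> qk; apply/eqP; rewrite -subr_eq0; apply/eqP.
  apply: (orb_free ox gx (t := fun q => kap (iter q (cox A) x) - (q < l)%N%:R)) => //.
  rewrite (eq_bigr (fun j : 'I_k => kap (iter j (cox A) x) *: iter j (cox A) x -
     (j < l)%N%:R *: iter j (cox A) x)) => [|j _]; last by rewrite scalerBl.
  by rewrite sumrB -aS -arc_sum -?aE ?subrr //; lia.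
have zC : z \in C by rewrite -Cj0 mem_nth.
have /trajectP[q qk zE] := Ct z zC; apply/trajectP; exists q => //.
have := tE q qk; rewrite -zE /kap zC -Cj0 index_uniq //; case: ltnP => // _ E.
by rewrite E eqxx in kj0.
Qed.

Lemma mem_supp_arc z : (z \in supp A d P a) = (z \in traject (cox A) x l).
Proof.
rewrite mem_filter; apply/andP/idP => [[/asboolP]|]; first by move=> /supp_arc_sub.
move=> /trajectP[j jl ->]; have jk : (j < k)%N by lia.
split; last by have [] := PR_itercox j xP.
apply/asboolP; exists (traject (cox A) x k); split; first exact: orb_component.
exists (mkseq (fun q => (q < l)%N%:R) k); split.
- by rewrite size_mkseq size_traject.
- rewrite size_traject aE (arc_sum _ (k := k)); last by lia.
  by apply: eq_bigr => q _; rewrite nth_mkseq // (set_nth_default x) ?size_traject // nth_traject.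
- exists j; rewrite size_traject jk (set_nth_default x) ?size_traject // nth_traject //.
  by rewrite nth_mkseq // jl oner_eq0.
Qed.

Lemma supp_uniq : uniq (supp A d P a).
Proof. exact/filter_uniq/P_uniq. Qed.

Lemma sum_supp : a = \sum_(z <- supp A d P a) z.
Proof.
rewrite {1}aE /arc -(big_traject id); apply: perm_big; apply: uniq_perm.
- have := traject_uniq ox; rewrite -(subnKC (_ : (l <= k)%N)); last by lia.
  by rewrite trajectD cat_uniq => /andP[].
- exact: supp_uniq.
- by move=> z; rewrite mem_supp_arc.
Qed.

Lemma supp_PR z : z \in supp A d P a -> PR z.
Proof. by rewrite mem_supp_arc => /trajectP[j _ ->]; apply: PR_itercox. Qed.

End ArcSupport.

(** * The degree of two arcs *)

Lemma orb_uniq x k k' : orb x k -> orb x k' -> k = k'.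
Proof.
move=> [_ k0 xk xm] [_ k0' xk' xm']; case: (ltngtP k k') => // h.
  by have := xm' k; rewrite k0 h xk eqxx => /(_ isT).
by have := xm k'; rewrite k0' h xk' eqxx => /(_ isT).
Qed.

Lemma traject_back x k y k' : orb x k -> orb y k' ->
  (exists2 z, z \in traject (cox A) x k & z \in traject (cox A) y k') ->
  y \in traject (cox A) x k.
Proof.
move=> ox oy [z /trajectP[i _ zi] /trajectP[j jk zj]].
have -> : y = iter (k' - j + i) (cox A) x; last exact: mem_orb.
by rewrite iterD -zi zj -iterD subnK ?(ltnW jk) //; case: oy.
Qed.

Lemma component_orbit C x k c0 : is_component A d P C -> orb x k ->
  Kf A d x (cox A x) != 0 -> c0 \in C -> c0 \in traject (cox A) x k ->
  forall m, iter m (cox A) x \in C.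
Proof.
move=> [_ _ CP _ Cc] ox gx c0C /trajectP[i _ cE] m.
have up q : iter q (cox A) c0 \in C.
  elim: q => // q IH; have [qP qr] := CP _ IH.
  have [sP sr] := PR_cox (conj qP qr : PR _).
  by apply: Cc IH sP sr _; rewrite cE -!iterD -iterS iterSr (Kf_itercox cartan).
have im : (i <= m + i * k)%N.
  by rewrite -[X in (X <= _)%N]add0n leq_add // leq_pmulr // (orb_k0 ox).
have -> : iter m (cox A) x = iter (m + i * k - i) (cox A) c0; last exact: up.
rewrite cE -iterD subnK //; apply/eqP.
by rewrite (orb_eq ox) addnC modnMDl.
Qed.

Lemma mem_supp_cox a x k l z : good_arc a x k l ->
  (cox A z \in supp A d P (cox A a)) = (z \in supp A d P a).
Proof.
move=> ga; rewrite (mem_supp_arc ga) (mem_supp_arc (good_arc_cox ga)).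
apply/trajectP/trajectP => -[j jl E]; exists j => //.
  by apply: (can_inj (coxK cartan)); rewrite E -iterSr iterS.
by rewrite E -iterS iterSr.
Qed.

Section ArcPair.
Variables (a b x y : 'rV[rat]_n) (k l k' m : nat).
Hypothesis ga : good_arc a x k l.
Hypothesis gb : good_arc b y k' m.
Let X q := iter q (cox A) x.
Let S := supp A d P b.

Let ox : orb x k. Proof. by case: ga. Qed.
Let gx : Kf A d x (cox A x) != 0. Proof. by case: ga. Qed.
Let lk : (0 < l < k)%N. Proof. by case: ga. Qed.
Let aE : a = arc x l. Proof. by case: ga. Qed.
Let oy : orb y k'. Proof. by case: gb. Qed.
Let gy : Kf A d y (cox A y) != 0. Proof. by case: gb. Qed.
Let mk : (0 < m < k')%N. Proof. by case: gb. Qed.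

Lemma coxinv_orb q : coxinv A (X q) = X (q + k.-1).
Proof.
apply: (can_inj (coxK cartan)); rewrite (coxinvK cartan) -iterS; apply/eqP.
rewrite (orb_eq ox) -addnS prednK ?modnDr //; exact: orb_k0 ox.
Qed.
Lemma coxinv_orb0 : coxinv A x = X k.-1. Proof. exact: (coxinv_orb 0). Qed.
Lemma coxinv_orbS q : coxinv A (X q.+1) = X q. Proof. by rewrite /X iterS (coxK cartan). Qed.

Lemma mem_supp_orb q : (q < k)%N -> (X q \in supp A d P a) = (q < l)%N.
Proof.
move=> qk; rewrite (mem_supp_arc ga); apply/trajectP/idP => [[j jl E]|ql]; last by exists q.
by rewrite (orb_inj ox qk _ E) //; apply: ltn_trans jl _; case/andP: lk.
Qed.

Lemma pair_efl : ef A d a b =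
  ef A d x x * ((coxinv A (X l) \in S)%:R - (coxinv A x \in S)%:R).
Proof.
rewrite {1}(sum_supp gb) ef_sumr big_seq.
rewrite (eq_bigr (fun z => ef A d x x * ((z == coxinv A (X l))%:R - (z == coxinv A x)%:R))).
  by rewrite -big_seq -mulr_sumr sumrB !sum_eq_mem ?supp_uniq.
move=> z /(supp_PR gb) zP; rewrite aE (arc_efl ox gx l zP).
by rewrite !(can2_eq (coxK cartan) (coxinvK cartan)).
Qed.

Lemma pair_efr : ef A d b a = ef A d x x * ((x \in S)%:R - (X l \in S)%:R).
Proof.
rewrite {1}(sum_supp gb) ef_suml big_seq.
rewrite (eq_bigr (fun z => ef A d x x * ((z == x)%:R - (z == X l)%:R))).
  by rewrite -big_seq -mulr_sumr sumrB !sum_eq_mem ?supp_uniq.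
by move=> z /(supp_PR gb) zP; rewrite aE (arc_efr ox gx l zP).
Qed.

(** c a and c^-1 a are the arc shifted by one step, and each gains one point. The two points
    coincide when l = k-1, whence the case distinction in [pair_adj]. *)
Lemma adjacent_arc z : adjacent A d P a z = (z == X l) || (z == coxinv A x).
Proof.
have [l0 lk'] := andP lk.
rewrite /adjacent mem_cat (mem_supp_arc (good_arc_cox ga)) (mem_supp_arc (good_arc_coxinv ga)).
apply/andP/orP => [[/orP[]/trajectP[j jl zE]]|].
- rewrite zE -iterSr; have [jE|jE] := eqVneq j.+1 l; first by left; apply/eqP; rewrite -jE.
  rewrite -/(X j.+1) mem_supp_orb ?(leq_ltn_trans jl lk') // => /negP[].
  by rewrite ltn_neqAle jE.
- case: j jl zE => [|j] jl zE; first by rewrite zE eqxx; right.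
  rewrite zE iterSr (coxinvK cartan) -/(X j) mem_supp_orb; last exact: ltn_trans (ltnW jl) lk'.
  by rewrite ltnW.
- case=> /eqP ->.
    rewrite mem_supp_orb // ltnn; split=> //; apply/orP; left; apply/trajectP.
    by exists l.-1; rewrite ?prednK // -iterSr prednK.
  split; first by apply/orP; right; apply/trajectP; exists 0%N.
  by rewrite coxinv_orb0 mem_supp_orb -?leqNgt; clear -lk; lia.
Qed.

Lemma pair_adj : adj A d P a b =
  (if X l == coxinv A x then (X l \in S) : nat else (X l \in S) + (coxinv A x \in S))%N.
Proof.
rewrite /adj (eq_count adjacent_arc) -/S; have uS : uniq S by apply: supp_uniq.
case: eqVneq => [<-|ne].
  by rewrite (eq_count (a2 := pred1 (X l))) ?count_uniq_mem // => z /=; rewrite orbb.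
have := count_predUI (pred1 (X l)) (pred1 (coxinv A x)) S.
rewrite !count_uniq_mem // => <-; rewrite -[LHS]addn0; congr (_ + _)%N.
rewrite (eq_count (a2 := pred0)) ?count_pred0 // => z /=.
by apply/andP => -[/eqP -> /eqP E]; rewrite E eqxx in ne.
Qed.

Lemma component_fullP : component_full A d P a b <->
  (y \in traject (cox A) x k /\
   forall q, (q < k)%N -> X q \in supp A d P a ++ supp A d P b).
Proof.
split=> [[C [Cc Csub]]|[_ h]]; last first.
  exists (traject (cox A) x k); split; first exact: orb_component.
  by move=> z /trajectP[q qk ->]; apply: h.
have [uC C0 _ _ _] := Cc.
have key c0 : c0 \in C -> c0 \in traject (cox A) x k ->
    y \in traject (cox A) x k /\
    forall q, (q < k)%N -> X q \in supp A d P a ++ supp A d P b.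
  move=> c0C c0x; have h q := Csub _ (component_orbit Cc ox gx c0C c0x q).
  split=> [|q _]; last exact: h.
  apply: traject_back ox oy _; exists (X k.-1); first exact: mem_orb.
  have := h k.-1; rewrite mem_cat mem_supp_orb; last by clear -lk; lia.
  have -> : (k.-1 < l)%N = false by clear -lk; lia.
  by rewrite (mem_supp_arc gb) => /trajectP[j _ E]; rewrite /X E; apply: mem_orb.
have supa z : z \in supp A d P a -> z \in traject (cox A) x k.
  by rewrite (mem_supp_arc ga) => /trajectP[j _ ->]; apply: mem_orb.
case: C C0 Csub Cc key {uC} => // c0 C _ Csub Cc key.
have c0C : c0 \in c0 :: C by rewrite inE eqxx.
have := Csub c0 c0C; rewrite mem_cat => /orP[/supa|]; first exact: key.
rewrite (mem_supp_arc gb) => /trajectP[j _ cE].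
have cy : c0 \in traject (cox A) y k' by rewrite cE; apply: mem_orb.
have YC := component_orbit Cc oy gy c0C cy k'.-1; apply: (key _ YC).
have := Csub _ YC; rewrite mem_cat => /orP[/supa //|].
rewrite (mem_supp_arc gb) => /trajectP[i im /(orb_inj oy) E].
by have := E ltac:(clear -mk; lia) ltac:(clear -mk im; lia); clear -mk im; lia.
Qed.

(** By [pair_efl] and [pair_efr] this is the larger of - [ef a b] and - [ef b a], divided by the
    common half norm of a and x. *)
Definition arc_value : rat :=
  Num.max ((coxinv A x \in S)%:R - (coxinv A (X l) \in S)%:R) ((X l \in S)%:R - (x \in S)%:R).

Lemma arc_circ : compat_circ A d P a b =
  if `[< component_full A d P a b >] then (adj A d P a b)%:R else arc_value.
Proof.
have [l0 lk'] := andP lk; have k1 : (k.-1 < k)%N by clear -lk; lia.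
have lE : coxinv A (X l) = X l.-1 by rewrite -{1}(prednK l0) coxinv_orbS.
have ll : (l.-1 < k)%N by clear -lk; lia.
rewrite /compat_circ; have [ab|nab] := eqVneq a b.
  have nf : ~ component_full A d P a b.
    case/component_fullP => _ /(_ k.-1 k1); rewrite mem_cat -ab orbb mem_supp_orb //.
    by clear -lk; lia.
  have kl : (k.-1 < l)%N = false by clear -lk; lia.
  rewrite asboolF // /arc_value /S -ab coxinv_orb0 lE -[x \in supp _ _ _ _]/(X 0%N \in supp A d P a).
  rewrite !mem_supp_orb //; last by apply: ltn_trans lk'.
  by rewrite kl ltn_predL ltnn l0 maxxx sub0r.
have [yx|yx] := boolP (y \in traject (cox A) x k); last first.
  have XS q : (X q \in S) = false.
    apply: contraNF yx => h; apply: traject_back ox oy _; exists (X q); first exact: mem_orb.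
    by move: h; rewrite (mem_supp_arc gb) => /trajectP[j _ ->]; apply: mem_orb.
  rewrite asboolF => [|/component_fullP[h]]; last by rewrite h in yx.
  rewrite pair_adj /arc_value coxinv_orb0 lE -[x \in S]/(X 0%N \in S) !XS.
  by rewrite addn0 if_same if_same subrr maxxx.
(* From here on both arcs lie on one cycle of length k: a occupies the positions [0, l), b starts at
   s with length m, and J is membership in b. *)
have /trajectP[s sk yE] := yx.
have kk : k' = k by apply: orb_uniq oy _; rewrite yE; apply: orb_iter.
have mk' : (0 < m < k)%N by rewrite -kk.
pose J := in_arc k s m.
have XS q : (q < k)%N -> (X q \in S) = J q.
  move=> qk; rewrite (mem_supp_arc gb) yE.
  apply/trajectP/idP => [[j jm /eqP]|].
    rewrite -iterD (orb_eq ox) modn_small // /J /in_arc; case: (ltnP (j + s) k) => h.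
      by rewrite modn_small // => /eqP; clear -jm; lia.
    rewrite -(subnK h) modnDr modn_small => [/eqP|]; clear -jm h mk' sk; lia.
  rewrite /J /in_arc => /orP[h|h].
    by exists (q - s)%N; [clear -h; lia|rewrite -iterD subnK //; case/andP: h].
  exists (q + k - s)%N; first by clear -h sk; lia.
  rewrite -iterD subnK; last by clear -sk; lia.
  by apply/eqP; rewrite (orb_eq ox) modnDr.
have sabP : reflect (forall q, (q < l)%N -> J q) (all (fun z => z \in S) (supp A d P a)).
  apply: (iffP allP) => [h q ql|h z].
    by rewrite -XS ?(ltn_trans ql) //; apply: h; rewrite mem_supp_orb // (ltn_trans ql).
  rewrite (mem_supp_arc ga) => /trajectP[j jl ->].
  by rewrite -/(X j) XS ?h // (ltn_trans jl).
have sbaP : reflect (forall q, (q < k)%N -> J q -> (q < l)%N)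
    (all (fun z => z \in supp A d P a) S).
  apply: (iffP allP) => [h q qk Jq|h z zS].
    by rewrite -mem_supp_orb //; apply: h; rewrite XS.
  have : z \in traject (cox A) x k.
    move: zS; rewrite (mem_supp_arc gb) yE => /trajectP[j _ ->].
    by rewrite -iterD; apply: mem_orb.
  by move=> /trajectP[q qk zE]; rewrite zE mem_supp_orb // h // -XS // /X -zE.
have nboth : ~~ (all (fun z => z \in S) (supp A d P a) && all (fun z => z \in supp A d P a) S).
  apply: contra nab => /andP[/allP h1 /allP h2]; rewrite (sum_supp ga) (sum_supp gb).
  apply/eqP/perm_big/uniq_perm; [exact: supp_uniq|exact: supp_uniq|].
  by move=> z; apply/idP/idP => [/h1|/h2].
have fullP : component_full A d P a b <-> forall q, (q < k)%N -> (q < l)%N || J q.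
  split=> [/component_fullP[_ h] q qk|h].
    by have := h q qk; rewrite mem_cat mem_supp_orb // XS.
  apply/component_fullP; split=> // q qk; rewrite mem_cat mem_supp_orb // XS //; exact: h.
rewrite /proper_sub -/S; set sab := all _ _ in sabP nboth *; set sba := all _ _ in sbaP nboth *.
have -> : sab && ~~ sba || sba && ~~ sab = sab || sba.
  by move: nboth; case: (sab); case: (sba).
case: asboolP => [/fullP full|nfull].
  (* Two proper arcs that cover the cycle cannot be nested, since the larger one would be the whole
     cycle. *)
  suff [-> ->] : sab = false /\ sba = false by [].
  split.
    apply/negP => /sabP h; have [q qk /negP] := in_arc_gap mk' sk; apply; have := full q qk.
    by case: (ltnP q l) => // ql _; apply: h.
  have kl : (k.-1 < l)%N = false by clear -lk; lia.
  apply/negP => /sbaP h; have := full k.-1 k1; rewrite kl => /= /(h _ k1).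
  by rewrite kl.
rewrite pair_adj /arc_value coxinv_orb0 lE -[x \in S]/(X 0%N \in S) !XS //; last by clear -lk; lia.
rewrite -[(X l == _)]/(X l == X k.-1) (orb_eq ox) !modn_small //.
have [q0 q0k q0J] : exists2 q, (q < k)%N & ~~ ((q < l)%N || J q).
  apply: contrapT => nex; apply: nfull; apply/fullP => q qk.
  by apply/negPn/negP => h; apply: nex; exists q.
move: q0J; rewrite negb_or -leqNgt => /andP[q0l q0J].
have nsab : ~~ sab -> exists2 q, (q < l)%N & ~~ J q.
  move=> /sabP h; apply: contrapT => nex; apply: h => q ql.
  by apply/negPn/negP => h; apply: nex; exists q.
have nsba : ~~ sba -> exists2 q, (l <= q < k)%N & J q.
  move=> /sbaP h; apply: contrapT => nex; apply: h => q qk Jq.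
  by rewrite ltnNge; apply/negP => lq; apply: nex; exists q; rewrite ?lq.
(* If b contains a, the candidates are J (k-1) - 1 and J l - 1, and b contains a neighbour of a. If
   a contains b, they are - J (l-1) and - J 0, and b misses an end of a. In both cases the maximum
   is 0. *)
have [sabT|sabF] := boolP sab => /=.
  have /nsba[q lq Jq] : ~~ sba by move: nboth; rewrite sabT.
  move/sabP: sabT => sabT.
  have J0 : J 0%N by apply: sabT.
  have Jl : J l.-1 by apply: sabT; rewrite ltn_predL.
  have := in_arc_superset lk mk' sk J0 Jl Jq lq; rewrite -!/(J _) J0 Jl.
  by case: (J k.-1) (J l) => -[] // _; apply/esym/max_eqP.
have [qa qal Jqa] := nsab sabF.
have [sbaT|sbaF] := boolP sba.
  move/sbaP: sbaT => h.
  have Jk : J k.-1 = false by apply/negP => /(h _ k1); clear -lk; lia.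
  have Jl : J l = false by apply/negP => /(h _ lk'); rewrite ltnn.
  have := in_arc_subset lk mk' sk Jk Jl qal Jqa; rewrite -!/(J _) Jk Jl.
  by case: (J 0%N) (J l.-1) => -[] // _; apply/esym/max_eqP.
have [qb lqb Jqb] := nsba sbaF.
have lq0 : (l <= q0 < k)%N by rewrite q0l.
have := in_arc_overlap lk mk' sk lq0 q0J qal Jqa lqb Jqb; rewrite -!/(J _) => -[].
- move=> [Jk /negPf Jl h1 h2]; apply/esym; rewrite Jk Jl.
  have [lE'|ne] := eqVneq l k.-1; first rewrite (h1 lE'); last rewrite (negPf (h2 ne)).
    by apply: max_eqP => //; case: (J 0%N).
  by apply: max_eqP => //; case: (J 0%N).
- move=> [Jl /negPf J0 /negPf Jk]; rewrite Jl J0 Jk addn0 if_same; apply/esym.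
  by apply: max_eqP => //; case: (J l.-1).
- move=> [/negPf Jk /negPf Jl]; rewrite Jk Jl if_same; apply/esym.
  have := in_arc_subset lk mk' sk Jk Jl qal Jqa; rewrite -!/(J _).
  by case: (J 0%N) (J l.-1) => -[] // _; apply: max_eqP.
Qed.

End ArcPair.

(** * Existence and uniqueness of the degree in affine type *)

Hypothesis dv_def : is_delta A^T dv.

(** By the symmetry of d_i a_ij the vector with entries d_i [delta : alpha_i] lies in the kernel of
    A^T, which is a line. *)
Lemma dv_delta : exists2 lam, 0 < lam & forall i, dv 0 i = lam * (d i * delta 0 i).
Proof.
have [[dv0 _ kdv] pdv _] := dv_def.
pose w : 'rV[rat]_n := \row_i (d i * delta 0 i).
have wE i : w 0 i = d i * delta 0 i by rewrite mxE.
have w0 i : 0 < w 0 i by rewrite wE mulr_gt0 ?delta_gt0.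
have wn0 : w != 0 by apply: contraTneq (w0 aff) => ->; rewrite mxE ltxx.
have kw i : pairc A^T i w = 0.
  rewrite -[RHS](mulr0 (d i)) -(pairc_delta i) /pairc mulr_sumr; apply: eq_bigr => j _.
  rewrite wE mxE mulrA [_ * d j]mulrC mulrA; case: cartan => _ _ _ _ ->; ring.
have rA : \rank (map_mx (fun z : int => z%:~R : rat) A^T) = n.-1.
  by case: affA => _ _ <-; rewrite -map_trmx mxrank_tr.
have [lam lamE] := kernel_line aff rA wn0 kw (kdv : forall i, pairc A^T i dv = 0).
have E i : dv 0 i = lam * (d i * delta 0 i) by rewrite lamE mxE wE.
exists lam => //; rewrite lt_def; apply/andP; split.
  by apply: contra dv0 => /eqP l0; rewrite lamE l0 scale0r.
by have := pdv aff; rewrite lamE mxE pmulr_lge0.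
Qed.

Lemma rootlike_neq_delta v : rootlike A d v -> v != delta.
Proof. by case=> v0 _ _; apply: contraTneq v0 => ->; rewrite ef_delta2 ltxx. Qed.

Lemma tau_delta : tau A delta = delta.
Proof.
rewrite tauE; elim: (enum _) => //= i l ->; rewrite sigma_pos; last exact: delta_pos.
by rewrite /refl pairc_delta scale0r subr0.
Qed.

Local Notation Phi := (PhiC_aff A d aff delta g).
Local Notation Ups := (Ups_re A d aff g).

Lemma Ups_ups v : Ups v -> [/\ real_root A v, pos v & ef A d delta v = 0].
Proof. by case=> rv pv /UcE. Qed.

Lemma Ups_cox v : Ups v -> Ups (cox A v).
Proof.
move=> Uv; have [rv pv ev] := Ups_ups Uv; case: Uv => _ _ _ [m hm]; split.
- exact: real_root_cox.
- exact: U_cox_pos (real_rootlike cartan rv) pv ev.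
- by apply/UcE; rewrite ef_delta_cox.
- case: hm => [|h]; last by exists m.+1; right; rewrite iterSr (coxK cartan).
  by case: m => [|m] h; [exists 1%N; right; rewrite /= (coxK cartan)|exists m; left; rewrite -iterSr].
Qed.
Lemma Ups_coxinv v : Ups v -> Ups (coxinv A v).
Proof.
move=> Uv; have [rv pv ev] := Ups_ups Uv; case: Uv => _ _ _ [m hm]; split.
- exact: real_root_coxinv.
- exact: U_coxinv_pos (real_rootlike cartan rv) pv ev.
- by apply/UcE; rewrite ef_delta_coxinv.
- case: hm => [h|]; first by exists m.+1; left; rewrite iterSr (coxinvK cartan).
  by case: m => [|m] h; [exists 1%N; left; rewrite /= (coxinvK cartan)|exists m; right; rewrite -iterSr].
Qed.

Lemma Ups_tau v : Ups v -> tau A v = cox A v.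
Proof.
move=> Uv; have [rv pv ev] := Ups_ups Uv; have [_ pc _] := Ups_ups (Ups_cox Uv).
exact: (tau_cox cartan aff_sgn (real_rootlike cartan rv)).
Qed.

Lemma Ups_negF i : ~ Ups (- sroot i).
Proof. by case=> _ /(_ i); rewrite oppE srootii; row_lra. Qed.
Lemma Ups_deltaF : ~ Ups delta.
Proof.
by move=> /Ups_ups[/(real_rootlike cartan)/rootlike_neq_delta]; rewrite eqxx.
Qed.

Lemma Phi_realP v : real_root A v -> pos v -> ef A d delta v != 0 -> Phi v.
Proof. by move=> rv pv ev; apply: Or42; split=> //; [left|move/UcE/eqP; apply/negP]. Qed.

Lemma Phi_cases v : Phi v ->
  [\/ exists i, v = - sroot i, [/\ real_root A v, pos v & ef A d delta v != 0],
      Ups v | v = delta].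
Proof.
case=> [|[[rv|[_ _ kv]] pv nU]||]; [exact: Or41| | |exact: Or43|exact: Or44].
  by apply: Or42; split=> //; apply/eqP => /UcE.
have [s vE] := aff_rad kv; case: nU; apply/UcE.
by rewrite vE efZr ef_delta2 mulr0.
Qed.

Lemma Phi_neg i : Phi (- sroot i).
Proof. by apply: Or41; exists i. Qed.

Lemma Phi_tau v : Phi v -> Phi (tau A v).
Proof.
case/Phi_cases => [[i ->]|[rv pv ev]|Uv|->].
- have [_ [ru pu /projtype_delta pr]] := tau_negsimple cartan aff_sgn i.
  by apply: Phi_realP => //; rewrite lt_eqF.
- have [[pc ->]|[i [-> _]]] := tau_pos cartan aff_sgn (real_rootlike cartan rv) pv.
    by apply: Phi_realP => //; [apply: real_root_cox|rewrite ef_delta_cox].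
  exact: Phi_neg.
- by rewrite Ups_tau //; apply/Or43/Ups_cox.
- by rewrite tau_delta; apply: Or44.
Qed.

Lemma Phi_surj v : Phi v -> exists2 w, Phi w & tau A w = v.
Proof.
case/Phi_cases => [[i ->]|[rv pv ev]|Uv|->].
- have [x [rx px xi _]] := injtype_ex cartan aff_sgn i; exists x.
    by apply: Phi_realP => //; rewrite gt_eqF // (injtype_delta xi).
  exact: (tau_injtype cartan aff_sgn (real_rootlike cartan rx)).
- have rlv := real_rootlike cartan rv.
  have [pc|npc] := pselect (pos (coxinv A v)); last first.
    have [i -> _] := coxinv_npos cartan aff_sgn rlv pv npc.
    by exists (- sroot i) => //; apply: Phi_neg.
  have rc := real_root_coxinv rv; exists (coxinv A v).
    by apply: Phi_realP => //; rewrite ef_delta_coxinv.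
  by rewrite (tau_cox cartan aff_sgn (real_rootlike cartan rc)) ?(coxinvK cartan).
- have Uc := Ups_coxinv Uv; exists (coxinv A v); first exact: Or43.
  by rewrite Ups_tau // (coxinvK cartan).
- by exists delta; [exact: Or44|exact: tau_delta].
Qed.

Lemma Phi_reaches v : Phi v -> [\/ reaches_neg A v, Ups v | v = delta].
Proof.
case/Phi_cases => [[i ->]|[rv pv ev]|Uv|->]; [|apply: Or31|exact: Or32|exact: Or33].
  by apply: Or31; exists 0%N, i; left.
have rlv := real_rootlike cartan rv.
have [[m hm]|n1] := pselect (exists m, ~ pos (iter m (cox A) v)).
  have [q [i [E _]]] := forward_exit cartan aff_sgn rlv pv (ex_intro _ m hm).
  by exists q.+1, i; left.
have [[m hm]|n2] := pselect (exists m, ~ pos (iter m (coxinv A) v)).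
  have [q [i [E _ _]]] := backward_exit cartan aff_sgn rlv pv (ex_intro _ m hm).
  by exists q.+1, i; right.
case/eqP: ev; apply: regular_U => //; split=> m; apply: contrapT => h.
  by apply: n1; exists m.
by apply: n2; exists m.
Qed.

Lemma Ups_tau_iff v : Phi v -> Ups (tau A v) -> Ups v.
Proof.
case/Phi_cases => [[i ->]|[rv pv ev]|//|->].
- have [_ [ru pu /projtype_delta pr]] := tau_negsimple cartan aff_sgn i.
  by move=> /Ups_ups[_ _ e0]; move: pr; rewrite e0 ltxx.
- have [[pc ->]|[i [-> _]]] := tau_pos cartan aff_sgn (real_rootlike cartan rv) pv.
    by move=> /Ups_ups[_ _]; rewrite ef_delta_cox => /eqP; rewrite (negPf ev).
  by move=> /Ups_negF.
- by rewrite tau_delta => /Ups_deltaF.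
Qed.

Lemma full_cox u v : Ups u -> Ups v ->
  component_full A d P u v <-> component_full A d P (cox A u) (cox A v).
Proof.
move=> /Ups_re_arc[x [k [l ga]]] /Ups_re_arc[y [k' [m gb]]].
have ox : orb x k by case: ga.
rewrite (component_fullP ga gb) (component_fullP (good_arc_cox ga) (good_arc_cox gb)).
have h q : (iter q (cox A) (cox A x) \in supp A d P (cox A u) ++ supp A d P (cox A v)) =
           (iter q (cox A) x \in supp A d P u ++ supp A d P v).
  by rewrite -iterSr iterS !mem_cat (mem_supp_cox _ ga) (mem_supp_cox _ gb).
have t : (cox A y \in traject (cox A) (cox A x) k) = (y \in traject (cox A) x k).
  apply/trajectP/trajectP => -[j jk E]; exists j => //.
    by apply: (can_inj (coxK cartan)); rewrite E -iterSr iterS.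
  by rewrite E -iterS iterSr.
by rewrite t; split=> -[h1 h2]; split=> // q qk; have := h2 q qk; rewrite h.
Qed.

Lemma adj_cox u v : Ups u -> Ups v -> adj A d P (cox A u) (cox A v) = adj A d P u v.
Proof.
move=> /Ups_re_arc[x [k [l ga]]] /Ups_re_arc[y [k' [m gb]]].
have E z : (z \in supp A d P (cox A v)) = (coxinv A z \in supp A d P v).
  by rewrite -{1}(coxinvK cartan z) (mem_supp_cox _ gb).
rewrite (pair_adj v ga) (pair_adj (cox A v) (good_arc_cox ga)) !E -iterSr iterS !(coxK cartan).
by rewrite (can2_eq (coxK cartan) (coxinvK cartan)).
Qed.

Section Degree.
Variable lamd : rat.
Hypothesis lamd0 : 0 < lamd.
Hypothesis lamdE : forall i, dv 0 i = lamd * (d i * delta 0 i).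

(** As K (delta, delta) = 0, the scalar of delta cannot be 2 / K; it is the factor supplied by
    [dv_delta]. *)
Definition coroot_scale v : rat := if v == delta then lamd else 2 / Kf A d v v.

Lemma corc_affE v : corc_aff A d delta dv v = (fun i => coroot_scale v * (d i * v 0 i)).
Proof.
apply/funext => i; rewrite /corc_aff /coroot_scale; case: eqP => [->|_]; first exact: lamdE.
by rewrite (corcE A d v).
Qed.

Lemma coroot_scaleE v : rootlike A d v -> coroot_scale v = 2 / Kf A d v v.
Proof. by move=> /rootlike_neq_delta/negPf h; rewrite /coroot_scale h. Qed.

Lemma coroot_scale_neg i : coroot_scale (- sroot i) = (d i)^-1.
Proof.
by rewrite coroot_scaleE ?(corc_sroot cartan) //; apply/rootlikeN/(rootlike_sroot cartan).
Qed.

Lemma Phi_tau_case v : Phi v -> tau_case A d v (coroot_scale v) (coroot_scale (tau A v)).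
Proof.
move=> Pv; have [vE|nvd] := eqVneq v delta.
  rewrite vE tau_delta /coroot_scale eqxx; apply: TauCox; rewrite ?cox_delta ?tau_delta //.
  - exact: ltW.
  - exact: delta_pos.
  - exact: delta_pos.
have cs : (rootlike A d v /\ pos v) \/ (exists i, v = - sroot i).
  case/Phi_cases: Pv => [|[rv pv _]|/Ups_ups[rv pv _]|vE]; first by right.
  - by left; split=> //; apply: real_rootlike.
  - by left; split=> //; apply: real_rootlike.
  - by rewrite vE eqxx in nvd.
have rt : rootlike A d (tau A v).
  case: cs => [[rv pv]|[i ->]]; last first.
    by have [_ [/(real_rootlike cartan)]] := tau_negsimple cartan aff_sgn i.
  have [[_ ->]|[i [-> _]]] := tau_pos cartan aff_sgn rv pv; first exact: rootlike_cox.
  exact/rootlikeN/(rootlike_sroot cartan).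
rewrite (coroot_scaleE rt) {1}/coroot_scale (negPf nvd).
exact: (tau_caseP cartan aff_sgn cs).
Qed.

Local Notation deg := (compat_aff A d aff delta dv g P).

Lemma degE a b : ~ (Ups a /\ Ups b) -> deg a b = cpt A d (coroot_scale a) a b.
Proof.
move=> h; rewrite /compat_aff corc_affE asboolF // => -[Ua Ub _].
by apply: h.
Qed.

Lemma deg_Ups a b : Ups a -> Ups b -> deg a b =
  if `[< component_full A d P a b >] then (adj A d P a b)%:R
  else cpt A d (coroot_scale a) a b.
Proof.
move=> Ua Ub; rewrite /compat_aff corc_affE.
by congr (if _ then _ else _); apply/asbool_equiv_eq; split=> [[]|].
Qed.

Lemma deg_circ a b : Ups a -> Ups b -> deg a b = compat_circ A d P a b.
Proof.
move=> Ua Ub; rewrite deg_Ups //.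
have [x [k [l ga]]] := Ups_re_arc Ua; have [y [k' [m gb]]] := Ups_re_arc Ub.
rewrite (arc_circ ga gb); congr (if _ then _ else _).
have [/(real_rootlike cartan) ra pa _] := Ups_ups Ua; have [_ pb _] := Ups_ups Ub.
have [a0 _ _] := ra; have e0 : ef A d x x != 0 by rewrite -(arc_halfnorm ga) gt_eqF.
rewrite coroot_scaleE // (inv_norm cartan) (cpt_pos cartan) ?invr_ge0 ?(ltW a0) //.
rewrite (pair_efl ga gb) (pair_efr ga gb) (arc_halfnorm ga) !mulKf // !opprB.
by [].
Qed.

Lemma deg_tau a b : Phi a -> Phi b -> deg a b = deg (tau A a) (tau A b).
Proof.
move=> Pa Pb; have ct := cpt_tau cartan (Phi_tau_case Pa) (Phi_tau_case Pb).
have [[Ua Ub]|nU] := pselect (Ups a /\ Ups b); last first.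
  rewrite !degE //; case=> /(Ups_tau_iff Pa) ? /(Ups_tau_iff Pb) ?; exact: nU.
rewrite (deg_Ups Ua Ub) ct (Ups_tau Ua) (Ups_tau Ub) (deg_Ups (Ups_cox Ua) (Ups_cox Ub)).
rewrite (adj_cox Ua Ub); congr (if _ then _ else _).
by apply/asbool_equiv_eq/full_cox.
Qed.

Lemma aff_degree : tau_degree A Phi (corc_aff A d delta dv) deg.
Proof.
split=> [i b _|i b _|a b]; last exact: deg_tau.
  by rewrite degE ?coroot_scale_neg ?(cpt_negl cartan) // => -[/Ups_negF].
by rewrite degE ?cpt_negr ?corc_affE // => -[_ /Ups_negF].
Qed.

Lemma deg_delta a : Ups a \/ a = delta -> deg delta a = 0 /\ deg a delta = 0.
Proof.
move=> ha; have [pa ea] : pos a /\ ef A d delta a = 0.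
  by case: ha => [/Ups_ups[]|->] //; split; [apply: delta_pos|apply: ef_delta2].
have la : 0 <= coroot_scale a.
  rewrite /coroot_scale; case: eqP => _; first exact: ltW.
  by rewrite divr_ge0 // aff_Kge0.
rewrite !degE; [|by case=> _ /Ups_deltaF|by case=> /Ups_deltaF].
rewrite !(cpt_pos cartan) ?(ef_deltar a) ?ea ?oppr0 ?mulr0 ?oppr0 ?maxxx //; try exact: delta_pos.
by rewrite /coroot_scale eqxx ltW.
Qed.

End Degree.

Theorem aff_compat_unique :
  axioms_aff A d aff delta dv g P (compat_aff A d aff delta dv g P) /\
  (forall f : 'rV[rat]_n -> 'rV[rat]_n -> rat, axioms_aff A d aff delta dv g P f ->
     forall a b, PhiC_aff A d aff delta g a -> PhiC_aff A d aff delta g b ->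
       f a b = compat_aff A d aff delta dv g P a b).
Proof.
have [lam lam0 lamE] := dv_delta; have dg := aff_degree lam0 lamE.
split=> [|f [f1 f2 f3 f4 f5] a b Pa Pb].
  case: dg => h1 h2 h3; split=> //; first exact: (deg_circ lamE).
  exact: (deg_delta lam0 lamE).
have df : tau_degree A Phi (corc_aff A d delta dv) f by split.
have uq := degree_uniq Phi_tau Phi_surj Phi_neg df dg Pa Pb.
case: (Phi_reaches Pa) => [ra|Ua|aE]; first by apply: uq; left.
  case: (Phi_reaches Pb) => [rb|Ub|->]; first by apply: uq; right.
    by rewrite f3 // (deg_circ lamE).
  by have [_ ->] := f4 a (or_introl Ua); have [_ ->] := deg_delta lam0 lamE (or_introl Ua).
case: (Phi_reaches Pb) => [rb|Ub|bE]; first by apply: uq; right.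
  by rewrite aE; have [-> _] := f4 b (or_introl Ub); have [-> _] := deg_delta lam0 lamE (or_introl Ub).
by rewrite aE; have [-> _] := f4 b (or_intror bE); have [-> _] := deg_delta lam0 lamE (or_intror bE).
Qed.

End Affine.

Theorem theorem4p6 :
  (* finite type *)
  (forall (n : nat) (A : 'M[int]_n) (d : 'I_n -> rat),
     sym_cartan A d -> finite_type A d ->
     axioms_fin A d (compat_fin A d) /\
     (forall f : 'rV[rat]_n -> 'rV[rat]_n -> rat, axioms_fin A d f ->
        forall a b, PhiC_fin A a -> PhiC_fin A b -> f a b = compat_fin A d a b)) /\
  (* affine type *)
  (forall (n : nat) (A : 'M[int]_n) (d : 'I_n -> rat)
          (delta dv : 'rV[rat]_n) (aff : 'I_n) (g : 'rV[rat]_n)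
          (P : seq 'rV[rat]_n),
     sym_cartan A d -> affine_type A d ->
     is_delta A delta -> is_delta A^T dv -> affine_node A delta dv aff ->
     g 0 aff = 0 -> cox A g = g + delta ->
     is_Pic A d g P ->
     axioms_aff A d aff delta dv g P (compat_aff A d aff delta dv g P) /\
     (forall f : 'rV[rat]_n -> 'rV[rat]_n -> rat, axioms_aff A d aff delta dv g P f ->
        forall a b, PhiC_aff A d aff delta g a -> PhiC_aff A d aff delta g b ->
          f a b = compat_aff A d aff delta dv g P a b)).
Proof.
split=> [n A d cartan fin|
         n A d delta dv aff g P cartan affA ddef dvdef [_ node] _ gdef Pic].
  exact: fin_compat_unique.
exact: (aff_compat_unique cartan affA ddef gdef Pic node dvdef).
Qed.
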